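(* Let $n\ge1$ and let $\Omega\subset\mathbb R^{n+1}$ be a domain with nonempty $C^2$ boundary which is weakly mean convex, i.e. $H(y)\ge0$ for all $y\in\partial\Omega$, and let $H_0:=\inf_{y\in\partial\Omega}H(y)$. Let $p>1$ and set $$\lambda(n,p,\Omega)=\left(\frac{p-1}{p}\right)^{p-1}\inf_{x\in\Omega\setminus S}\frac{-\Delta\delta(x)}{\delta(x)^{p-1}} .$$ Then $\lambda(n,p,\Omega)\ge\frac{p}{n^{p-1}}H_0^p$, and for every $f\in C_0^\infty(\Omega)$, $$\int_\Omega|\nabla f|^p\,dx\ \ge\ \left(\frac{p-1}{p}\right)^p\int_\Omega\frac{|f|^p}{\delta^p}\,dx+\lambda(n,p,\Omega)\int_\Omega|f|^p\,dx .$$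
   Context: A domain is an open connected subset of Euclidean space; its boundary is $C^2$ if near each boundary point the domain is, after a rotation, the region on one side of the graph of a $C^2$ function. $\delta(x)=\inf_{y\in\mathbb R^{n+1}\setminus\Omega}|x-y|$. For $y\in\partial\Omega$, $\kappa_1(y),\dots,\kappa_n(y)$ are the principal curvatures of $\partial\Omega$ at $y$ with respect to the outward unit normal, with the sign convention that they all equal $1$ when $\Omega$ is the unit ball, and $H(y)=\sum_{i=1}^n\kappa_i(y)$ is the mean curvature. The good set $G\subset\Omega$ is the largest open subset of $\Omega$ such that every $x\in G$ has a unique nearest point on $\partial\Omega$; $S=\Omega\setminus G$ is the singular set (it has Lebesgue measure zero). One has $\delta\in C^2(G)$, so $\Delta\delta$ is defined classically on $G=\Omega\setminus S$. *)

(* Defs.v *)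
From HB Require Import structures.
From mathcomp Require Import all_boot all_order all_algebra.
From mathcomp Require Import all_classical all_reals all_analysis.

Set Implicit Arguments.
Unset Strict Implicit.
Unset Printing Implicit Defensive.

Import Order.TTheory GRing.Theory Num.Theory.
Import numFieldNormedType.Exports.

Local Open Scope classical_set_scope.
Local Open Scope ring_scope.

(* Points of R^m are row vectors.  The
   library norm on 'rV[R]_m is the sup norm: it is used only through the
   topology and the derivatives it induces, lengths being measured by the
   Euclidean norm [enorm] below. *)

Section measurable_rV.
Context {d : measure_display} {T : sigmaRingType d}.
Variable n : nat.

Let coors : 'I_n -> 'rV[T]_n -> T := fun i v => v ord0 i.

Let rV_set0 : g_sigma_preimage coors set0.
Proof. exact: sigma_algebra0. Qed.

Let rV_setC A : g_sigma_preimage coors A -> g_sigma_preimage coors (~` A).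
Proof. exact: sigma_algebraC. Qed.

Let rV_bigcup (F : _^nat) : (forall i, g_sigma_preimage coors (F i)) ->
  g_sigma_preimage coors (\bigcup_i (F i)).
Proof. exact: sigma_algebra_bigcup. Qed.

(* The sigma-algebra generated by the coordinates, as for [n.-tuple T] in the
   library.  Over R it is the Borel sigma-algebra of R^n. *)
HB.instance Definition _ := @isMeasurable.Build (measure_tuple_display d)
  'rV[T]_n (g_sigma_preimage coors) rV_set0 rV_setC rV_bigcup.

Lemma measurable_rV_coord (i : 'I_n) :
  measurable_fun [set: 'rV[T]_n] (fun v : 'rV[T]_n => v ord0 i).
Proof.
move=> _ Y mY; rewrite setTI; apply: sub_sigma_algebra => /=.
rewrite -bigcup_seq/=; exists i => /=; first by rewrite mem_index_enum.
by exists Y => //; rewrite setTI.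
Qed.

Lemma measurable_fun_rV d1 (T1 : measurableType d1) (f : T1 -> 'rV[T]_n) :
  (forall i, measurable_fun [set: T1] (fun x => f x ord0 i)) ->
  measurable_fun [set: T1] f.
Proof.
move=> mf _ Y; rewrite setTI /measurable /= => mY.
have : g_sigma_preimage (fun i => coors i \o f) (f @^-1` Y).
  rewrite /g_sigma_preimage.
  move: mY; rewrite /g_sigma_preimage => mY.
  move=> B [sB genB].
  have := mY (image_set_system setT f B); rewrite /image_set_system /= setTI.
  apply; split; first exact: sigma_algebra_image.
  move=> A; rewrite -bigcup_seq /= => -[i _ [C mC]]; rewrite !setTI => <-.
  apply: genB; rewrite -bigcup_seq /=; exists i => //.
    by rewrite /= mem_index_enum.
  by exists C => //; rewrite setTI.
apply; split; first exact: sigma_algebra_measurable.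
move=> A; rewrite -bigcup_seq /= => -[i _ [C mC <-]].
exact: mf.
Qed.

End measurable_rV.

Section lebesgue_rV.
Context {R : realType}.

Definition rV_cons n (t : R) (z : 'rV[R]_n) : 'rV[R]_n.+1 :=
  row_mx t%:M z : 'rV[R]_(1 + n).

Definition rV_head n (x : 'rV[R]_n.+1) : R := x ord0 ord0.

Definition rV_tail n (x : 'rV[R]_n.+1) : 'rV[R]_n :=
  rsubmx (x : 'rV[R]_(1 + n)).

Lemma rV_cons0 n t (z : 'rV[R]_n) : rV_cons t z ord0 ord0 = t.
Proof.
rewrite /rV_cons (_ : ord0 = lshift n (ord0 : 'I_1)); last exact/val_inj.
by rewrite (row_mxEl t%:M z) mxE eqxx mulr1n.
Qed.

Lemma rV_consS n t (z : 'rV[R]_n) i : rV_cons t z ord0 (lift ord0 i) = z ord0 i.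
Proof.
rewrite /rV_cons (_ : lift ord0 i = rshift 1 i); last exact/val_inj.
by rewrite (row_mxEr t%:M z).
Qed.

Lemma rV_consK n t (z : 'rV[R]_n) : rV_tail (rV_cons t z) = z.
Proof. exact: row_mxKr. Qed.

Lemma rV_eta n (x : 'rV[R]_n.+1) : rV_cons (rV_head x) (rV_tail x) = x.
Proof.
apply/rowP => i; case: (unliftP ord0 i) => [j|] ->.
  rewrite rV_consS mxE; congr (x _ _); exact/val_inj.
by rewrite rV_cons0.
Qed.

Definition rV_consp n (p : measurableTypeR R * 'rV[R]_n) : 'rV[R]_n.+1 :=
  rV_cons p.1 p.2.

Lemma measurable_rV_consp n : measurable_fun setT (@rV_consp n).
Proof.
apply: measurable_fun_rV => i; rewrite /rV_consp.
case: (unliftP ord0 i) => [j|] ->.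
  under eq_fun do rewrite rV_consS.
  apply: (@measurableT_comp _ _ _ _ _ _ (fun v : 'rV[R]_n => v ord0 j)).
    exact: measurable_rV_coord.
  exact: measurable_snd.
under eq_fun do rewrite rV_cons0.
exact: measurable_fst.
Qed.

Lemma measurable_rV_tail n : measurable_fun setT (@rV_tail n).
Proof.
apply: measurable_fun_rV => i.
under eq_fun do rewrite /rV_tail mxE.
exact: measurable_rV_coord.
Qed.

Section step.
Variables (n : nat) (mu : {sigma_finite_measure set 'rV[R]_n -> \bar R}).

Definition lebesgue_rV_step : set 'rV[R]_n.+1 -> \bar R :=
  pushforward (@lebesgue_measure R \x mu)%E (@rV_consp n).

Let m : {measure set (measurableTypeR R * 'rV[R]_n) -> \bar R} :=
  (@lebesgue_measure R \x mu)%E.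

Let step0 : lebesgue_rV_step set0 = 0%E.
Proof. exact: (@measure0 _ _ _ m). Qed.

Let step_ge0 A : (0 <= lebesgue_rV_step A)%E.
Proof. exact: (measure_ge0 m). Qed.

Let step_sigma_additive : semi_sigma_additive lebesgue_rV_step.
Proof.
rewrite /lebesgue_rV_step -/m => F mF tF mUF; rewrite /pushforward preimage_bigcup.
apply: (measure_semi_sigma_additive (s := m)).
- by move=> k; rewrite -[X in measurable X]setTI; exact: measurable_rV_consp.
- apply/trivIsetP => /= i j _ _ ij; rewrite -preimage_setI.
  by move/trivIsetP : tF => /(_ _ _ _ _ ij) ->//; rewrite preimage_set0.
- rewrite -preimage_bigcup -[X in measurable X]setTI.
  exact: measurable_rV_consp.
Qed.

HB.instance Definition _ := isMeasure.Build _ _ _ lebesgue_rV_step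
  step0 step_ge0 step_sigma_additive.

Let lebesgue_rV_step_sigma_finite : sigma_finite setT lebesgue_rV_step.
Proof.
have /sigma_finiteP[F [TF ndF Foo]] := sigma_finiteT (@lebesgue_measure R).
have /sigma_finiteP[G [TG ndG Goo]] := sigma_finiteT mu.
exists (fun k => @rV_head n @^-1` F k `&` @rV_tail n @^-1` G k).
  apply/seteqP; split => // x _.
  have : [set: measurableTypeR R] (rV_head x) by [].
  have : [set: 'rV[R]_n] (rV_tail x) by [].
  rewrite TF TG => -[i _ Gi] [j _ Fj]; exists (maxn i j) => //; split.
    by have /subsetPset := ndF _ _ (leq_maxr i j); exact.
  by have /subsetPset := ndG _ _ (leq_maxl i j); exact.
move=> k; have [mF Fk] := Foo k; have [mG Gk] := Goo k; split.
  apply: measurableI.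
    rewrite -[X in measurable X]setTI.
    exact: (@measurable_rV_coord _ _ _ (ord0 : 'I_n.+1)).
  by rewrite -[X in measurable X]setTI; exact: measurable_rV_tail.
rewrite /lebesgue_rV_step /pushforward (_ : _ @^-1` _ = F k `*` G k).
  by rewrite product_measure1E// lte_mul_pinfty// ge0_fin_numE.
by apply/seteqP; split=> -[t z] /=;
  rewrite /rV_consp /rV_head /= rV_cons0 rV_consK.
Qed.

HB.instance Definition _ := Measure_isSigmaFinite.Build _ _ _ lebesgue_rV_step
  lebesgue_rV_step_sigma_finite.

End step.

(* Lebesgue measure on R^n, as the n-fold product of the library's Lebesgue
   measure on R. *)
Fixpoint lebesgue_rV n : {sigma_finite_measure set 'rV[R]_n -> \bar R} :=
  if n is n'.+1 then lebesgue_rV_step (lebesgue_rV n')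
  else \d_(0 : 'rV[R]_0).

End lebesgue_rV.

Section differential_calculus.
Context {R : realType}.

Definition enorm m (x : 'rV[R]_m) : R := Num.sqrt (\sum_i x ord0 i ^+ 2).

Definition partial m (i : 'I_m) (f : 'rV[R]_m -> R) : 'rV[R]_m -> R :=
  fun x => 'D_(delta_mx ord0 i) f x.

Definition grad m (f : 'rV[R]_m -> R) (x : 'rV[R]_m) : 'rV[R]_m :=
  \row_i partial i f x.

Definition laplacian m (f : 'rV[R]_m -> R) (x : 'rV[R]_m) : R :=
  \sum_i partial i (partial i f) x.

(* f is of class C^k on the open set U: all its partial derivatives of order
   at most k exist and are continuous on U. *)
Fixpoint Ck m (k : nat) (U : set 'rV[R]_m) (f : 'rV[R]_m -> R) : Prop :=
  (forall x, U x -> {for x, continuous f}) /\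
  (if k is k'.+1 then
     forall i : 'I_m,
       (forall x, U x -> derivable f x (delta_mx ord0 i)) /\
       Ck k' U (partial i f)
   else True).

Definition test_function m (Omega : set 'rV[R]_m) (f : 'rV[R]_m -> R) : Prop :=
  [/\ forall k, Ck k setT f,
      compact (closure [set x | f x != 0]) &
      closure [set x | f x != 0] `<=` Omega].

End differential_calculus.

Section domains.
Context {R : realType}.

Definition boundary m (Omega : set 'rV[R]_m) : set 'rV[R]_m :=
  closure Omega `\` Omega°.

Definition is_domain m (Omega : set 'rV[R]_m) : Prop :=
  open Omega /\ connected Omega.

(* After the rotation x |-> x *m Q, the set Omega is, near its boundary point
   y, the region above the graph of phi, the height being the first
   coordinate.  Taking the region above is no restriction, since in dimension
   n + 1 >= 2 a further rotation exchanges above and below. *)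
Definition local_graph n (Omega : set 'rV[R]_n.+1) (y : 'rV[R]_n.+1)
    (Q : 'M[R]_n.+1) (phi : 'rV[R]_n -> R) : Prop :=
  [/\ Q *m Q^T = 1%:M, \det Q = 1,
      exists U : set 'rV[R]_n, [/\ open U, U (rV_tail (y *m Q)) & Ck 2 U phi] &
      \forall x \near y,
        Omega x <-> phi (rV_tail (x *m Q)) < rV_head (x *m Q)].

Definition C2_boundary n (Omega : set 'rV[R]_n.+1) : Prop :=
  forall y, boundary Omega y -> exists Q phi, local_graph Omega y Q phi.

Definition graph_point n (Q : 'M[R]_n.+1) (phi : 'rV[R]_n -> R)
    (z : 'rV[R]_n) : 'rV[R]_n.+1 :=
  rV_cons (phi z) z *m Q^T.

(* The unit normal to the graph of phi pointing below it, that is, out of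
   Omega. *)
Definition graph_normal n (Q : 'M[R]_n.+1) (phi : 'rV[R]_n -> R)
    (z : 'rV[R]_n) : 'rV[R]_n.+1 :=
  (Num.sqrt (1 + enorm (grad phi z) ^+ 2))^-1
    *: (rV_cons (-1) (grad phi z) *m Q^T).

(* The matrix of the differential of the unit normal, an endomorphism of the
   tangent space of the graph at graph_point Q phi z, in the basis of the
   coordinate tangent vectors.  For the unit ball the outward normal at y is y
   itself, so that W is the identity. *)
Definition is_shape_matrix n (Q : 'M[R]_n.+1) (phi : 'rV[R]_n -> R)
    (z : 'rV[R]_n) (W : 'M[R]_n) : Prop :=
  forall i : 'I_n,
    'D_(delta_mx ord0 i) (graph_normal Q phi) z =
    \sum_j W i j *: 'D_(delta_mx ord0 j) (graph_point Q phi) z.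

(* The entries of k are the eigenvalues, with multiplicity, of the
   differential of the outward unit normal at y. *)
Definition are_principal_curvatures n (Omega : set 'rV[R]_n.+1)
    (y : 'rV[R]_n.+1) (k : 'rV[R]_n) : Prop :=
  exists Q phi W,
    [/\ local_graph Omega y Q phi,
        is_shape_matrix Q phi (rV_tail (y *m Q)) W &
        char_poly W = \prod_(i < n) ('X - (k ord0 i)%:P)].

(* Along a C^2 boundary the principal curvatures exist and do not depend on
   the local graph; only their order is chosen arbitrarily here. *)
Definition principal_curvatures n (Omega : set 'rV[R]_n.+1)
    (y : 'rV[R]_n.+1) : 'rV[R]_n :=
  xget 0 [set k | are_principal_curvatures Omega y k].

Definition mean_curvature n (Omega : set 'rV[R]_n.+1) (y : 'rV[R]_n.+1) : R :=
  \sum_(i < n) principal_curvatures Omega y ord0 i.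

Definition weakly_mean_convex n (Omega : set 'rV[R]_n.+1) : Prop :=
  forall y, boundary Omega y -> 0 <= mean_curvature Omega y.

Definition dist_compl m (Omega : set 'rV[R]_m) (x : 'rV[R]_m) : R :=
  inf [set enorm (x - y) | y in ~` Omega].

Definition nearest_point m (Omega : set 'rV[R]_m) (x y : 'rV[R]_m) : Prop :=
  boundary Omega y /\
  forall z, boundary Omega z -> enorm (x - y) <= enorm (x - z).

Definition good_set m (Omega : set 'rV[R]_m) : set 'rV[R]_m :=
  \bigcup_(U in [set U : set 'rV[R]_m |
      [/\ open U, U `<=` Omega &
          forall x, U x -> exists! y, nearest_point Omega x y]]) U.

Definition singular_set m (Omega : set 'rV[R]_m) : set 'rV[R]_m :=
  Omega `\` good_set Omega.

Local Open Scope ereal_scope.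

(* The infima are taken in the extended reals. *)
Definition inf_mean_curvature n (Omega : set 'rV[R]_n.+1) : \bar R :=
  ereal_inf [set (mean_curvature Omega y)%:E | y in boundary Omega].

Definition hardy_lambda n (p : R) (Omega : set 'rV[R]_n.+1) : \bar R :=
  (((p - 1) / p) `^ (p - 1))%:E *
  ereal_inf [set (- laplacian (dist_compl Omega) x /
                    dist_compl Omega x `^ (p - 1))%:E
            | x in Omega `\` singular_set Omega].

End domains.

(* Main.v *)
(* Write d for the distance to the complement.  A point x strictly inside a minimal segment from
   a boundary point y has invertible second variation of the squared distance to the boundary, so
   the implicit function theorem makes the nearest point unique near x and d twice differentiable
   there.  Conversely every good point is of this kind.  At such a point, comparing d(x + h e_i)
   with the distance to well chosen boundary points gives
     d Lap d <= n (1 - a)^2 - a^2 d H(y)   for every real a,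
   and optimising in a yields - Lap d >= H / (1 - d H / n), with d H < n, hence the lower bound
   on lambda by the weighted arithmetic-geometric mean inequality.

   For the integral inequality the distributional bound on - Lap d across the singular set is
   replaced by finite differences.  With w = |f| / d and psi = d w^p, the discrete divergence
     E_h(x) = sum_i [psi(x) (d(x) - d(x - h e_i)) - psi(x + h e_i) (d(x + h e_i) - d(x))] / h^2
   integrates to 0 and is bounded below.  Its lower limit as h -> 0 is at least
     l |f|^p + c w^p - c^(1-p) |grad f|^p,   c = (p - 1) / p,   lambda = c^(p-1) l,
   at every point: where f = 0 it is nonnegative and the bound is not positive; where the nearest
   point is not unique the second differences of d tend to minus infinity; and where it is unique
   the second differences are controlled by those at inner points of the minimal segment, the
   rest being Young's inequality.  Fatou's lemma concludes. *)
Require Import Defs.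
From HB Require Import structures.
From mathcomp Require Import all_boot all_order all_algebra.
From mathcomp Require Import all_classical all_reals all_analysis.
From mathcomp Require Import measurable_realfun complex ring lra.
Set Implicit Arguments.
Unset Strict Implicit.
Unset Printing Implicit Defensive.
Import Order.TTheory GRing.Theory Num.Theory.
Import numFieldNormedType.Exports.
Local Open Scope classical_set_scope.
Local Open Scope ring_scope.

(** * Euclidean geometry *)

Section euclid.
Context {R : realType}.
Implicit Types m : nat.

(** Obstacle: [d] is merely Lipschitz across the singular set, where - Lap d may carry a singular
    part, so integration by parts is replaced by translation invariance of the measure, applied to a
    flux built on [psi]. Origin of [psi] = d^(1-p) |f|^p: where [d] is smooth, psi (- Lap d) >= l
    d^(p-1) psi = l |f|^p, and - <grad psi, grad d> = (p - 1) w^p - p w^(p-1) sgn f <grad f, grad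
    d>. Young's inequality is weighted so as to spend (p - 1) c w^p, which leaves (p - 1) (1 - c)
    w^p = c w^p. Origin of the parameter a: when x moves along e_i, the competing boundary point
    moves along a times the tangential part of e_i. Inner points of minimal segments come in because
    at the far end of such a segment, possibly a focal point, the second variation may degenerate.
    Strictly inside, the competition from the far end makes it positive definite, with the explicit
    lower bound 1 - k at the fraction k of the segment. *)

Definition dot m (u v : 'rV[R]_m) : R := \sum_i u ord0 i * v ord0 i.

Lemma dotE m (u v : 'rV[R]_m) : dot u v = (u *m v^T) ord0 ord0.
Proof. by rewrite mxE; apply: eq_bigr => i _; rewrite mxE. Qed.

Lemma dotC m (u v : 'rV[R]_m) : dot u v = dot v u.
Proof. by apply: eq_bigr => i _; rewrite mulrC. Qed.

Lemma dotDl m (u v w : 'rV[R]_m) : dot (u + v) w = dot u w + dot v w.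
Proof. by rewrite -big_split; apply: eq_bigr => i _; rewrite mxE mulrDl. Qed.

Lemma dotZl m a (u v : 'rV[R]_m) : dot (a *: u) v = a * dot u v.
Proof. by rewrite mulr_sumr; apply: eq_bigr => i _; rewrite mxE mulrA. Qed.

Lemma dotDr m (u v w : 'rV[R]_m) : dot u (v + w) = dot u v + dot u w.
Proof. by rewrite dotC dotDl !(dotC u). Qed.

Lemma dotZr m a (u v : 'rV[R]_m) : dot u (a *: v) = a * dot u v.
Proof. by rewrite dotC dotZl dotC. Qed.

Lemma dotNl m (u v : 'rV[R]_m) : dot (- u) v = - dot u v.
Proof. by rewrite -scaleN1r dotZl mulN1r. Qed.

Lemma dotNr m (u v : 'rV[R]_m) : dot u (- v) = - dot u v.
Proof. by rewrite dotC dotNl dotC. Qed.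

Lemma dotBl m (u v w : 'rV[R]_m) : dot (u - v) w = dot u w - dot v w.
Proof. by rewrite dotDl dotNl. Qed.

Lemma dotBr m (u v w : 'rV[R]_m) : dot u (v - w) = dot u v - dot u w.
Proof. by rewrite dotDr dotNr. Qed.

Lemma dot0l m (u : 'rV[R]_m) : dot 0 u = 0.
Proof. by rewrite -(scale0r 0) dotZl mul0r. Qed.

Lemma dot0r m (u : 'rV[R]_m) : dot u 0 = 0.
Proof. by rewrite dotC dot0l. Qed.

Lemma dot_ge0 m (u : 'rV[R]_m) : 0 <= dot u u.
Proof. by apply: sumr_ge0 => i _; rewrite -expr2 sqr_ge0. Qed.

Lemma dot_delta m (u : 'rV[R]_m) i : dot (delta_mx ord0 i) u = u ord0 i.
Proof.
rewrite /dot (bigD1 i) //= big1 ?addr0 => [|j ji]; rewrite mxE eqxx ?eqxx ?mul1r//=.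
by rewrite (negbTE ji) mul0r.
Qed.

Lemma dot_mulmx m (Q : 'M[R]_m) (u v : 'rV[R]_m) : Q *m Q^T = 1%:M ->
  dot (u *m Q) (v *m Q) = dot u v.
Proof. by move=> QQ; rewrite !dotE trmx_mul -mulmxA (mulmxA Q) QQ mul1mx. Qed.

Lemma enorm_sqr m (u : 'rV[R]_m) : enorm u ^+ 2 = dot u u.
Proof.
rewrite sqr_sqrtr; last by apply: sumr_ge0 => i _; rewrite sqr_ge0.
by apply: eq_bigr => i _; rewrite expr2.
Qed.

Lemma enormE m (u : 'rV[R]_m) : enorm u = Num.sqrt (dot u u).
Proof. by congr Num.sqrt; apply: eq_bigr => i _; rewrite expr2. Qed.

Lemma enorm_ge0 m (u : 'rV[R]_m) : 0 <= enorm u.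
Proof. exact: sqrtr_ge0. Qed.
Hint Extern 0 (is_true (0 <= enorm _)) => solve [exact: enorm_ge0] : core.

Lemma dot_eq0 m (u : 'rV[R]_m) : (dot u u == 0) = (u == 0).
Proof.
apply/eqP/eqP => [|->]; last by rewrite dot0l.
move/eqP; rewrite psumr_eq0 => [/allP u0|i _]; last by rewrite -expr2 sqr_ge0.
apply/rowP => i; rewrite mxE; apply/eqP; rewrite -sqrf_eq0 expr2.
by apply: u0; rewrite mem_index_enum.
Qed.

Lemma enorm_eq0 m (u : 'rV[R]_m) : (enorm u == 0) = (u == 0).
Proof. by rewrite -dot_eq0 -enorm_sqr sqrf_eq0. Qed.

Lemma enorm_gt0 m (u : 'rV[R]_m) : (0 < enorm u) = (u != 0).
Proof. by rewrite lt_def enorm_eq0 enorm_ge0 andbT. Qed.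

Lemma enorm0 m : enorm (0 : 'rV[R]_m) = 0.
Proof. by apply/eqP; rewrite enorm_eq0. Qed.

Lemma enormZ m a (u : 'rV[R]_m) : enorm (a *: u) = `|a| * enorm u.
Proof.
by rewrite !enormE dotZl dotZr mulrA -expr2 sqrtrM ?sqr_ge0// sqrtr_sqr.
Qed.

Lemma enormN m (u : 'rV[R]_m) : enorm (- u) = enorm u.
Proof. by rewrite -scaleN1r enormZ normrN1 mul1r. Qed.

Lemma enormBC m (u v : 'rV[R]_m) : enorm (u - v) = enorm (v - u).
Proof. by rewrite -enormN opprB. Qed.

Lemma enorm_delta m i : enorm (delta_mx ord0 i : 'rV[R]_m) = 1.
Proof. by rewrite enormE dot_delta mxE !eqxx sqrtr1. Qed.

Lemma dot_le m (u v : 'rV[R]_m) : dot u v <= enorm u * enorm v.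
Proof.
have [->|u0] := eqVneq u 0; first by rewrite dot0l enorm0 mul0r.
have [->|v0] := eqVneq v 0; first by rewrite dot0r enorm0 mulr0.
have up : 0 < enorm u by rewrite enorm_gt0.
have vp : 0 < enorm v by rewrite enorm_gt0.
have := dot_ge0 (enorm u *: v - enorm v *: u).
rewrite dotBl !dotBr !dotZl !dotZr (dotC v u) -!enorm_sqr.
have -> : enorm u * (enorm u * enorm v ^+ 2) - enorm u * (enorm v * dot u v) -
  (enorm v * (enorm u * dot u v) - enorm v * (enorm v * enorm u ^+ 2)) =
  2 * (enorm u * enorm v) * (enorm u * enorm v - dot u v) by ring.
by rewrite pmulr_rge0 ?subr_ge0// mulr_gt0// mulr_gt0.
Qed.

Lemma dot_norm_le m (u v : 'rV[R]_m) : `|dot u v| <= enorm u * enorm v.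
Proof.
by rewrite ler_norml dot_le andbT lerNl -dotNl (le_trans (dot_le _ _))// enormN.
Qed.

Lemma ler_enormD m (u v : 'rV[R]_m) : enorm (u + v) <= enorm u + enorm v.
Proof.
rewrite -(@ler_pXn2r _ 2) ?nnegrE ?addr_ge0// enorm_sqr dotDl !dotDr (dotC v u).
by rewrite sqrrD !enorm_sqr; have := dot_le u v; rewrite mulr2n; lra.
Qed.

Lemma enorm_triangle m (v u w : 'rV[R]_m) :
  enorm (u - w) <= enorm (u - v) + enorm (v - w).
Proof. by rewrite (le_trans _ (ler_enormD _ _))// addrA subrK. Qed.

Lemma ler_enorm_dist m (u v : 'rV[R]_m) : `|enorm u - enorm v| <= enorm (u - v).
Proof.
rewrite ler_norml; apply/andP; split.
  by have := enorm_triangle u v 0; rewrite !subr0 enormBC; lra.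
by have := enorm_triangle v u 0; rewrite !subr0; lra.
Qed.

(* Supporting-hyperplane form of the convexity of the norm. *)
Lemma enorm_ge_dot m (u v : 'rV[R]_m) : dot v u / enorm u <= enorm v.
Proof.
have [->|u0] := eqVneq u 0; first by rewrite dot0r mul0r.
by rewrite ler_pdivrMr ?enorm_gt0// dot_le.
Qed.

Lemma coord_le_enorm m (u : 'rV[R]_m) i : `|u ord0 i| <= enorm u.
Proof.
by rewrite -(dot_delta u) (le_trans (dot_norm_le _ _))// enorm_delta mul1r.
Qed.

Lemma enorm_le_sum m (u : 'rV[R]_m) : enorm u <= \sum_i `|u ord0 i|.
Proof.
rewrite {1}(row_sum_delta u).
elim/big_rec2: _ => [|i a b _ ab]; first by rewrite enorm0.
by rewrite (le_trans (ler_enormD _ _))// enormZ enorm_delta mulr1 lerD2l.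
Qed.

(** The topology comes from the sup norm while lengths are Euclidean; this equivalence lets later
    neighbourhood arguments run on Euclidean balls. *)
Lemma nbhs_enormP m (x : 'rV[R]_m) (P : set 'rV[R]_m) :
  nbhs x P <-> exists2 e, 0 < e & forall y, enorm (y - x) < e -> P y.
Proof.
split => [/nbhs_ballP[e e0 eP]|[e e0 eP]].
  exists e => // y yx; apply: eP; split=> // i j; rewrite ord1.
  rewrite /ball /= distrC; have := coord_le_enorm (y - x) j; rewrite !mxE.
  by move/le_lt_trans; exact.
(* The [m] coordinates contribute at most [e * m / (m + 1)]; the successor keeps the bound strict
   and covers [m = 0]. *)
apply/nbhs_ballP; exists (e / m.+1%:R); first by rewrite /= divr_gt0.
move=> y [_ xy]; apply: eP; apply: le_lt_trans (enorm_le_sum _) _.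
apply: (@le_lt_trans _ _ (\sum_(i < m) (e / m.+1%:R))).
  by apply: ler_sum => i _; have := xy ord0 i; rewrite /ball/= distrC !mxE; exact: ltW.
rewrite sumr_const card_ord -[ltLHS]mulr_natr -mulrA gtr_pMr// mulrC ltr_pdivrMr//.
by rewrite mul1r ltr_nat.
Qed.

Lemma enorm_continuous m : continuous (@enorm R m).
Proof.
move=> x; apply/(@cvgrPdist_lt _ _ _ (nbhs x)) => e e0; apply/nbhs_enormP; exists e => // y yx.
by rewrite (le_lt_trans (ler_enorm_dist _ _))// enormBC.
Qed.

End euclid.
#[global] Hint Extern 0 (is_true (0 <= enorm _)) => solve [exact: enorm_ge0] : core.

(** * The distance to the complement *)

Section eps_delta.
Context {R : realType}.

(** Multiplying the difference quotient by [h] removes the division and admits [h = 0], so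
    derivatives are proved and used through plain inequalities. *)
Lemma is_deriveP (V : normedModType R) (f : V -> R) x v (l : R) :
  is_derive x v f l <-> forall e : R, 0 < e -> exists2 r : R, 0 < r &
    forall h : R, `|h| < r -> `|f (x + h *: v) - f x - h * l| <= e * `|h|.
Proof.
split => [df e e0|H].
  have : (fun h => h^-1 *: ((f \o shift x) (h *: v) - f x)) @ 0^' --> l.
    by rewrite -(@derive_val _ _ _ _ _ _ _ df); exact: ex_derive.
  move/cvgrPdist_le => /(_ e e0) [r /= r0 rP]; exists r => // h hr.
  have [->|h0] := eqVneq h 0.
    by rewrite scale0r addr0 subrr mul0r subr0 normr0 mulr0.
  have : ball_ Num.norm 0 r h by rewrite /ball_ /= sub0r normrN.
  move=> /rP /(_ h0) /=.
  rewrite -(ler_pM2r (_ : 0 < `|h|)) ?normr_gt0// -normrM; apply: le_trans.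
  rewrite mulrBl -[h^-1 *: _]/(h^-1 * _) mulrAC mulVf// mul1r distrC (mulrC h).
  by rewrite (addrC x).
have cvgl : (fun h => h^-1 *: ((f \o shift x) (h *: v) - f x)) @ 0^' --> l.
  apply/cvgrPdist_le => e e0; have [r r0 rP] := H e e0.
  exists r => //= h; rewrite /ball_ /= sub0r normrN => hr h0.
  rewrite -(ler_pM2r (_ : 0 < `|h|)) ?normr_gt0// -normrM.
  apply: le_trans (rP h hr).
  rewrite mulrBl -[h^-1 *: _]/(h^-1 * _) mulrAC mulVf// mul1r distrC (mulrC h).
  by rewrite (addrC x).
by apply: DeriveDef; [apply/cvg_ex; exists l | exact/cvg_lim].
Qed.

Lemma continuous_enormP m (f : 'rV[R]_m -> R) (x : 'rV[R]_m) :
  {for x, continuous f} <-> forall e : R, 0 < e -> exists2 r : R, 0 < r &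
    forall y : 'rV[R]_m, enorm (y - x) < r -> `|f y - f x| < e.
Proof.
split=> [/(@cvgrPdist_lt _ _ _ (nbhs x)) H e e0|H].
  have /nbhs_enormP[r r0 rP] := H e e0.
  by exists r => // y /rP; rewrite distrC.
apply/(@cvgrPdist_lt _ _ _ (nbhs x)) => e e0; have [r r0 rP] := H e e0.
by apply/nbhs_enormP; exists r => // y /rP; rewrite distrC.
Qed.

Lemma continuous_dot m (v : 'rV[R]_m) : continuous (dot v).
Proof.
move=> x; apply/continuous_enormP => e e0; exists (e / (enorm v + 1)).
  by rewrite divr_gt0 ?ltr_wpDl.
move=> y yx; rewrite -dotBr (le_lt_trans (dot_norm_le _ _))//.
apply: (@le_lt_trans _ _ ((enorm v + 1) * enorm (y - x))).
  by rewrite ler_wpM2r ?lerDl.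
by rewrite mulrC -ltr_pdivlMr ?ltr_wpDl.
Qed.

Lemma compact_enorm m (x : 'rV[R]_m) r (A : set 'rV[R]_m) : closed A ->
  compact (A `&` [set y | enorm (y - x) <= r]).
Proof.
move=> cA; apply: bounded_closed_compact.
  exists (r + `|x|); split; first by rewrite num_real.
  move=> M rM y [_ /= yx]; apply: le_trans (ltW rM).
  rewrite -lerBlDr (le_trans (lerB_dist _ _))//.
  apply: le_trans yx; rewrite [leLHS]/Num.Def.normr/= mx_normrE.
  apply: bigmax_le => // -[i j] _ /=; rewrite ord1; exact: coord_le_enorm.
apply: closedI => //.
have -> : [set y | enorm (y - x) <= r] =
    (fun y : 'rV[R]_m => enorm (y - x)) @^-1` [set u | u <= r] by [].
apply: closed_comp; last exact: closed_le.
move=> y _; apply/continuous_enormP => e e0; exists e => // z zy.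
by rewrite (le_lt_trans (ler_enorm_dist _ _))// opprB addrA subrK.
Qed.

Lemma continuous_enormB m (x : 'rV[R]_m) : continuous (fun y : 'rV[R]_m => enorm (x - y)).
Proof.
move=> y; apply/continuous_enormP => e e0; exists e => // z zy.
by rewrite (le_lt_trans (ler_enorm_dist _ _))// opprB [X in enorm X]addrC addrA subrK enormBC.
Qed.

End eps_delta.

Section distance.
Context {R : realType} (m : nat) (Omega : set 'rV[R]_m).
Hypotheses (oO : open Omega) (cO : ~` Omega !=set0).
Let d := dist_compl Omega.

Let has_lb x : has_lbound [set enorm (x - y) | y in ~` Omega].
Proof. by exists 0 => _ [y _ <-]. Qed.

(** The nearest point is sought in the whole complement, so that one exists for every [x], inside
    [Omega] or not; on [Omega] it agrees with [nearest_point], by [nearest_pointP]. *)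
Definition near_pt x y := ~ Omega y /\ enorm (x - y) = d x.

Lemma dist_le x y : ~ Omega y -> d x <= enorm (x - y).
Proof. by move=> Oy; apply: ge_inf => //; exists y. Qed.

Lemma le_dist x c : (forall y, ~ Omega y -> c <= enorm (x - y)) -> c <= d x.
Proof.
move=> H; apply: lb_le_inf; last by move=> _ [y Oy <-]; exact: H.
by have [y Oy] := cO; exists (enorm (x - y)); exists y.
Qed.

Lemma dist_ge0 x : 0 <= d x.
Proof. by apply: le_dist => y _. Qed.

Lemma dist_lip x x' : `|d x - d x'| <= enorm (x - x').
Proof.
have H a b : d a <= d b + enorm (a - b).
  rewrite -lerBlDr; apply: le_dist => y Oy; rewrite lerBlDr.
  by rewrite (le_trans (dist_le a Oy))// [leRHS]addrC enorm_triangle.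
rewrite ler_norml; apply/andP; split; first by have := H x' x; rewrite enormBC; lra.
by have := H x x'; lra.
Qed.

Lemma dist_continuous : continuous d.
Proof.
move=> x; apply/continuous_enormP => e e0; exists e => // y yx.
exact: le_lt_trans (dist_lip _ _) yx.
Qed.

Lemma near_pt_ex x : exists y, near_pt x y.
Proof.
have [y0 Oy0] := cO.
have cpt := @compact_enorm _ _ x (enorm (y0 - x)) (~` Omega) (open_closedC oO).
have [||y] := compact_EVT_min _ cpt (f := fun y : 'rV[R]_m => enorm (x - y)).
- by exists y0; split => /=.
- by apply: continuous_subspaceT; exact: continuous_enormB.
rewrite inE => -[Oy yx] ymin; exists y; split => //; apply/eqP.
rewrite eq_le dist_le// andbT; apply: le_dist => z Oz.
have [zy0|zy0] := leP (enorm (z - x)) (enorm (y0 - x)).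
  by apply: ymin; rewrite inE.
by rewrite (enormBC x y) (enormBC x z); exact: le_trans yx (ltW zy0).
Qed.

Lemma dist_gt0 x : Omega x -> 0 < d x.
Proof.
move=> Ox; have [y [Oy <-]] := near_pt_ex x; rewrite enorm_gt0 subr_eq0.
by apply: contra_notN Oy => /eqP <-.
Qed.

Lemma dist_out x : ~ Omega x -> d x = 0.
Proof.
by move=> /(dist_le x); rewrite subrr enorm0 => d0; apply/eqP; rewrite eq_le d0 dist_ge0.
Qed.

Lemma boundaryN y : boundary Omega y -> ~ Omega y.
Proof. by move=> [_] + Oy; apply; apply: open_nbhs_nbhs. Qed.

Lemma lt_dist x y : enorm (x - y) < d x -> Omega y.
Proof. by move=> xy; apply: contrapT => /(dist_le x); rewrite leNgt xy. Qed.

(** Points of the segment from [y] to [x], apart from [y], are closer to [x] than [d x], hence in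
    [Omega]; they accumulate at [y]. *)
Lemma near_pt_boundary x y : Omega x -> near_pt x y -> boundary Omega y.
Proof.
move=> Ox [Oy xy]; split; last by move/interior_subset.
move=> B /nbhs_enormP[e e0 eB].
have dx := dist_gt0 Ox.
set k := Num.min 1 (e / (2 * d x)).
have k0 : 0 < k by rewrite lt_min ltr01 divr_gt0// mulr_gt0.
have k1 : k <= 1 by rewrite ge_min lexx.
exists (y + k *: (x - y)); split.
  apply: (@lt_dist x); have -> : x - (y + k *: (x - y)) = (1 - k) *: (x - y).
    by rewrite scalerBl scale1r opprD addrA.
  by rewrite enormZ xy ger0_norm ?subr_ge0// gtr_pMl// gtrBl.
apply: eB; rewrite addrAC subrr add0r enormZ xy gtr0_norm//.
apply: (@le_lt_trans _ _ (e / 2)); last by lra.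
by rewrite -ler_pdivlMr// ge_min invfM mulrA lexx orbT.
Qed.

Lemma nearest_pointP x y : Omega x -> nearest_point Omega x y <-> near_pt x y.
Proof.
move=> Ox; split=> [[By ymin]|xy].
  have [z xz] := near_pt_ex x; split; first exact: boundaryN.
  apply/eqP; rewrite eq_le -{1}xz.2 ymin ?dist_le//; first exact: boundaryN.
  exact: near_pt_boundary xz.
split; first exact: near_pt_boundary xy.
by move=> z /boundaryN Oz; rewrite xy.2 dist_le.
Qed.

(** Compactness: complement points at distance at least [e] from [y], in a bounded region, have
    distance to [x] bounded away from [d x]. This is continuity at [x] of the possibly multivalued
    foot point. *)
Lemma near_pt_stable x y : (forall y', near_pt x y' -> y' = y) ->
  forall e : R, 0 < e -> exists2 r : R, 0 < r &
    forall x' y', enorm (x' - x) < r -> near_pt x' y' -> enorm (y' - y) < e.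
Proof.
move=> yuniq e e0.
(* The radius [d x + 2] captures every foot of a point within 1 of [x], since [d] is 1-Lipschitz. *)
pose A := (~` Omega `&` [set z | e <= enorm (z - y)]) `&`
  [set z | enorm (z - x) <= d x + 2].
have cptA : compact A.
  apply: compact_enorm; apply: closedI; first exact: open_closedC.
  have -> : [set z | e <= enorm (z - y)] =
    (fun z : 'rV[R]_m => enorm (y - z)) @^-1` [set u | e <= u].
    by apply/seteqP; split => z /=; rewrite enormBC.
  apply: closed_comp; last exact: closed_ge.
  by move=> ? _; exact: continuous_enormB.
have [[z0 Az0]|A0] := pselect (A !=set0); last first.
  exists 1 => // x' y' x'x [Oy' xy']; rewrite ltNge; apply/negP => ey'.
  apply: A0; exists y'; split => //=; rewrite enormBC.
  rewrite (le_trans (enorm_triangle x' _ _))// xy' enormBC.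
  by have := dist_lip x' x; rewrite ler_norml => /andP[]; lra.
have [||z] := compact_EVT_min _ cptA (f := fun z : 'rV[R]_m => enorm (x - z)).
- by exists z0.
- by apply: continuous_subspaceT; exact: continuous_enormB.
rewrite inE => -[[Oz /= ez] zx] zmin.
have dz : d x < enorm (x - z).
  rewrite lt_neqAle dist_le// andbT; apply/eqP => dxz.
  have zy : z = y by apply: yuniq.
  by move: ez; rewrite zy subrr enorm0 leNgt e0.
exists (Num.min 1 ((enorm (x - z) - d x) / 2)).
  by rewrite lt_min ltr01 divr_gt0 ?subr_gt0.
move=> x' y'; rewrite lt_min => /andP[x'1 x'2] [Oy' xy'].
rewrite ltNge; apply/negP => ey'.
have xy'le : enorm (x - y') <= 2 * enorm (x' - x) + d x.
  rewrite (le_trans (enorm_triangle x' _ _))// xy' enormBC.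
  by have := dist_lip x' x; rewrite ler_norml => /andP[]; lra.
have : enorm (x - z) <= enorm (x - y').
  apply: zmin; rewrite inE; split => //=; rewrite enormBC; lra.
by lra.
Qed.

(** For [q = y + k (x - y)], |q - z|^2 = k |x - z|^2 + (1 - k) |y - z|^2 - k (1 - k) |x - y|^2, and
    |x - z| >= [d x]. The quadratic growth away from [y] yields uniqueness of the foot of [q] and,
    later, nondegeneracy of the second variation. *)
Lemma segment_growth x y (k : R) (xy : near_pt x y) (k0 : 0 < k) (k1 : k < 1) z : ~ Omega z ->
  (k * d x) ^+ 2 + (1 - k) * dot (z - y) (z - y) <=
  dot (y + k *: (x - y) - z) (y + k *: (x - y) - z).
Proof.
move=> Oz; have xz : d x ^+ 2 <= dot (x - z) (x - z).
  by rewrite -enorm_sqr ler_pXn2r ?nnegrE ?dist_ge0// dist_le.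
have -> : y + k *: (x - y) - z = k *: (x - z) - (1 - k) *: (z - y).
  by apply/rowP => i; rewrite !mxE; ring.
have dxy : d x ^+ 2 = dot (x - z) (x - z) + 2 * dot (x - z) (z - y) + dot (z - y) (z - y).
  rewrite -xy.2 enorm_sqr; have -> : x - y = (x - z) + (z - y) by rewrite addrA subrK.
  by move: (x - z) (z - y) => a b; rewrite dotDl !dotDr (dotC b a); ring.
move: dxy xz; move: (x - z) (z - y) => a b.
rewrite dotBl !dotBr !dotZl !dotZr (dotC b a) exprMn => -> xz.
have : 0 <= k * (- 2 * dot a b - dot b b) by apply: mulr_ge0; lra.
lra.
Qed.

Lemma segment_dist x y (k : R) (xy : near_pt x y) (k0 : 0 < k) (k1 : k < 1) :
  d (y + k *: (x - y)) = k * d x.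
Proof.
have kd : 0 <= k * d x by rewrite mulr_ge0 ?dist_ge0// ltW.
apply/eqP; rewrite eq_le; apply/andP; split.
  rewrite (le_trans (dist_le _ xy.1))// addrAC subrr add0r enormZ xy.2.
  by rewrite gtr0_norm.
apply: le_dist => z Oz; rewrite -(@ler_pXn2r _ 2) ?nnegrE//.
rewrite enorm_sqr (le_trans _ (segment_growth xy k0 k1 Oz))// lerDl.
by rewrite mulr_ge0 ?dot_ge0// subr_ge0 ltW.
Qed.

Lemma segment_near x y (k : R) (xy : near_pt x y) (k0 : 0 < k) (k1 : k < 1) :
  near_pt (y + k *: (x - y)) y.
Proof.
split; first exact: xy.1.
by rewrite segment_dist// addrAC subrr add0r enormZ xy.2 gtr0_norm.
Qed.

Lemma segment_uniq x y (k : R) (xy : near_pt x y) (k0 : 0 < k) (k1 : k < 1) z :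
  near_pt (y + k *: (x - y)) z -> z = y.
Proof.
move=> [Oz xz]; have := segment_growth xy k0 k1 Oz.
rewrite -[X in _ <= X]enorm_sqr xz segment_dist// gerDl pmulr_rle0 ?subr_gt0//.
move=> zy; apply/eqP; rewrite -subr_eq0 -dot_eq0 eq_le zy; exact: dot_ge0.
Qed.

(* The triangle inequality through (y + k *: (x - y)) + v, which is an equality at v = 0, it bounds
   the second differences of d at x by those at y + k (x - y). *)
Lemma segment_shift x y (k : R) (xy : near_pt x y) (k0 : 0 < k) (k1 : k < 1) v :
  d (x + v) <= d (y + k *: (x - y) + v) + (1 - k) * d x.
Proof.
have := dist_lip (x + v) (y + k *: (x - y) + v); rewrite ler_norml => /andP[_].
have -> : x + v - (y + k *: (x - y) + v) = (1 - k) *: (x - y).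
  by apply/rowP => i; rewrite !mxE; ring.
rewrite enormZ xy.2 ger0_norm; first by lra.
by rewrite subr_ge0 ltW.
Qed.


(** From above, [y] competes for [x + h v]; from below, the foot [y'] of [x + h v] competes for [x],
    with convexity of the norm. By [near_pt_stable] the slope at [y'] tends to the slope at [y]. *)
Lemma dist_is_derive x y v : Omega x -> near_pt x y ->
  (forall y', near_pt x y' -> y' = y) ->
  is_derive x v d (dot (x - y) v / d x).
Proof.
move=> Ox xy yuniq; have dx := dist_gt0 Ox.
apply/is_deriveP => e e0.
pose F (z : 'rV[R]_m) := dot (x - z) v / enorm (x - z).
have cD : {for y, continuous (fun z : 'rV[R]_m => dot (x - z) v)}.
  have -> : (fun z : 'rV[R]_m => dot (x - z) v) = (fun z => dot v x - dot v z).
    by apply/funext => z; rewrite dotC dotBr.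
  by apply: continuousB; [exact: cst_continuous|exact: continuous_dot].
have cV : {for y, continuous (fun z : 'rV[R]_m => (enorm (x - z))^-1)}.
  by apply: continuousV; [rewrite xy.2 gt_eqF | exact: continuous_enormB].
have cF : {for y, continuous F} by exact: (continuousM cD cV).
have [r1 r10 r1P] := (continuous_enormP F y).1 cF e e0.
have [r r0 rP] := near_pt_stable yuniq r10.
have [v0|v0] := eqVneq v 0.
  exists 1 => // h _; rewrite v0 scaler0 addr0 dot0r subrr mul0r mulr0 subr0 normr0.
  by rewrite mulr_ge0// ltW.
have vp : 0 < enorm v by rewrite enorm_gt0.
have v2 : 0 < dot v v by rewrite -enorm_sqr exprn_gt0.
exists (Num.min (r / enorm v) (e * d x / dot v v)).
  by rewrite lt_min !divr_gt0// mulr_gt0.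
move=> h; rewrite lt_min => /andP[hr he].
have [y' xy'] := near_pt_ex (x + h *: v).
have y'y : enorm (y' - y) < r1.
  apply: rP xy'; rewrite addrAC subrr add0r enormZ.
  by rewrite -ltr_pdivlMr.
have := r1P y' y'y; rewrite {2}/F xy.2 => /ltW Fe.
rewrite ler_norml; apply/andP; split.
  have low : d (x + h *: v) - d x >= h * F y'.
    have := dist_le x xy'.1; rewrite -xy'.2.
    have := enorm_ge_dot (x - y') (x + h *: v - y').
    rewrite [x + _ - _]addrAC /F; move: (x - y') => a.
    rewrite dotDl dotZl -enorm_sqr mulrDl (dotC v a).
    have [->|a0] := eqVneq (enorm a) 0; first by lra.
    by rewrite expr2 mulfK// mulrA; lra.
  have : `|h * (F y' - dot (x - y) v / d x)| <= e * `|h|.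
    by rewrite normrM mulrC ler_wpM2r.
  by rewrite ler_norml => /andP[+ _]; lra.
have up : d (x + h *: v) <= d x + h * (dot (x - y) v / d x) + h ^+ 2 * dot v v / d x.
  have h1 := dist_le (x + h *: v) xy.1.
  apply: le_trans h1 _.
  have S : dot (x - y + h *: v) (x - y + h *: v) =
      d x ^+ 2 + 2 * h * dot (x - y) v + h ^+ 2 * dot v v.
    rewrite -xy.2 enorm_sqr; move: (x - y) => a.
    by rewrite dotDl !dotDr !dotZl !dotZr (dotC v a); ring.
  (* Nonnegativity of the right side, so that the upper bound can be checked after squaring. *)
  have Rp : 0 <= d x ^+ 2 + h * dot (x - y) v + h ^+ 2 * dot v v.
    have := dot_ge0 (x - y + h *: v); rewrite S; have := sqr_ge0 (d x).
    by have := mulr_ge0 (sqr_ge0 h) (ltW v2); lra.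
  have -> : d x + h * (dot (x - y) v / d x) + h ^+ 2 * dot v v / d x =
      (d x ^+ 2 + h * dot (x - y) v + h ^+ 2 * dot v v) / d x.
    by field; rewrite gt_eqF.
  rewrite ler_pdivlMr// -(@ler_pXn2r _ 2) ?nnegrE ?mulr_ge0 ?(ltW dx)//.
  rewrite exprMn enorm_sqr addrAC S -subr_ge0.
  have -> : (d x ^+ 2 + h * dot (x - y) v + h ^+ 2 * dot v v) ^+ 2 -
     (d x ^+ 2 + 2 * h * dot (x - y) v + h ^+ 2 * dot v v) * d x ^+ 2 =
     (h * dot (x - y) v + h ^+ 2 * dot v v) ^+ 2 + d x ^+ 2 * (h ^+ 2 * dot v v) by ring.
  by rewrite addr_ge0 ?sqr_ge0// mulr_ge0 ?sqr_ge0// mulr_ge0 ?sqr_ge0// ltW.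
suff : h ^+ 2 * dot v v / d x <= e * `|h| by lra.
have -> : h ^+ 2 = `|h| * `|h| by rewrite -normrM -expr2 ger0_norm ?sqr_ge0.
rewrite -mulrA -mulrA [leRHS]mulrC ler_wpM2l//.
by rewrite mulrA ler_pdivrMr// -ler_pdivlMr// ltW.
Qed.

End distance.

(** * Second order Taylor expansions *)

Section one_variable.
Context {R : realType}.
Implicit Types f g : R -> R.

Lemma increment_bound f (f' : R -> R) (c l e : R) :
  (forall s : R, `|s| <= `|c| -> is_derive s 1 f (f' s)) ->
  (forall s : R, `|s| <= `|c| -> `|f' s - l| <= e) ->
  `|f c - f 0 - c * l| <= e * `|c|.
Proof.
move=> df f'l.
have H (a b : R) : a < b -> (forall s : R, s \in `[a, b] -> `|s| <= `|c|) ->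
    exists2 s : R, `|s| <= `|c| & f b - f a = f' s * (b - a).
  move=> ab abc; have [||s sab ->] := @MVT R f f' a b ab.
  - move=> s sab; apply: df; apply: abc; exact: subset_itv_oo_cc sab.
  - apply: derivable_within_continuous => s sab.
    by have := df s (abc s sab) => -[].
  by exists s => //; apply: abc; exact: subset_itv_oo_cc sab.
have [c0|c0|->] := ltgtP c 0; last by rewrite subrr mul0r subr0 normr0 mulr0.
- have [s|s sc E] := H c 0 c0.
    by rewrite in_itv/= => /andP[cs s0]; rewrite ler0_norm// (ltr0_norm c0) lerN2.
  have -> : f c - f 0 - c * l = (f' s - l) * c.
    have -> : f c - f 0 = - (f 0 - f c) by rewrite opprB.
    by rewrite E; ring.
  by rewrite normrM ler_wpM2r// f'l.
- have [s|s sc E] := H 0 c c0.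
    by rewrite in_itv/= => /andP[s0 sc]; rewrite ger0_norm// (gtr0_norm c0).
  by rewrite E subr0 (mulrC c) -mulrBl normrM ler_wpM2r// f'l.
Qed.

(* [taylor2 f a b c]: f h = a + b h + c h^2 + o(h^2) at 0. *)
Definition taylor2 f (a b c : R) : Prop :=
  (fun h : R => (f h - a - b * h) / h ^+ 2) @ 0^' --> c.

Lemma taylor2P f a b c : taylor2 f a b c <->
  forall e : R, 0 < e -> exists2 r : R, 0 < r & forall h : R, `|h| < r -> h != 0 ->
    `|f h - a - b * h - c * h ^+ 2| <= e * h ^+ 2.
Proof.
split=> [/cvgrPdist_le H e e0|H].
  have [r /= r0 rP] := H e e0; exists r => // h hr h0.
  have : ball_ Num.norm 0 r h by rewrite /ball_ /= sub0r normrN.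
  move=> /rP /(_ h0) /=; have h2 : 0 < h ^+ 2 by rewrite exprn_even_gt0.
  rewrite -(ler_pM2r h2) -{2}(gtr0_norm h2) -normrM mulrBl divfK ?gt_eqF//.
  by rewrite distrC.
apply/cvgrPdist_le => e e0; have [r r0 rP] := H e e0.
exists r => //= h; rewrite /ball_ /= sub0r normrN => hr h0.
have h2 : 0 < h ^+ 2 by rewrite exprn_even_gt0.
rewrite -(ler_pM2r h2) -{2}(gtr0_norm h2) -normrM mulrBl divfK ?gt_eqF//.
by rewrite distrC; exact: rP.
Qed.

Lemma taylor2_ext f g a b c : (forall h, f h = g h) ->
  taylor2 f a b c -> taylor2 g a b c.
Proof. by move=> /funext ->. Qed.

Lemma taylor2_eq f a b c a' b' c' : taylor2 f a b c -> a = a' -> b = b' -> c = c' ->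
  taylor2 f a' b' c'.
Proof. by move=> + <- <- <-. Qed.

Lemma taylor2_lin (a b : R) : taylor2 (fun h => a + b * h) a b 0.
Proof.
apply/taylor2P => e e0; exists 1 => // h _ _.
have -> : a + b * h - a - b * h - 0 * h ^+ 2 = 0 by ring.
by rewrite normr0 mulr_ge0 ?sqr_ge0// ltW.
Qed.

Lemma taylor2D f g a b c a' b' c' : taylor2 f a b c -> taylor2 g a' b' c' ->
  taylor2 (fun h => f h + g h) (a + a') (b + b') (c + c').
Proof.
rewrite /taylor2 => ff gg; apply: (cvg_trans _ (cvgD ff gg)); apply: near_eq_cvg.
apply: nearW => h /=.
rewrite -[LHS]/((f h - a - b * h) / h ^+ 2 + (g h - a' - b' * h) / h ^+ 2).
by rewrite -mulrDl; congr (_ / _); ring.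
Qed.

Lemma taylor2M f g a b c a' b' c' : taylor2 f a b c -> taylor2 g a' b' c' ->
  taylor2 (fun h => f h * g h) (a * a') (a * b' + b * a') (a * c' + c * a' + b * b').
Proof.
move=> ff gg.
pose F h := (f h - a - b * h) / h ^+ 2.
pose G h := (g h - a' - b' * h) / h ^+ 2.
have h0 : (fun h : R => h) @ 0^' --> (0 : R).
  by apply: cvg_within_filter; exact: cvg_id.
have : (fun h => a * G h + F h * a' + b * b' + h * (b * G h + F h * b' + h * (F h * G h)))
    @ 0^' --> a * c' + c * a' + b * b' + 0 * (b * c' + c * b' + 0 * (c * c')).
  apply: cvgD; first (apply: cvgD; last exact: cvg_cst).
    by apply: cvgD; [apply: cvgMr|apply: cvgMl].
  apply: cvgM => //; apply: cvgD; last by apply: cvgM => //; apply: cvgM.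
  by apply: cvgD; [apply: cvgMr|apply: cvgMl].
rewrite mul0r addr0 /taylor2 => FG; apply: (cvg_trans _ FG); apply: near_eq_cvg.
near=> h; rewrite /F /G; field.
by near: h; exact: nbhs_dnbhs_neq.
Unshelve. all: by end_near. Qed.

Lemma taylor2Z f a b c k : taylor2 f a b c ->
  taylor2 (fun h => k * f h) (k * a) (k * b) (k * c).
Proof.
move=> ff; have := taylor2M (taylor2_lin k 0) ff.
move/taylor2_ext => /(_ (fun h => k * f h)) H.
apply: (taylor2_eq (H _)); rewrite ?mul0r ?addr0//.
by move=> h; rewrite mul0r addr0.
Qed.

(** Adding the values at [h] and [- h] cancels the linear term, so second order coefficients can be
    compared even when the first order ones are not known to agree. *)
Lemma taylor2_sym f a b c : taylor2 f a b c ->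
  (fun h : R => (f h + f (- h) - 2 * a) / h ^+ 2) @ 0^' --> 2 * c.
Proof.
move=> /taylor2P H; apply/cvgrPdist_le => e e0.
have e2 : 0 < e / 2 by rewrite divr_gt0.
have [r r0 rP] := H (e / 2) e2.
exists r => //= h; rewrite /ball_ /= sub0r normrN => hr h0.
have h2 : 0 < h ^+ 2 by rewrite exprn_even_gt0.
rewrite -(ler_pM2r h2) -{2}(gtr0_norm h2) -normrM mulrBl divfK ?gt_eqF// distrC.
have := rP h hr h0; have := rP (- h); rewrite normrN oppr_eq0 sqrrN mulrN => /(_ hr h0).
by rewrite !ler_norml => /andP[? ?] /andP[? ?]; apply/andP; split; lra.
Qed.

Lemma taylor2_le f g a b c b' c' : taylor2 f a b c -> taylor2 g a b' c' ->
  (\forall h \near (0 : R), f h <= g h) -> c <= c'.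
Proof.
move=> ff gg fg; rewrite -(@ler_pM2l _ 2)//.
apply: (ler_cvg_to (taylor2_sym ff) (taylor2_sym gg)).
near=> h; rewrite ler_wpM2r ?invr_ge0 ?sqr_ge0// lerD2r lerD//.
  by near: h; apply: nbhs_dnbhs.
near: h; apply: nbhs_dnbhs; have /nbhs_ballP[r r0 rP] := fg.
apply/nbhs_ballP; exists r => // h; rewrite /ball/= sub0r normrN => hr.
by apply: rP; rewrite /ball/= sub0r opprK.
Unshelve. all: by end_near. Qed.

(** Taylor-Peano with [f'] derivable at 0 only: the remainder has derivative [f' s - f' 0 - s k],
    which is o(s), and [increment_bound] integrates it. *)
Lemma taylor2_derive f (f' : R -> R) (r k : R) : 0 < r ->
  (forall s : R, `|s| < r -> is_derive s 1 f (f' s)) ->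
  is_derive (0 : R) 1 f' k -> taylor2 f (f 0) (f' 0) (k / 2).
Proof.
move=> r0 df /is_deriveP d2; apply/taylor2P => e e0.
have [r1 r10 r1P] := d2 e e0.
exists (Num.min r r1); first by rewrite lt_min r0.
move=> h; rewrite lt_min => /andP[hr hr1] h0.
pose g s := f s - f' 0 * s - (k / 2) * s ^+ 2.
have dg (s : R) : `|s| <= `|h| -> is_derive s 1 g (f' s - f' 0 - s * k).
  move=> sh; have := df s (le_lt_trans sh hr) => dfs.
  have D1 : is_derive s 1 (fun s => f' 0 * s) (f' 0).
    have := is_deriveZ (f' 0) (is_derive_id s 1).
    by rewrite [_ *: _]mulr1.
  have D2 : is_derive s 1 (fun s => (k / 2) * s ^+ 2) (s * k).
    have := is_deriveZ (k / 2) (is_deriveX 2 (is_derive_id s 1)).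
    move=> D.  apply: (@is_derive_eq _ _ _ (fun s : R => (k / 2) * s ^+ 2) _ _ _ _ D).
    by rewrite /GRing.scale/=; field.
  exact: (is_deriveB (is_deriveB dfs D1) D2).
have := @increment_bound g _ h 0 (e * `|h|) dg.
rewrite mulr0 subr0 /g mulr0 subr0 expr0n /= mulr0 subr0 => H.
have -> : f h - f 0 - f' 0 * h - k / 2 * h ^+ 2 = f h - f' 0 * h - k / 2 * h ^+ 2 - f 0.
  by ring.
have -> : e * h ^+ 2 = e * `|h| * `|h|.
  by rewrite -mulrA -normrM -expr2 (ger0_norm (sqr_ge0 h)).
apply: H.
move=> s sh; rewrite subr0.
have := r1P s (le_lt_trans sh hr1); rewrite add0r [_%:A]mulr1 => /le_trans; apply.
by rewrite ler_wpM2l// ltW.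
Qed.

End one_variable.

(** * Strict differentiability, Schwarz's theorem and expansions along lines *)

Section several_variables.
Context {R : realType}.

Lemma is_derive_line (V : normedModType R) (f : V -> R) x v (s l : R) :
  is_derive (x + s *: v) v f l <-> is_derive s 1 (fun t : R => f (x + t *: v)) l.
Proof.
have E (h : R) : x + (s + h *: 1) *: v = x + s *: v + h *: v.
  by rewrite scalerDl [_%:A]mulr1 addrA.
split=> /is_deriveP H; apply/is_deriveP => e /H[r r0 rP]; exists r => // h.
  by rewrite E; exact: rP.
by move/rP; rewrite E.
Qed.

Definition C1_at m (f : 'rV[R]_m -> R) (z : 'rV[R]_m) : Prop :=
  (\forall y \near z, forall i, derivable f y (delta_mx ord0 i)) /\
  forall i, {for z, continuous (partial i f)}.

Lemma C1_at_enorm m (f : 'rV[R]_m -> R) (z : 'rV[R]_m) (e : R) : C1_at f z -> 0 < e ->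
  exists2 r : R, 0 < r & forall y, enorm (y - z) < r ->
    forall i, is_derive y (delta_mx ord0 i) f (partial i f y) /\
      `|partial i f y - partial i f z| <= e.
Proof.
move=> [df cf] e0.
have : \forall y \near z, forall i, is_derive y (delta_mx ord0 i) f (partial i f y) /\
      `|partial i f y - partial i f z| <= e.
  have /(@filter_forall _ _ _ (nbhs z)) H : forall i, \forall y \near z,
      `|partial i f y - partial i f z| <= e.
    move=> i; have /(@cvgrPdist_le _ _ _ (nbhs z)) /(_ e e0) := cf i.
    by apply: filterS => y; rewrite distrC.
  by apply: filterS2 df H => y dfy fy i; split=> //; exact/derivableP.
by move/nbhs_enormP.
Qed.

(** Passes from [z] to [z'] one coordinate at a time, so that each increment of a function is along
    a single axis. *)
Definition staircase m (z z' : 'rV[R]_m) (k : nat) : 'rV[R]_m :=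
  \row_i (if (i < k)%N then z' ord0 i else z ord0 i).

(** Both end points vary: this is strict differentiability at [z0], the form that the implicit
    function argument uses. The increment telescopes along [staircase]. *)
Lemma strict_diff m (f : 'rV[R]_m -> R) (z0 : 'rV[R]_m) : C1_at f z0 ->
  forall e : R, 0 < e -> exists2 r : R, 0 < r & forall z z', enorm (z - z0) < r ->
    enorm (z' - z0) < r ->
    `|f z' - f z - dot (z' - z) (grad f z0)| <= e * enorm (z' - z).
Proof.
move=> C1 e e0.
have e1 : 0 < e / m.+1%:R by rewrite divr_gt0.
have [r r0 rP] := C1_at_enorm C1 e1.
(* Each coordinate of an intermediate point is within [2 (|z - z0| + |z' - z0|)], hence within
   [r / (m + 1)], of that of [z0]; the whole staircase then stays within [r]. *)
exists (r / (4 * m.+1%:R)); first by rewrite divr_gt0// mulr_gt0.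
move=> z z' zr z'r.
have step (k : 'I_m) : staircase z z' k.+1 =
    staircase z z' k + (z' - z) ord0 k *: delta_mx ord0 k.
  apply/rowP => i; rewrite !mxE eqxx /= ltnS leq_eqVlt.
  have [->|ik] := eqVneq i k; first by rewrite eqxx ltnn/= mulr1 addrC subrK.
  by rewrite -val_eqE/= in ik; rewrite (negbTE ik) /= mulr0 addr0.
have tele : f z' - f z - dot (z' - z) (grad f z0) =
    \sum_(k < m) (f (staircase z z' k.+1) - f (staircase z z' k) -
       (z' - z) ord0 k * partial k f z0).
  rewrite sumrB; congr (_ - _); last by apply: eq_bigr => k _; rewrite !mxE.
  rewrite -(big_mkord xpredT (fun k => f (staircase z z' k.+1) - f (staircase z z' k))).
  rewrite telescope_sumr//; congr (f _ - f _); apply/rowP => i; rewrite !mxE ?ltn0//.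
  by rewrite ltn_ord.
rewrite tele (le_trans (ler_norm_sum _ _ _))//.
apply: (@le_trans _ _ (\sum_(k < m) (e / m.+1%:R * enorm (z' - z)))); last first.
  rewrite sumr_const card_ord -[leLHS]mulr_natr mulrAC ler_wpM2r//.
  by rewrite -mulrA ger_pMr// mulrC ler_pdivrMr// mul1r ler_nat.
apply: ler_sum => k _.
have near_step (s : R) : `|s| <= `|(z' - z) ord0 k| ->
    enorm (staircase z z' k + s *: delta_mx ord0 k - z0) < r.
  move=> sc; apply: (le_lt_trans (enorm_le_sum _)).
  apply: (@le_lt_trans _ _ (\sum_(i < m) 2 * (enorm (z - z0) + enorm (z' - z0)))).
    apply: ler_sum => i _.
    have zi := coord_le_enorm (z - z0) i; have z'i := coord_le_enorm (z' - z0) i.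
    have zp := enorm_ge0 (z - z0); have z'p := enorm_ge0 (z' - z0).
    move: zp z'p zi z'i; move: (enorm (z - z0)) (enorm (z' - z0)) => u v u0 v0.
    rewrite !mxE eqxx /=.
    have [->|ik] := eqVneq i k; last first.
      by rewrite mulr0 addr0; case: ifP => _; lra.
    rewrite ltnn mulr1 => zk z'k.
    have : `|s| <= u + v.
      have := ler_normB (z' ord0 k - z0 ord0 k) (z ord0 k - z0 ord0 k).
      have -> : z' ord0 k - z0 ord0 k - (z ord0 k - z0 ord0 k) = z' ord0 k - z ord0 k.
        by ring.
      move=> H; rewrite (le_trans _ (le_trans H _))//; first by move: sc; rewrite !mxE.
      by rewrite addrC lerD.
    move=> sb; have := ler_normD (z ord0 k - z0 ord0 k) s.
    by rewrite [z ord0 k - _ + s]addrAC; move: zk sb u0 v0; clear; lra.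
  rewrite sumr_const card_ord -[ltLHS]mulr_natr.
  have m0 : 0 < m.+1%:R :> R by [].
  have uv : enorm (z - z0) + enorm (z' - z0) <= r / (2 * m.+1%:R).
    have -> : r / (2 * m.+1%:R) = r / (4 * m.+1%:R) + r / (4 * m.+1%:R).
      by field; rewrite gt_eqF.
    by rewrite ltW// ltrD.
  apply: (@le_lt_trans _ _ (2 * (r / (2 * m.+1%:R)) * m%:R)).
    by rewrite ler_wpM2r// ler_wpM2l.
  have -> : 2 * (r / (2 * m.+1%:R)) * m%:R = r * (m%:R / m.+1%:R).
    by field; rewrite gt_eqF.
  by rewrite gtr_pMr// ltr_pdivrMr// mul1r ltr_nat.
rewrite step.
have := @increment_bound R (fun s => f (staircase z z' k + s *: delta_mx ord0 k))
  (fun s => partial k f (staircase z z' k + s *: delta_mx ord0 k))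
  ((z' - z) ord0 k) (partial k f z0) (e / m.+1%:R).
rewrite scale0r addr0 => H; apply: (le_trans (H _ _)).
- move=> s sc; have [H1 _] := rP _ (near_step s sc) k.
  exact: (is_derive_line _ _ _ _ _).1 H1.
- move=> s sc; by have [] := rP _ (near_step s sc) k.
- by rewrite ler_wpM2l ?(ltW e1)// coord_le_enorm.
Qed.

Lemma C1_is_derive m (f : 'rV[R]_m -> R) (z v : 'rV[R]_m) : C1_at f z ->
  is_derive z v f (dot v (grad f z)).
Proof.
move=> C1; apply/is_deriveP => e e0.
have [->|v0] := eqVneq v 0.
  exists 1 => // h _; rewrite scaler0 addr0 dot0l subrr mulr0 subr0 normr0.
  by rewrite mulr_ge0// ltW.
have vp : 0 < enorm v by rewrite enorm_gt0.
have ev : 0 < e / enorm v by rewrite divr_gt0.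
have [r r0 rP] := strict_diff C1 ev.
exists (r / enorm v); first by rewrite divr_gt0.
move=> h hr; have := rP z (z + h *: v).
rewrite subrr enorm0 [z + _ - z]addrAC subrr add0r dotZl enormZ.
rewrite -ltr_pdivlMr// => /(_ r0 hr) /le_trans; apply.
by rewrite mulrA mulrAC divfK ?gt_eqF// mulrC.
Qed.

Lemma C1_continuous m (f : 'rV[R]_m -> R) (z : 'rV[R]_m) : C1_at f z ->
  {for z, continuous f}.
Proof.
move=> C1; apply/continuous_enormP => e e0.
have [r r0 rP] := strict_diff C1 ltr01.
pose c := 1 + enorm (grad f z).
have c0 : 0 < c by rewrite ltr_wpDr.
exists (Num.min r (e / c)); first by rewrite lt_min r0 divr_gt0.
move=> y; rewrite lt_min => /andP[yr ye]; have := rP z y.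
rewrite subrr enorm0 => /(_ r0 yr) H.
have D := dot_norm_le (y - z) (grad f z).
have := ler_normD (f y - f z - dot (y - z) (grad f z)) (dot (y - z) (grad f z)).
rewrite subrK => /le_lt_trans; apply.
apply: (@le_lt_trans _ _ (enorm (y - z) * c)); first by rewrite /c; lra.
by rewrite -ltr_pdivlMr.
Qed.

Definition hess m (f : 'rV[R]_m -> R) (z : 'rV[R]_m) : 'M[R]_m :=
  \matrix_(i, j) partial i (partial j f) z.

Definition C2_at m (f : 'rV[R]_m -> R) (z : 'rV[R]_m) : Prop :=
  (\forall y \near z, C1_at f y) /\ forall i, C1_at (partial i f) z.

Lemma Ck2_C2_at m (f : 'rV[R]_m -> R) (U : set 'rV[R]_m) z : open U -> U z ->
  Ck 2 U f -> \forall y \near z, C2_at f y.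
Proof.
move=> oU Uz [_ fU]; have nU y : U y -> \forall w \near y, U w.
  by move=> Uy; exact: open_nbhs_nbhs.
have C1f y : U y -> C1_at f y.
  move=> Uy; split; last by move=> i; have [_ [c _]] := fU i; exact: c.
  by apply: filterS (nU y Uy) => w Uw i; have [dfi _] := fU i; exact: dfi.
apply: filterS (nU z Uz) => y Uy; split.
  by apply: filterS (nU y Uy) => w; exact: C1f.
move=> i; have [_ [_ fi]] := fU i; split.
  by apply: filterS (nU y Uy) => w Uw j; have [dfij _] := fi j; exact: dfij.
by move=> j; have [_ [c _]] := fi j; exact: c.
Qed.

Lemma hess_partial m (f : 'rV[R]_m -> R) (z v : 'rV[R]_m) i : C2_at f z ->
  is_derive z v (partial i f) ((v *m hess f z) ord0 i).
Proof.
move=> [_ /(_ i)] /(C1_is_derive v).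
suff -> : dot v (grad (partial i f) z) = (v *m hess f z) ord0 i by [].
by rewrite mxE; apply: eq_bigr => j _; rewrite !mxE.
Qed.

(** The double difference is the increment over [[0, h]] of f (z + h e_i + t e_j) - f (z + t e_j) in
    [t]; its derivative is an increment of [partial j f], estimated by [strict_diff]. Exchanging [i]
    and [j] leaves the difference unchanged, whence the symmetry of [hess]. *)
Lemma double_difference m (f : 'rV[R]_m -> R) (z : 'rV[R]_m) i j : C2_at f z ->
  forall e : R, 0 < e -> exists2 r : R, 0 < r & forall h : R, `|h| < r ->
   `|f (z + h *: delta_mx ord0 i + h *: delta_mx ord0 j) - f (z + h *: delta_mx ord0 i)
     - f (z + h *: delta_mx ord0 j) + f z - h ^+ 2 * hess f z i j| <= e * h ^+ 2.
Proof.
move=> [C1f C1p] e e0.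
have [r1 r10 r1P] := strict_diff (C1p j) e0.
have /nbhs_enormP[r2 r20 r2P] := C1f.
exists (Num.min r1 r2 / 2); first by rewrite divr_gt0// lt_min r10.
move=> h hr.
have near_z (s t : R) : `|s| <= `|h| -> `|t| <= `|h| ->
    enorm (z + s *: delta_mx ord0 i + t *: delta_mx ord0 j - z) < Num.min r1 r2.
  move=> sh th; rewrite -(addrA z) [z + _ - z]addrAC subrr add0r.
  rewrite (le_lt_trans (ler_enormD _ _))//.
  by rewrite !enormZ !enorm_delta; lra.
have hh : `|h| <= `|h| by [].
have h0 : `|0 : R| <= `|h| by rewrite normr0.
pose g (t : R) := f (z + h *: delta_mx ord0 i + t *: delta_mx ord0 j) -
  f (z + t *: delta_mx ord0 j).
pose g' (t : R) := partial j f (z + h *: delta_mx ord0 i + t *: delta_mx ord0 j) -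
  partial j f (z + t *: delta_mx ord0 j).
have z0 t : z + t *: delta_mx ord0 j = z + 0 *: delta_mx ord0 i + t *: delta_mx ord0 j.
  by rewrite scale0r addr0.
have := @increment_bound R g g' h (h * hess f z i j) (e * `|h|).
rewrite /g scale0r !addr0 => H.
have -> : f (z + h *: delta_mx ord0 i + h *: delta_mx ord0 j) - f (z + h *: delta_mx ord0 i)
     - f (z + h *: delta_mx ord0 j) + f z - h ^+ 2 * hess f z i j =
  f (z + h *: delta_mx ord0 i + h *: delta_mx ord0 j) - f (z + h *: delta_mx ord0 j)
  - (f (z + h *: delta_mx ord0 i) - f z) - h * (h * hess f z i j) by ring.
have -> : e * h ^+ 2 = e * `|h| * `|h|.
  by rewrite -mulrA -normrM -expr2 (ger0_norm (sqr_ge0 h)).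
have partialE y : enorm (y - z) < r2 -> is_derive y (delta_mx ord0 j) f (partial j f y).
  by move=> /r2P /(C1_is_derive (delta_mx ord0 j)); rewrite dot_delta mxE.
apply: H => t th.
  have D1 : is_derive (z + h *: delta_mx ord0 i + t *: delta_mx ord0 j)
      (delta_mx ord0 j) f (partial j f (z + h *: delta_mx ord0 i + t *: delta_mx ord0 j)).
    by apply: partialE; have := near_z h t hh th; rewrite lt_min => /andP[].
  have D2 : is_derive (z + t *: delta_mx ord0 j) (delta_mx ord0 j) f
      (partial j f (z + t *: delta_mx ord0 j)).
    by apply: partialE; rewrite z0; have := near_z 0 t h0 th; rewrite lt_min => /andP[].
  exact: (is_deriveB ((is_derive_line _ _ _ _ _).1 D1) ((is_derive_line _ _ _ _ _).1 D2)).
have := r1P (z + t *: delta_mx ord0 j) (z + h *: delta_mx ord0 i + t *: delta_mx ord0 j).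
have -> : z + h *: delta_mx ord0 i + t *: delta_mx ord0 j - (z + t *: delta_mx ord0 j) =
   h *: delta_mx ord0 i by rewrite addrAC opprD addrACA subrr add0r addrAC addrK.
rewrite dotZl dot_delta enormZ enorm_delta mulr1 !mxE; apply.
  by rewrite z0; have := near_z 0 t h0 th; rewrite lt_min => /andP[].
by have := near_z h t hh th; rewrite lt_min => /andP[].
Qed.

Lemma hess_sym m (f : 'rV[R]_m -> R) (z : 'rV[R]_m) : C2_at f z -> (hess f z)^T = hess f z.
Proof.
move=> C2; apply/matrixP => j i; rewrite mxE; apply/eqP.
rewrite -subr_eq0 -normr_le0; apply/ler_addgt0Pr => e e0; rewrite add0r.
have e2 : 0 < e / 2 by rewrite divr_gt0.
have [r1 r10 r1P] := double_difference i j C2 e2.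
have [r2 r20 r2P] := double_difference j i C2 e2.
pose h := Num.min r1 r2 / 2.
have h0 : 0 < h by rewrite divr_gt0// lt_min r10.
have hlt : h < Num.min r1 r2 by rewrite /h; have := h0; rewrite /h; lra.
have hr : `|h| < Num.min r1 r2 by rewrite gtr0_norm.
move: hr; rewrite lt_min => /andP[/r1P H1 /r2P H2].
have h2 : 0 < h ^+ 2 by rewrite exprn_gt0.
rewrite -(ler_pM2r h2) -{1}(gtr0_norm h2) -normrM.
rewrite [z + _ + _]addrAC in H2.
move: H1 H2; rewrite !ler_norml => /andP[? ?] /andP[? ?]; apply/andP; split; lra.
Qed.

Lemma taylor2_line m (f : 'rV[R]_m -> R) (z v : 'rV[R]_m) : C2_at f z ->
  taylor2 (fun h => f (z + h *: v)) (f z) (dot v (grad f z))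
    (dot (v *m hess f z) v / 2).
Proof.
move=> C2; have [C1f _] := C2.
have /nbhs_enormP[r r0 rP] := C1f.
have [->|v0] := eqVneq v 0.
  apply: (taylor2_ext _ (taylor2_eq (taylor2_lin (f z) 0) _ _ _)) => //.
  - by move=> h; rewrite scaler0 addr0 mul0r addr0.
  - by rewrite dot0l.
  - by rewrite dot0r mul0r.
have vp : 0 < enorm v by rewrite enorm_gt0.
have rv : 0 < r / enorm v by rewrite divr_gt0.
have := @taylor2_derive R (fun h => f (z + h *: v)) (fun h => dot v (grad f (z + h *: v)))
  (r / enorm v) (dot (v *m hess f z) v) rv.
rewrite scale0r addr0; apply.
  move=> s sr; have D : is_derive (z + s *: v) v f (dot v (grad f (z + s *: v))).
    by apply: C1_is_derive; apply: rP; rewrite addrAC subrr add0r enormZ -ltr_pdivlMr.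
  exact: (is_derive_line _ _ _ _ _).1 D.
have -> : (fun h => dot v (grad f (z + h *: v))) =
    \sum_i (v ord0 i *: (fun h : R => partial i f (z + h *: v))).
  apply/funext => h; rewrite fct_sumE; apply: eq_bigr => i _; by rewrite mxE.
rewrite dotC; apply: is_derive_sum => i.
have D : is_derive (z + 0 *: v) v (partial i f) ((v *m hess f z) ord0 i).
  by rewrite scale0r addr0; exact: hess_partial.
exact: (is_deriveZ _ ((is_derive_line _ _ _ _ _).1 D)).
Qed.

End several_variables.

(** * Symmetric matrices and the shape operator *)

Section spectral.

Lemma char_poly_conj (F : fieldType) n (P A : 'M[F]_n) : P \in unitmx ->
  char_poly (invmx P *m A *m P) = char_poly A.
Proof.
move=> Pu; rewrite /char_poly.
have -> : char_poly_mx (invmx P *m A *m P) =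
    map_mx polyC (invmx P) *m char_poly_mx A *m map_mx polyC P.
  rewrite /char_poly_mx mulmxBr mulmxBl -!map_mxM; congr (_ - _).
  by rewrite scalar_mxC -mulmxA -map_mxM mulVmx// map_mx1 mulmx1.
rewrite !det_mulmx mulrAC -det_mulmx -map_mxM mulVmx// map_mx1 det1 mul1r //.
Qed.

Lemma char_poly_tr (F : fieldType) n (W : 'M[F]_n) (k : 'rV[F]_n) : (0 < n)%N ->
  char_poly W = \prod_(i < n) ('X - (k ord0 i)%:P) -> \sum_i k ord0 i = \tr W.
Proof.
move=> n0 /(congr1 (fun p : {poly F} => p`_n.-1)); rewrite char_poly_trace//.
have -> : \prod_(i < n) ('X - (k ord0 i)%:P) =
  \prod_(c <- [seq k ord0 i | i <- enum 'I_n]) ('X - c%:P).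
  by rewrite big_map big_enum.
have sz : size [seq k ord0 i | i <- enum 'I_n] = n by rewrite size_map size_enum_ord.
have := @coefPn_prod_XsubC _ [seq k ord0 i | i <- enum 'I_n].
rewrite sz -lt0n n0 => -> //; by rewrite big_map big_enum => /oppr_inj.
Qed.

(** Over the complex numbers the matrix is Hermitian and the spectral theorem gives real
    eigenvalues; injectivity of the embedding on polynomials brings the factorisation back. *)
Lemma sym_char_poly (R : realType) n (A : 'M[R]_n) : A^T = A ->
  exists k : 'rV[R]_n, char_poly A = \prod_(i < n) ('X - (k ord0 i)%:P).
Proof.
move=> As; pose f : {rmorphism R -> complex.complex R} := complex.real_complex_def (Phant R).
have H : map_mx f A \is hermsymmx.
  apply: realsym_hermsym; last first.
    by apply/mxOverP => i j; rewrite mxE; apply/complex.complex_realP; exists (A i j).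
  by apply/is_hermitianmxP; rewrite expr0 scale1r map_mx_id// map_trmx As.
have /orthomx_spectralP E := hermitian_normalmx H.
have D := hermitian_spectral_diag_real H.
exists (\row_i complex.Re (spectral_diag (map_mx f A) ord0 i)).
have finj : injective f by exact: complex.complexI.
apply: (map_poly_inj f); rewrite map_char_poly {1}E char_poly_conj ?spectral_unit//.
rewrite char_poly_trig ?diag_mx_is_trig// rmorph_prod; apply: eq_bigr => i _.
rewrite rmorphB/= map_polyX map_polyC/= !mxE eqxx mulr1n.
by rewrite [f _]complex.RRe_real//; exact: (mxOverP D).
Qed.

End spectral.

(** * Graphs: first fundamental form and shape operator *)

Section graph_geometry.
Context {R : realType}.

Lemma is_derive_row (V : normedModType R) m (F : V -> 'rV[R]_m) x v (l : 'rV[R]_m) :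
  (forall i, is_derive x v (fun y => F y ord0 i) (l ord0 i)) -> is_derive x v F l.
Proof.
move=> H.
have dF : derivable F x v by apply/derivable_mxP => i j; rewrite ord1; case: (H j).
apply: DeriveDef => //; rewrite derive_mx//; apply/rowP => i; rewrite mxE.
exact: derive_val.
Qed.

Lemma is_derive_coord (V : normedModType R) m (F : V -> 'rV[R]_m) x v (l : 'rV[R]_m) i :
  is_derive x v F l -> is_derive x v (fun y => F y ord0 i) (l ord0 i).
Proof.
move=> [dF <-]; rewrite derive_mx// mxE.
by apply: derivableP; have /derivable_mxP := dF; exact.
Qed.

Lemma is_derive_sumr (V : normedModType R) m (F : 'I_m -> V -> R) x v (l : 'I_m -> R) :
  (forall i, is_derive x v (F i) (l i)) ->
  is_derive x v (fun y => \sum_i F i y) (\sum_i l i).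
Proof.
move=> H; have -> : (fun y => \sum_i F i y) = \sum_i F i.
  by apply/funext => y; rewrite fct_sumE.
exact: is_derive_sum.
Qed.

Lemma is_derive_mulmx (V : normedModType R) m k (F : V -> 'rV[R]_m) x v (l : 'rV[R]_m)
  (A : 'M[R]_(m, k)) : is_derive x v F l -> is_derive x v (fun y => F y *m A) (l *m A).
Proof.
move=> dF; apply: is_derive_row => i; rewrite mxE.
have -> : (fun y => (F y *m A) ord0 i) = (fun y => \sum_j F y ord0 j * A j i).
  by apply/funext => y; rewrite mxE.
apply: is_derive_sumr => j.
have D := is_deriveZ (A j i) (is_derive_coord j dF).
have -> : (fun y => F y ord0 j * A j i) = (A j i) \*: (fun y => F y ord0 j).
  by apply/funext => y; rewrite /= mulrC.
by rewrite mulrC; exact: D.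
Qed.

Lemma is_derive_rV_cons (V : normedModType R) m (f : V -> R) (F : V -> 'rV[R]_m) x v df dF :
  is_derive x v f df -> is_derive x v F dF ->
  is_derive x v (fun y => rV_cons (f y) (F y)) (rV_cons df dF).
Proof.
move=> Df DF; apply: is_derive_row => i; case: (unliftP ord0 i) => [j|] ->.
  rewrite rV_consS; under eq_fun do rewrite rV_consS.
  exact: is_derive_coord.
by rewrite rV_cons0; under eq_fun do rewrite rV_cons0.
Qed.

Lemma is_derive_comp1 (V : normedModType R) (F : R -> R) (f : V -> R) x v (a b : R) :
  is_derive (f x) 1 F a -> is_derive x v f b -> is_derive x v (fun y => F (f y)) (a * b).
Proof.
move=> DF Df.
have D0 : is_derive (x + 0 *: v) v f b by rewrite scale0r addr0.
have := (is_derive_line f x v 0 b).1 D0 => D1.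
have DF' : is_derive (f (x + 0 *: v)) 1 F a by rewrite scale0r addr0.
have := is_derive1_comp DF' D1 => D2.
have := (is_derive_line (fun y => F (f y)) x v 0 (a * b)).2 D2.
by rewrite scale0r addr0.
Qed.

Lemma dot_rV_cons m (a b : R) (u v : 'rV[R]_m) :
  dot (rV_cons a u) (rV_cons b v) = a * b + dot u v.
Proof.
rewrite /dot big_ord_recl !rV_cons0; congr (_ + _); apply: eq_bigr => i _.
by rewrite !rV_consS.
Qed.

Lemma rV_consD m (a b : R) (u v : 'rV[R]_m) :
  rV_cons a u + rV_cons b v = rV_cons (a + b) (u + v).
Proof.
apply/rowP => i; rewrite mxE; case: (unliftP ord0 i) => [j|] ->.
  by rewrite !rV_consS mxE.
by rewrite !rV_cons0.
Qed.

Lemma rV_consZ m (k a : R) (u : 'rV[R]_m) :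
  k *: rV_cons a u = rV_cons (k * a) (k *: u).
Proof.
apply/rowP => i; rewrite mxE; case: (unliftP ord0 i) => [j|] ->.
  by rewrite !rV_consS mxE.
by rewrite !rV_cons0.
Qed.

Lemma rV_cons_sum m (k : nat) (a : 'I_k -> R) (u : 'I_k -> 'rV[R]_m) :
  \sum_i rV_cons (a i) (u i) = rV_cons (\sum_i a i) (\sum_i u i).
Proof.
apply/rowP => i; rewrite summxE; case: (unliftP ord0 i) => [j|] ->.
  by rewrite rV_consS summxE; apply: eq_bigr => l _; rewrite rV_consS.
by rewrite rV_cons0; apply: eq_bigr => l _; rewrite rV_cons0.
Qed.

(** The normalising factor of [graph_normal], that is, the cosine of the angle between the normal
    and the downward height axis. *)
Definition slope m (phi : 'rV[R]_m -> R) (z : 'rV[R]_m) : R :=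
  (Num.sqrt (1 + enorm (grad phi z) ^+ 2))^-1.

Lemma slope_gt0 m (phi : 'rV[R]_m -> R) z : 0 < slope phi z.
Proof. by rewrite invr_gt0 sqrtr_gt0 ltr_wpDr// sqr_ge0. Qed.

Lemma slope_sqr m (phi : 'rV[R]_m -> R) z :
  slope phi z ^+ 2 * (1 + dot (grad phi z) (grad phi z)) = 1.
Proof.
rewrite /slope exprVn -enorm_sqr; have p : 0 < 1 + enorm (grad phi z) ^+ 2.
  by rewrite ltr_wpDr// sqr_ge0.
by rewrite sqr_sqrtr ?ltW// mulVf// gt_eqF.
Qed.

(** The Gram matrix of the coordinate tangent vectors of the graph. *)
Definition first_form m (phi : 'rV[R]_m -> R) (z : 'rV[R]_m) : 'M[R]_m :=
  1%:M + (grad phi z)^T *m grad phi z.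

Lemma graph_point_derive m (Q : 'M[R]_m.+1) (phi : 'rV[R]_m -> R) z v : C2_at phi z ->
  is_derive z v (graph_point Q phi) (rV_cons (dot v (grad phi z)) v *m Q^T).
Proof.
move=> [C1 _]; apply: is_derive_mulmx; apply: is_derive_rV_cons.
by apply: C1_is_derive; exact: nbhs_singleton C1.
Qed.

Lemma grad_derive m (phi : 'rV[R]_m -> R) z v : C2_at phi z ->
  is_derive z v (grad phi) (v *m hess phi z).
Proof.
move=> C2; apply: is_derive_row => i.
under eq_fun do rewrite mxE; exact: hess_partial.
Qed.

Lemma slope_derive m (phi : 'rV[R]_m -> R) z v : C2_at phi z ->
  is_derive z v (slope phi)
    (- slope phi z ^+ 3 * dot (v *m hess phi z) (grad phi z)).
Proof.
move=> C2; have := slope_gt0 phi z; have := slope_sqr phi z; rewrite /slope.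
set q := 1 + enorm _ ^+ 2 => E s0.
have q0 : 0 < q by rewrite ltr_wpDr// sqr_ge0.
have Dq : is_derive z v (fun y => 1 + enorm (grad phi y) ^+ 2)
    (2 * dot (v *m hess phi z) (grad phi z)).
  have Dg i := is_derive_coord i (grad_derive v C2).
  have D2 := is_derive_sumr (fun i => is_deriveM (Dg i) (Dg i)).
  have D3 := is_deriveD (is_derive_cst (1 : R) z v) D2.
  have -> : (fun y => 1 + enorm (grad phi y) ^+ 2) =
     cst (1 : R) + (fun y => \sum_i ((fun y => grad phi y ord0 i) * (fun y => grad phi y ord0 i)) y).
    by apply/funext => y; rewrite enorm_sqr.
  suff -> : 2 * dot (v *m hess phi z) (grad phi z) = 0 + \sum_i
    (grad phi z ord0 i *: (v *m hess phi z) ord0 i + grad phi z ord0 i *: (v *m hess phi z) ord0 i).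
    by exact: D3.
  rewrite add0r mulr_sumr; apply: eq_bigr => i _; rewrite /GRing.scale/=; ring.
have DF : is_derive q 1 (fun t : R => (Num.sqrt t)^-1)
    (- Num.sqrt q ^- 2 *: (2 * Num.sqrt q)^-1).
  by apply: is_deriveV; [rewrite sqrtr_eq0 -ltNge|exact: is_derive1_sqrt].
have := @is_derive_comp1 _ _ (fun y => 1 + enorm (grad phi y) ^+ 2) z v _ _ DF Dq.
set A := (X in is_derive _ _ _ X -> _); set B := (X in _ -> is_derive _ _ _ X).
suff -> : A = B by [].
rewrite /A /B /GRing.scale/=; field.
by rewrite sqrtr_eq0 -ltNge.
Qed.

Lemma graph_normal_derive m (Q : 'M[R]_m.+1) (phi : 'rV[R]_m -> R) z i : C2_at phi z ->
  is_derive z (delta_mx ord0 i) (graph_normal Q phi)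
   ((- slope phi z ^+ 3 * dot (row i (hess phi z)) (grad phi z))
       *: (rV_cons (-1) (grad phi z) *m Q^T) +
    slope phi z *: (rV_cons 0 (row i (hess phi z)) *m Q^T)).
Proof.
move=> C2; rewrite rowE; have Ds := slope_derive (delta_mx ord0 i) C2.
have Dg := grad_derive (delta_mx ord0 i) C2.
have Dn := is_derive_mulmx Q^T (is_derive_rV_cons (is_derive_cst (-1 : R) z (delta_mx ord0 i)) Dg).
apply: is_derive_row => j.
have := is_deriveM Ds (is_derive_coord j Dn).
have -> : slope phi * (fun y => (rV_cons (cst (-1) y) (grad phi y) *m Q^T) ord0 j) =
   (fun y => graph_normal Q phi y ord0 j) by apply/funext => y; rewrite [RHS]mxE.
set A := (X in is_derive _ _ _ X -> _); set B := (X in _ -> is_derive _ _ _ X).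
suff -> : A = B by [].
have L (a b : R) (u w : 'rV_m.+1) : (a *: u + b *: w) ord0 j = a * u ord0 j + b * w ord0 j.
  by rewrite !mxE.
by rewrite /A /B L addrC; congr (_ + _); exact: mulrC.
Qed.

Lemma tangent_dot m (Q : 'M[R]_m.+1) (a b : R) (u v : 'rV[R]_m) : Q *m Q^T = 1%:M ->
  dot (rV_cons a u *m Q^T) (rV_cons b v *m Q^T) = a * b + dot u v.
Proof. by move=> QQ; rewrite dot_mulmx ?dot_rV_cons// trmxK mulmx1C. Qed.

(** Pairing the Weingarten equations with the tangent vectors kills the derivative of the
    normalising factor, which multiplies the normal; what remains is the second fundamental form. *)
Lemma shape_matrix_form m (Q : 'M[R]_m.+1) (phi : 'rV[R]_m -> R) z (W : 'M[R]_m) :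
  Q *m Q^T = 1%:M -> C2_at phi z -> is_shape_matrix Q phi z W ->
  W *m first_form phi z = slope phi z *: hess phi z.
Proof.
move=> QQ C2 SW; apply/matrixP => i l.
have Xd (j : 'I_m) := @derive_val _ _ _ _ _ _ _ (graph_point_derive Q (delta_mx ord0 j) C2).
have := SW i; rewrite (@derive_val _ _ _ _ _ _ _ (graph_normal_derive Q i C2)).
under eq_bigr do rewrite Xd.
move/(congr1 (dot (rV_cons (dot (delta_mx ord0 l) (grad phi z)) (delta_mx ord0 l) *m Q^T))).
rewrite dotDr !dotZr !tangent_dot// !dot_delta.
rewrite mulrN1 addNr !mulr0 !add0r => E.
transitivity (slope phi z * row i (hess phi z) ord0 l); last by rewrite !mxE.
rewrite E mxE.
have -> (F : 'I_m -> 'rV[R]_m.+1) (w : 'rV[R]_m.+1) : dot w (\sum_j F j) = \sum_j dot w (F j).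
  by elim/big_rec2: _ => [|j a b _ <-]; rewrite ?dot0r ?dotDr.
apply: eq_bigr => j _; rewrite dotZr tangent_dot// !dot_delta; congr (_ * _).
rewrite !mxE big_ord1 !mxE eqxx /= addrC mulrC eq_sym; congr (_ + _).
Qed.

(** Sherman-Morrison formula for a rank one perturbation of the identity, simplified by
    [slope_sqr]. *)
Lemma first_form_unit m (phi : 'rV[R]_m -> R) z :
  first_form phi z *m (1%:M - slope phi z ^+ 2 *: ((grad phi z)^T *m grad phi z)) = 1%:M.
Proof.
have := slope_sqr phi z; rewrite /first_form; move: (slope phi z) (grad phi z) => w g E.
rewrite mulmxDl mul1mx mulmxBr mulmx1 -scalemxAr mulmxA -(mulmxA g^T).
have -> : g *m g^T = (dot g g)%:M by rewrite [LHS]mx11_scalar dotE.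
rewrite mul_mx_scalar -scalemxAl scalerA.
apply/matrixP => i j; rewrite !mxE; move: (\sum_k _) => X.
have H : X * (w ^+ 2 * (1 + dot g g)) = X by rewrite E mulr1.
lra.
Qed.

(** In coordinates the shape matrix [w B G^-1] need not be symmetric; with [S] a symmetric square
    root of the inverse first form, it is similar to the symmetric matrix [S (w B) S], whose
    spectrum is real. *)
Lemma shape_matrix_ex m (Q : 'M[R]_m.+1) (phi : 'rV[R]_m -> R) z : C2_at phi z ->
  exists (W : 'M[R]_m) (k : 'rV[R]_m), is_shape_matrix Q phi z W /\
    char_poly W = \prod_(i < m) ('X - (k ord0 i)%:P).
Proof.
move=> C2; pose g := grad phi z; pose B := hess phi z; pose w := slope phi z.
have w0 : 0 < w := slope_gt0 phi z.
have wg : w ^+ 2 * (1 + dot g g) = 1 := slope_sqr phi z.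
pose P := g^T *m g.
have PP : P *m P = dot g g *: P.
  rewrite /P mulmxA -(mulmxA g^T).
  have -> : g *m g^T = (dot g g)%:M by rewrite [LHS]mx11_scalar dotE.
  by rewrite mul_mx_scalar -scalemxAl.
(* The coefficient [t = w^2 / (1 + w)] solves [2 t - t^2 |g|^2 = w^2] for |g|^2 = w^(-2) - 1, which
   is what [S *m S = 1 - w^2 P] asks for. *)
pose S : 'M[R]_m := 1%:M - (w ^+ 2 / (1 + w)) *: P.
have w1 : 1 + w != 0 by rewrite gt_eqF// addr_gt0.
have SS : S *m S = 1%:M - w ^+ 2 *: P.
  rewrite /S mulmxBl mul1mx mulmxBr mulmx1 -scalemxAl -scalemxAr PP.
  apply/matrixP => i j; rewrite !mxE; move: (i == j)%:R (\sum_k _) => X Y.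
  have -> : dot g g = (w ^+ 2)^-1 - 1.
    have w2 : w ^+ 2 != 0 by rewrite expf_neq0// gt_eqF.
    apply: (mulfI w2); rewrite mulrBr mulfV// mulr1; move: wg; rewrite mulrDr mulr1 => <-.
    by rewrite addrAC subrr add0r.
  field.
  by rewrite w1 gt_eqF.
have Sunit : S \in unitmx.
  have := first_form_unit phi z; rewrite -/g -/w -/P -SS mulmxA => /mulmx1_unit[_ //].
have ST : S^T = S.
  by rewrite /S linearB/= linearZ/= trmx1 /P trmx_mul trmxK.
exists (w *: B *m (S *m S)).
have BT : (S *m (w *: B) *m S)^T = S *m (w *: B) *m S.
  by rewrite !trmx_mul linearZ/= hess_sym// ST mulmxA.
have [k kP] := sym_char_poly BT; exists k; split; last first.
  by rewrite -kP -[RHS](char_poly_conj _ Sunit) !mulmxA mulVmx// mul1mx.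
move=> i; have Xd (j : 'I_m) := @derive_val _ _ _ _ _ _ _ (graph_point_derive Q (delta_mx ord0 j) C2).
rewrite (@derive_val _ _ _ _ _ _ _ (graph_normal_derive Q i C2)).
under eq_bigr do rewrite Xd scalemxAl rV_consZ.
rewrite -mulmx_suml rV_cons_sum !scalemxAl -mulmxDl; congr (_ *m _).
have rowW : row i (w *: B *m (S *m S)) = w *: row i B - (w ^+ 3 * dot (row i B) g) *: g.
  rewrite SS mulmxBr mulmx1 linearB/= linearZ/=; congr (_ - _).
  rewrite -scalemxAl -scalemxAr scalerA linearZ/= /P mulmxA row_mul row_mul.
  rewrite [row i B *m g^T]mx11_scalar -dotE mul_scalar_mx scalerA.
  by congr (_ *: _); ring.
rewrite !rV_consZ rV_consD -/g -/B -/w; congr rV_cons; last first.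
  rewrite addrC -scaleNr -mulNr in rowW *; rewrite -rowW [LHS]row_sum_delta.
  by apply: eq_bigr => j _; rewrite mxE.
transitivity (dot (row i (w *: B *m (S *m S))) g); last first.
  by apply: eq_bigr => j _; rewrite dot_delta mxE.
rewrite rowW dotBl !dotZl.
have -> : w ^+ 3 * dot (row i B) g * dot g g = w * dot (row i B) g * (w ^+ 2 * (1 + dot g g) - w ^+ 2).
  by ring.
by rewrite wg; ring.
Qed.

End graph_geometry.

(** * A quantitative implicit function argument *)

Section strict_differentiability.
Context {R : realType}.

Lemma enorm_mulmx_bound m k (A : 'M[R]_(m, k)) :
  exists2 K : R, 0 < K & forall u : 'rV[R]_m, enorm (u *m A) <= K * enorm u.
Proof.
exists (1 + \sum_i enorm (row i A)).
  by rewrite ltr_wpDr// sumr_ge0.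
move=> u; apply: (@le_trans _ _ (\sum_i enorm (row i A) * enorm u)); last first.
  by rewrite -mulr_suml ler_wpM2r// lerDr.
have -> : u *m A = \sum_i u ord0 i *: row i A.
  by rewrite {1}(row_sum_delta u) mulmx_suml; apply: eq_bigr => i _; rewrite -scalemxAl -rowE.
elim/big_rec2: _ => [|i a b _ ab]; first by rewrite enorm0.
rewrite (le_trans (ler_enormD _ _))// lerD// enormZ mulrC ler_wpM2l//.
exact: coord_le_enorm.
Qed.

Definition sdiffv m k (F : 'rV[R]_m -> 'rV[R]_k) (z0 : 'rV[R]_m) (A : 'M[R]_(m, k)) : Prop :=
  forall e : R, 0 < e -> exists2 r : R, 0 < r & forall z z', enorm (z - z0) < r ->
    enorm (z' - z0) < r -> enorm (F z' - F z - (z' - z) *m A) <= e * enorm (z' - z).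

Lemma C1_sdiffv m k (F : 'rV[R]_m -> 'rV[R]_k) (z0 : 'rV[R]_m) (A : 'M[R]_(m, k)) :
  (forall j, C1_at (fun z => F z ord0 j) z0) ->
  (forall i j, A i j = partial i (fun z => F z ord0 j) z0) -> sdiffv F z0 A.
Proof.
move=> C1 AE e e0; have e1 : 0 < e / k.+1%:R by rewrite divr_gt0.
have : \forall r \near (0 : R)^'+, forall j, forall z z', enorm (z - z0) < r ->
    enorm (z' - z0) < r ->
    `|F z' ord0 j - F z ord0 j - dot (z' - z) (grad (fun z => F z ord0 j) z0)|
       <= e / k.+1%:R * enorm (z' - z).
  apply: filter_forall => j; have [r r0 rP] := strict_diff (C1 j) e1.
  near=> s => z z' zs z's; apply: rP; [apply: lt_le_trans zs _|apply: lt_le_trans z's _].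
    by near: s; apply: nbhs_right_le.
  by near: s; apply: nbhs_right_le.
move=> H; have : \forall r \near (0 : R)^'+, 0 < r /\ forall j, forall z z', enorm (z - z0) < r ->
    enorm (z' - z0) < r ->
    `|F z' ord0 j - F z ord0 j - dot (z' - z) (grad (fun z => F z ord0 j) z0)|
       <= e / k.+1%:R * enorm (z' - z).
  by near=> r; split; near: r => //; exact: nbhs_right_gt.
move=> /filter_ex[r [r0 rP]]; exists r => // z z' zr z'r.
rewrite (le_trans (enorm_le_sum _))//.
apply: (@le_trans _ _ (\sum_(j < k) e / k.+1%:R * enorm (z' - z))).
  apply: ler_sum => j _; apply: le_trans (rP j z z' zr z'r); rewrite le_eqVlt; apply/orP; left.
  have E (u v w : 'rV[R]_k) : (u - v - w) ord0 j = u ord0 j - v ord0 j - w ord0 j.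
    by rewrite !mxE.
  apply/eqP; rewrite E; congr (`| _ - _ |).
  by rewrite mxE; apply: eq_bigr => i _; rewrite AE; congr (_ * _); rewrite mxE.
rewrite sumr_const card_ord -[leLHS]mulr_natr mulrAC ler_wpM2r//.
by rewrite -mulrA ger_pMr// mulrC ler_pdivrMr// mul1r ler_nat.
Unshelve. all: by end_near. Qed.

Lemma sdiffv_lip m k (F : 'rV[R]_m -> 'rV[R]_k) (z0 : 'rV[R]_m) (A : 'M[R]_(m, k)) :
  sdiffv F z0 A -> exists2 L : R, 0 < L & exists2 r : R, 0 < r &
  forall z z', enorm (z - z0) < r -> enorm (z' - z0) < r ->
    enorm (F z' - F z) <= L * enorm (z' - z).
Proof.
move=> /(_ 1 ltr01)[r r0 rP]; have [K K0 KP] := enorm_mulmx_bound A.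
exists (1 + K); first by rewrite addr_gt0.
exists r => // z z' zr z'r; have H := rP z z' zr z'r.
rewrite -[F z' - F z](subrK ((z' - z) *m A)) (le_trans (ler_enormD _ _))//.
by rewrite mulrDl lerD.
Qed.

Lemma C1_atD m (f g : 'rV[R]_m -> R) z : C1_at f z -> C1_at g z ->
  C1_at (fun x => f x + g x) z.
Proof.
move=> [df cf] [dg cg]; split.
  apply: filterS2 df dg => y dfy dgy i; exact: (derivableD (dfy i) (dgy i)).
move=> i; have H : \forall y \near z,
    partial i f y + partial i g y = partial i (fun x => f x + g x) y.
  by apply: filterS2 df dg => y dfy dgy; rewrite /partial -deriveD.
pose F := partial i (fun x => f x + g x); have Fz := nbhs_singleton H.
suff : F x @[x --> z] --> partial i f z + partial i g z.
  by move=> S; rewrite Fz in S; exact: S.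
exact: (cvg_trans (near_eq_cvg H) (cvgD (cf i) (cg i))).
Qed.

Lemma C1_atM m (f g : 'rV[R]_m -> R) z : C1_at f z -> C1_at g z ->
  C1_at (fun x => f x * g x) z.
Proof.
move=> Cf Cg; move: (Cf) (Cg) => [df cf] [dg cg]; split.
  apply: filterS2 df dg => y dfy dgy i; exact: (derivableM (dfy i) (dgy i)).
move=> i; have H : \forall y \near z,
    f y * partial i g y + g y * partial i f y = partial i (fun x => f x * g x) y.
  by apply: filterS2 df dg => y dfy dgy; rewrite /partial -deriveM.
pose F := partial i (fun x => f x * g x); have Fz := nbhs_singleton H.
suff : F x @[x --> z] --> f z * partial i g z + g z * partial i f z.
  by move=> S; rewrite Fz in S; exact: S.
apply: (cvg_trans (near_eq_cvg H)).
exact: (cvgD (cvgM (C1_continuous Cf) (cg i)) (cvgM (C1_continuous Cg) (cf i))).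
Qed.

Lemma C1_at_cst m (c : R) (z : 'rV[R]_m) : C1_at (fun=> c) z.
Proof.
split; first by apply: (@nearW _ (nbhs z)) => y i; exact: derivable_cst.
move=> i; have -> : partial i (fun=> c) = cst 0.
  by apply/funext => y; rewrite /partial derive_cst.
exact: cst_continuous.
Qed.

Lemma coord_is_derive m (z v : 'rV[R]_m) j :
  is_derive z v (fun x : 'rV[R]_m => x ord0 j) (v ord0 j).
Proof. exact: is_derive_coord (is_derive_id z v). Qed.

Lemma C1_at_coord m (z : 'rV[R]_m) j : C1_at (fun x : 'rV[R]_m => x ord0 j) z.
Proof.
have D (y v : 'rV[R]_m) := coord_is_derive y v j.
split; first by apply: (@nearW _ (nbhs z)) => y i; case: (D y (delta_mx ord0 i)).
move=> i; have -> : partial i (fun x : 'rV[R]_m => x ord0 j) = cst ((delta_mx ord0 i : 'rV[R]_m) ord0 j).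
  by apply/funext => y; exact: derive_val.
exact: cst_continuous.
Qed.

Lemma sdiffv_grad m (f : 'rV[R]_m -> R) (z : 'rV[R]_m) : C2_at f z ->
  sdiffv (grad f) z (hess f z).
Proof.
move=> [_ C1]; apply: C1_sdiffv => [j|i j]; rewrite /grad; under eq_fun do rewrite mxE.
  exact: C1.
by rewrite mxE.
Qed.

(* Up to sign, twice the z-gradient of (a - f z)^2 + |b - z|^2 is [critical f a z] - b. *)
Definition critical m (f : 'rV[R]_m -> R) (a : R) (z : 'rV[R]_m) : 'rV[R]_m :=
  z + (f z - a) *: grad f z.

Definition critical_diff m (f : 'rV[R]_m -> R) (a : R) (z : 'rV[R]_m) : 'M[R]_m :=
  1%:M + (grad f z)^T *m grad f z + (f z - a) *: hess f z.

Lemma sdiffv_critical m (f : 'rV[R]_m -> R) a (z : 'rV[R]_m) : C2_at f z ->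
  sdiffv (critical f a) z (critical_diff f a z).
Proof.
move=> [C1f C1p]; have Cf := nbhs_singleton C1f.
have E j : (fun x => critical f a x ord0 j) =
    (fun x => x ord0 j + (f x + - a) * partial j f x).
  by apply/funext => x; rewrite !mxE.
apply: C1_sdiffv => [j|i j]; rewrite E.
  exact: (C1_atD (C1_at_coord z j) (C1_atM (C1_atD Cf (C1_at_cst (- a) z)) (C1p j))).
have dei := is_deriveD (C1_is_derive (delta_mx ord0 i) Cf)
  (is_derive_cst (- a) z (delta_mx ord0 i)).
have := is_deriveD (coord_is_derive z (delta_mx ord0 i) j)
   (is_deriveM dei (C1_is_derive (delta_mx ord0 i) (C1p j))).
move=> /(@derive_val _ _ _ _ _ _ _); rewrite /partial => ->.
rewrite !mxE eqxx /= big_ord1 !mxE !dot_delta !mxE addr0 /GRing.scale/= eq_sym.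
rewrite -addrA; congr (_ + _); rewrite addrC; congr (_ + _); exact: mulrC.
Qed.

(** With [K] a bound for the inverse of [M], an error of at most [|z' - z| / (2 K)] is absorbed by
    the left side, half of which remains. *)
Lemma sdiffv_inverse_lip m (P : 'rV[R]_m -> 'rV[R]_m) (z0 : 'rV[R]_m) (M : 'M[R]_m) :
  M \in unitmx -> sdiffv P z0 M -> exists2 K : R, 0 < K & exists2 r : R, 0 < r &
  forall z z', enorm (z - z0) < r -> enorm (z' - z0) < r ->
    enorm (z' - z) <= K * enorm (P z' - P z).
Proof.
move=> Mu PM; have [K K0 KP] := enorm_mulmx_bound (invmx M).
have K2 : 0 < (2 * K)^-1 by rewrite invr_gt0 mulr_gt0.
have [r r0 rP] := PM _ K2; exists (2 * K); first by rewrite mulr_gt0.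
exists r => // z z' zr z'r; have H := rP z z' zr z'r.
have := KP ((z' - z) *m M); rewrite mulmxK// => H2.
have H3 : enorm ((z' - z) *m M) <= enorm (P z' - P z) + (2 * K)^-1 * enorm (z' - z).
  rewrite enormBC in H.
  by rewrite -[X in enorm X <= _](subrK (P z' - P z)) addrC (le_trans (ler_enormD _ _))// lerD.
have := le_trans H2 (ler_wpM2l (ltW K0) H3).
have E : K * ((2 * K)^-1 * enorm (z' - z)) = enorm (z' - z) / 2 by field; rewrite gt_eqF.
by rewrite mulrDr E -mulrA; lra.
Qed.

(** [P - t G] takes the same value at [z] and [z']. Increments of [P] are at least [1 / K] times
    those of the point, increments of [t G] at most [|t| L] times, so the map is injective once
    [|t| K L < 1]. *)
Lemma implicit_unique m (P G : 'rV[R]_m -> 'rV[R]_m) (z0 : 'rV[R]_m) (M B : 'M[R]_m) :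
  M \in unitmx -> sdiffv P z0 M -> sdiffv G z0 B -> exists2 r : R, 0 < r &
  forall z z' t, enorm (z - z0) < r -> enorm (z' - z0) < r -> `|t| < r ->
    P z' - P z = t *: (G z' - G z) -> z' = z.
Proof.
move=> Mu /(sdiffv_inverse_lip Mu)[K K0 [r1 r10 r1P]] /sdiffv_lip[L L0 [r2 r20 r2P]].
exists (Num.min (K * L)^-1 (Num.min r1 r2)).
  by rewrite !lt_min r10 r20 invr_gt0 mulr_gt0.
move=> z z' t; rewrite !lt_min => /and3P[_ z1 z2] /and3P[_ z'1 z'2] /and3P[tKL _ _] E.
apply/eqP; rewrite -subr_eq0 -enorm_eq0 eq_le enorm_ge0 andbT leNgt; apply/negP => zz'.
have := r1P z z' z1 z'1; rewrite E enormZ; have := r2P z z' z2 z'2 => H1 H2.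
have : enorm (z' - z) <= (K * L * `|t|) * enorm (z' - z).
  rewrite (le_trans H2)// -!mulrA ler_wpM2l ?(ltW K0)// mulrCA ler_wpM2l//.
by rewrite leNgt gtr_pMl ?tKL// -ltr_pdivlMl ?mulr_gt0// mulr1 tKL.
Qed.

(** The curve [zf] is only known to be continuous at 0. The inverse Lipschitz bound first gives
    [|zf h - z0| = O(h)]; strict differentiability of [P] and [u] then upgrades this to a first
    order expansion. *)
Lemma implicit_derive m (P u : 'rV[R]_m -> 'rV[R]_m) (z0 : 'rV[R]_m) (M B : 'M[R]_m)
    (zf : R -> 'rV[R]_m) :
  M \in unitmx -> sdiffv P z0 M -> sdiffv u z0 B -> zf 0 = z0 ->
  (forall e : R, 0 < e -> exists2 r : R, 0 < r & forall h : R, `|h| < r ->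
    enorm (zf h - z0) < e) ->
  (exists2 r : R, 0 < r & forall h : R, `|h| < r -> P (zf h) - P z0 = h *: u (zf h)) ->
  forall e : R, 0 < e -> exists2 r : R, 0 < r & forall h : R, `|h| < r ->
    enorm (zf h - z0 - h *: (u z0 *m invmx M)) <= e * `|h|.
Proof.
move=> Mu PM uB zf0 zfc [r1 r10 r1P] e e0.
have [K K0 KP] := enorm_mulmx_bound (invmx M).
have [K' K'0 [r2 r20 r2P]] := sdiffv_inverse_lip Mu PM.
have [L L0 [r3 r30 r3P]] := sdiffv_lip uB.
pose c := K' * (enorm (u z0) + L).
have c0 : 0 < c by rewrite mulr_gt0// ltr_wpDl.
have e1 : 0 < e / (2 * K * c) by rewrite divr_gt0// mulr_gt0// mulr_gt0.
have [r4 r40 r4P] := PM _ e1.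
have rr : 0 < Num.min (Num.min 1 (e / (2 * K * L))) (Num.min r2 (Num.min r3 r4)).
  by rewrite !lt_min r20 r30 r40 ltr01 divr_gt0// !mulr_gt0.
have [r5 r50 r5P] := zfc _ rr.
exists (Num.min r1 r5); first by rewrite lt_min r10.
move=> h; rewrite lt_min => /andP[/r1P hP /r5P]; rewrite !lt_min.
move=> /andP[/andP[zf1 zfe] /and3P[zr2 zr3 zr4]].
have z00 (r : R) : 0 < r -> enorm (z0 - z0) < r by rewrite subrr enorm0.
have uz : enorm (u (zf h) - u z0) <= L * enorm (zf h - z0) by exact: r3P (z00 _ r30) zr3.
have zl : enorm (zf h - z0) <= c * `|h|.
  have := r2P z0 (zf h) (z00 _ r20) zr2; rewrite hP enormZ => /le_trans; apply.
  rewrite /c -!mulrA ler_wpM2l ?(ltW K'0)// mulrC ler_wpM2r//.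
  rewrite -[u (zf h)](subrK (u z0)) addrC (le_trans (ler_enormD _ _))// lerD2l.
  by rewrite (le_trans uz)// -[leRHS]mulr1 ler_wpM2l// ltW.
have -> : zf h - z0 - h *: (u z0 *m invmx M) =
   ((zf h - z0) *m M - h *: u z0) *m invmx M.
  by rewrite mulmxBl mulmxK// -scalemxAl.
have -> : (zf h - z0) *m M - h *: u z0 =
   h *: (u (zf h) - u z0) - (P (zf h) - P z0 - (zf h - z0) *m M).
  by rewrite hP scalerBr; move: (_ *m M) (h *: u (zf h)) (h *: u z0) => a b w;
     apply/rowP => j; rewrite !mxE; ring.
apply: (le_trans (KP _)).
have H1 := r4P z0 (zf h) (z00 _ r40) zr4.
have H2 : enorm (h *: (u (zf h) - u z0)) <= `|h| * (e / (2 * K)).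
  rewrite enormZ ler_wpM2l// (le_trans uz)//.
  have -> : e / (2 * K) = L * (e / (2 * K * L)) by field; rewrite !gt_eqF.
  by rewrite ler_wpM2l ?ltW.
have H3 : e / (2 * K * c) * enorm (zf h - z0) <= e / (2 * K) * `|h|.
  have -> : e / (2 * K) * `|h| = e / (2 * K * c) * (c * `|h|) by field; rewrite !gt_eqF.
  by rewrite ler_wpM2l// ltW.
apply: (@le_trans _ _ (K * (`|h| * (e / (2 * K)) + e / (2 * K) * `|h|))).
  rewrite ler_wpM2l ?(ltW K0)// (le_trans (ler_enormD _ _))// enormN lerD//.
  exact: le_trans H1 H3.
by rewrite le_eqVlt; apply/orP; left; apply/eqP; field; rewrite gt_eqF.
Qed.

End strict_differentiability.

(** * Distance to a local graph *)

Section head_tail.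
Context {R : realType}.
Implicit Types m : nat.

Lemma rV_headD m (u v : 'rV[R]_m.+1) : rV_head (u + v) = rV_head u + rV_head v.
Proof. by rewrite /rV_head mxE. Qed.

Lemma rV_headZ m k (u : 'rV[R]_m.+1) : rV_head (k *: u) = k * rV_head u.
Proof. by rewrite /rV_head mxE. Qed.

Lemma rV_tailD m (u v : 'rV[R]_m.+1) : rV_tail (u + v) = rV_tail u + rV_tail v.
Proof. by apply/rowP => i; rewrite !mxE. Qed.

Lemma rV_tailZ m k (u : 'rV[R]_m.+1) : rV_tail (k *: u) = k *: rV_tail u.
Proof. by apply/rowP => i; rewrite !mxE. Qed.

Lemma rV_headK m t (z : 'rV[R]_m) : rV_head (rV_cons t z) = t.
Proof. exact: rV_cons0. Qed.

Lemma dot_head_tail m (u v : 'rV[R]_m.+1) :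
  dot u v = rV_head u * rV_head v + dot (rV_tail u) (rV_tail v).
Proof. by rewrite -{1}(rV_eta u) -{1}(rV_eta v) dot_rV_cons. Qed.

Lemma enorm_head m (u : 'rV[R]_m.+1) : `|rV_head u| <= enorm u.
Proof. exact: coord_le_enorm. Qed.

Lemma enorm_tail m (u : 'rV[R]_m.+1) : enorm (rV_tail u) <= enorm u.
Proof.
rewrite -(@ler_pXn2r _ 2) ?nnegrE// !enorm_sqr [leRHS]dot_head_tail lerDr.
by rewrite -expr2 sqr_ge0.
Qed.

Lemma enorm_mulQ m (Q : 'M[R]_m) (u : 'rV[R]_m) : Q *m Q^T = 1%:M ->
  enorm (u *m Q) = enorm u.
Proof. by move=> QQ; rewrite !enormE dot_mulmx. Qed.

Lemma graph_pointK m (Q : 'M[R]_m.+1) phi (z : 'rV[R]_m) : Q *m Q^T = 1%:M ->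
  graph_point Q phi z *m Q = rV_cons (phi z) z.
Proof. by move=> QQ; rewrite -mulmxA (mulmx1C QQ) mulmx1. Qed.

Lemma dist2_graph m (Q : 'M[R]_m.+1) phi (x : 'rV[R]_m.+1) z : Q *m Q^T = 1%:M ->
  dot (x - graph_point Q phi z) (x - graph_point Q phi z) =
  (rV_head (x *m Q) - phi z) ^+ 2 + dot (rV_tail (x *m Q) - z) (rV_tail (x *m Q) - z).
Proof.
move=> QQ; rewrite -(dot_mulmx _ _ QQ) mulmxBl graph_pointK// dot_head_tail.
by rewrite -[- rV_cons _ _]scaleN1r rV_headD rV_tailD rV_headZ rV_tailZ
  rV_headK rV_consK mulN1r scaleN1r expr2.
Qed.

Lemma taylor2_quad (a b c : R) : taylor2 (fun h => a + b * h + c * h ^+ 2) a b c.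
Proof.
apply/taylor2P => e e0; exists 1 => // h _ _.
have -> : a + b * h + c * h ^+ 2 - a - b * h - c * h ^+ 2 = 0 by ring.
by rewrite normr0 mulr_ge0 ?sqr_ge0// ltW.
Qed.

Lemma taylor2_min (f : R -> R) b c (r : R) : taylor2 f (f 0) b c -> 0 < r ->
  (forall h : R, `|h| < r -> f 0 <= f h) -> b = 0 /\ 0 <= c.
Proof.
move=> f2 r0 fmin; split; last first.
  apply: (taylor2_le (taylor2_lin (f 0) 0) f2).
  apply/nbhs_ballP; exists r => // h; rewrite /ball/= sub0r normrN => hr.
  by rewrite mul0r addr0 fmin.
apply/eqP; apply: contrapT => /negP b0.
have [r1 r10 r1P] := (taylor2P f _ _ _).1 f2 1 ltr01.
have bp : 0 < `|b| by rewrite normr_gt0.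
pose c1 := `|c| + 1; have c10 : 0 < c1 by rewrite ltr_wpDl.
pose t := Num.min (Num.min r r1) (`|b| / c1) / 2.
have t0 : 0 < t by rewrite divr_gt0// !lt_min r0 r10 divr_gt0.
have tlt : t < Num.min (Num.min r r1) (`|b| / c1).
  by rewrite /t; move: t0; rewrite /t; lra.
move: tlt; rewrite !lt_min => /andP[/andP[tr tr1]]; rewrite ltr_pdivlMr// => tb.
(* A step against the sign of [b], short enough for the linear term to beat the quadratic one and
   the error. *)
pose h := - Num.sg b * t.
have hE : `|h| = t by rewrite normrM normrN normr_sg b0 mul1r gtr0_norm.
have h0 : h != 0 by rewrite -normr_gt0 hE.
have h2 : h ^+ 2 = t ^+ 2 by rewrite -hE real_normK ?num_real.
have bh : b * h = - (`|b| * t).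
  by rewrite /h mulNr mulrN mulrA [b * _]mulrC -normrEsg.
have := fmin h; rewrite hE => /(_ tr); have := r1P h.
rewrite hE => /(_ tr1 h0); rewrite bh h2 ler_norml => /andP[_ H1] H2.
have cle : c * t ^+ 2 <= `|c| * t ^+ 2 by rewrite ler_wpM2r ?sqr_ge0 ?ler_norm.
have : t * c1 * t < `|b| * t by rewrite ltr_pM2r.
rewrite /c1; lra.
Qed.

(** The point moves along [w] while the graph parameter moves along [zeta]. The case [w = 0] gives
    the first and second variations of the squared distance along the boundary; a basis vector [w]
    gives the comparison for second derivatives of [d]. *)
Lemma dist2_taylor m (Q : 'M[R]_m.+1) phi (x w : 'rV[R]_m.+1) (z zeta : 'rV[R]_m) :
  Q *m Q^T = 1%:M -> C2_at phi z ->
  let A := rV_head (x *m Q) - phi z in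
  let beta := rV_tail (x *m Q) - z in
  let a := rV_head (w *m Q) - dot zeta (grad phi z) in
  let u := rV_tail (w *m Q) - zeta in
  taylor2 (fun h => dot (x + h *: w - graph_point Q phi (z + h *: zeta))
                        (x + h *: w - graph_point Q phi (z + h *: zeta)))
    (A ^+ 2 + dot beta beta) (2 * (A * a + dot beta u))
    (a ^+ 2 + dot u u - A * dot (zeta *m hess phi z) zeta).
Proof.
move=> QQ C2 A beta a u.
pose k := dot (zeta *m hess phi z) zeta.
have T1 : taylor2 (fun h => (rV_head (x *m Q) + rV_head (w *m Q) * h) + (-1) * phi (z + h *: zeta))
    A a (- k / 2).
  have T0 := taylor2D (taylor2_lin (rV_head (x *m Q)) (rV_head (w *m Q)))
    (taylor2Z (k := -1) (taylor2_line (v := zeta) C2)).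
  apply: (taylor2_eq T0).
  - by rewrite mulN1r.
  - by rewrite mulN1r.
  - by rewrite add0r mulN1r mulNr.
have T2 := @taylor2_quad (dot beta beta) (2 * dot beta u) (dot u u).
apply: (@taylor2_ext _ (fun h => ((rV_head (x *m Q) + rV_head (w *m Q) * h) + (-1) * phi (z + h *: zeta)) * 
  ((rV_head (x *m Q) + rV_head (w *m Q) * h) + (-1) * phi (z + h *: zeta)) +
   (dot beta beta + 2 * dot beta u * h + dot u u * h ^+ 2))).
  move=> h; rewrite dist2_graph// mulmxDl -scalemxAl rV_headD rV_headZ rV_tailD rV_tailZ.
  congr (_ + _); first by rewrite expr2 (mulrC h) mulN1r.
  have -> : rV_tail (x *m Q) + h *: rV_tail (w *m Q) - (z + h *: zeta) = beta + h *: u.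
    by apply/rowP => i; rewrite !mxE; ring.
  have E (p q : 'rV[R]_m) : dot (p + h *: q) (p + h *: q) =
      dot p p + 2 * dot p q * h + dot q q * h ^+ 2.
    by rewrite dotDl !dotDr !dotZl !dotZr (dotC q p); ring.
  by rewrite E.
have T3 := taylor2D (taylor2M T1 T1) T2.
apply: (taylor2_eq T3).
- by rewrite expr2.
- by ring.
- by rewrite -/k; field.
Qed.

Lemma critical_point m (Q : 'M[R]_m.+1) phi (x : 'rV[R]_m.+1) (z : 'rV[R]_m) (r : R) :
  Q *m Q^T = 1%:M -> C2_at phi z -> 0 < r ->
  (forall z', enorm (z' - z) < r ->
    enorm (x - graph_point Q phi z) <= enorm (x - graph_point Q phi z')) ->
  critical phi (rV_head (x *m Q)) z = rV_tail (x *m Q).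
Proof.
move=> QQ C2 r0 zmin; apply/rowP => j.
have := @dist2_taylor m Q phi x 0 z (delta_mx ord0 j) QQ C2 => /=.
set F := fun h : R => _; set c0 := (_ ^+ 2 + _); set c1 := 2 * _; set c2 := (_ - _) => T.
have F0 : F 0 = c0.
  by rewrite /F !scale0r !addr0 dist2_graph.
have [] := @taylor2_min F c1 c2 r _ r0.
- by rewrite F0.
- move=> h hr; rewrite /F !scale0r !scaler0 !addr0 -!enorm_sqr ler_pXn2r ?nnegrE//.
  by apply: zmin; rewrite addrAC subrr add0r enormZ enorm_delta mulr1.
rewrite /c1 mul0mx !dot_delta => E _; move/eqP: E; rewrite mulf_eq0 pnatr_eq0/=.
have -> : rV_head (0 : 'rV[R]_m.+1) = 0 by rewrite /rV_head mxE.
have -> : rV_tail (0 : 'rV[R]_m.+1) = 0 by apply/rowP => i; rewrite !mxE.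
rewrite !sub0r dotNr dotC dot_delta => /eqP.
by rewrite /critical !mxE; lra.
Qed.

End head_tail.

Section local_graph_facts.
Context {R : realType} (n : nat) (Omega : set 'rV[R]_n.+1).
Implicit Types (Q : 'M[R]_n.+1) (phi : 'rV[R]_n -> R).

Lemma C2_at_enorm phi (z0 : 'rV[R]_n) (U : set 'rV[R]_n) : open U -> U z0 -> Ck 2 U phi ->
  exists2 r : R, 0 < r & forall z, enorm (z - z0) < r -> C2_at phi z.
Proof. by move=> oU Uz CkU; apply/nbhs_enormP; exact: Ck2_C2_at CkU. Qed.

Lemma graph_pointB Q phi (z z' : 'rV[R]_n) : Q *m Q^T = 1%:M ->
  enorm (graph_point Q phi z - graph_point Q phi z') <=
  `|phi z - phi z'| + enorm (z - z').
Proof.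
move=> QQ; rewrite -(enorm_mulQ _ QQ) mulmxBl !graph_pointK//.
rewrite -[- rV_cons _ _]scaleN1r rV_consZ rV_consD mulN1r scaleN1r.
have -> : rV_cons (phi z - phi z') (z - z') =
    rV_cons (phi z - phi z') 0 + rV_cons 0 (z - z') by rewrite rV_consD addr0 add0r.
rewrite (le_trans (ler_enormD _ _))// lerD//.
  by rewrite enormE dot_rV_cons dot0l addr0 -expr2 sqrtr_sqr.
by rewrite enormE dot_rV_cons mul0r add0r -enormE.
Qed.

(** A boundary point is outside the open set [Omega], hence not above the graph; strictly below, a
    whole neighbourhood would be below by continuity of [phi], against membership in the closure. *)
Lemma boundary_graph y Q phi : open Omega -> local_graph Omega y Q phi ->
  exists2 r : R, 0 < r & forall y', boundary Omega y' -> enorm (y' - y) < r ->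
    y' = graph_point Q phi (rV_tail (y' *m Q)).
Proof.
move=> oO [QQ _ [U [oU Uz CkU]] /nbhs_enormP[r1 r10 r1P]].
have [r2 r20 r2P] := C2_at_enorm oU Uz CkU.
exists (Num.min r1 r2); first by rewrite lt_min r10.
move=> y' By'; rewrite lt_min => /andP[y'r1 y'r2].
suff E : rV_head (y' *m Q) = phi (rV_tail (y' *m Q)).
  rewrite /graph_point -E rV_eta -mulmxA QQ mulmx1 //.
have nOy' := boundaryN oO By'.
have hd_le : rV_head (y' *m Q) <= phi (rV_tail (y' *m Q)).
  by rewrite leNgt; apply/negP => /(r1P y' y'r1).2.
apply/eqP; rewrite eq_le hd_le/= leNgt; apply/negP => lt_hd.
set eta := phi (rV_tail (y' *m Q)) - rV_head (y' *m Q).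
have eta0 : 0 < eta / 2 by rewrite divr_gt0 ?subr_gt0.
have tl_le (u v : 'rV[R]_n.+1) : enorm (rV_tail (u *m Q) - rV_tail (v *m Q)) <= enorm (u - v).
  have -> : rV_tail (u *m Q) - rV_tail (v *m Q) = rV_tail ((u - v) *m Q).
    by rewrite mulmxBl -(scaleN1r (v *m Q)) rV_tailD rV_tailZ scaleN1r.
  by rewrite -(enorm_mulQ (u - v) QQ) enorm_tail.
have hd_lip (u v : 'rV[R]_n.+1) : `|rV_head (u *m Q) - rV_head (v *m Q)| <= enorm (u - v).
  have -> : rV_head (u *m Q) - rV_head (v *m Q) = rV_head ((u - v) *m Q).
    by rewrite mulmxBl -(scaleN1r (v *m Q)) rV_headD rV_headZ mulN1r.
  by rewrite -(enorm_mulQ (u - v) QQ) enorm_head.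
have C2y' : C2_at phi (rV_tail (y' *m Q)).
  by apply: r2P; exact: le_lt_trans (tl_le _ _) y'r2.
have [r3 r30 r3P] := (continuous_enormP _ _).1 (C1_continuous (nbhs_singleton C2y'.1)) _ eta0.
have [clO _] := By'.
have [x [Ox xr]] : Omega `&` [set x | enorm (x - y') < Num.min (r1 - enorm (y' - y)) (Num.min r3 (eta / 2))] !=set0.
  apply: clO; apply/nbhs_enormP; eexists; last by move=> x xr; exact: xr.
  by rewrite !lt_min r30 eta0 subr_gt0 y'r1.
move: xr => /=; rewrite !lt_min => /and3P[xr1 xr3 xeta].
have : enorm (x - y) < r1 by rewrite (le_lt_trans (enorm_triangle y' _ _))// -ltrBrDr.
move=> /r1P[/(_ Ox) + _].
have := r3P _ (le_lt_trans (tl_le x y') xr3); have := le_lt_trans (hd_lip x y') xeta.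
rewrite /eta !ltr_norml => /andP[? ?] /andP[? ?]; lra.
Qed.

Lemma graph_outside y Q phi : local_graph Omega y Q phi ->
  y = graph_point Q phi (rV_tail (y *m Q)) ->
  exists2 r : R, 0 < r & forall z, enorm (z - rV_tail (y *m Q)) < r ->
    ~ Omega (graph_point Q phi z).
Proof.
move=> [QQ _ [U [oU Uz CkU]] /nbhs_enormP[r1 r10 r1P]] yE.
have [r2 r20 r2P] := C2_at_enorm oU Uz CkU.
have C2 : C2_at phi (rV_tail (y *m Q)) by apply: r2P; rewrite subrr enorm0.
have r12 : 0 < r1 / 2 by rewrite divr_gt0.
have [r3 r30 r3P] := (continuous_enormP _ _).1 (C1_continuous (nbhs_singleton C2.1)) _ r12.
exists (Num.min r3 (r1 / 2)); first by rewrite lt_min r30.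
move=> z; rewrite lt_min => /andP[zr3 zr1].
have : enorm (graph_point Q phi z - y) < r1.
  rewrite {1}yE (le_lt_trans (graph_pointB _ _ _ QQ))//.
  by have := r3P z zr3; lra.
move=> /r1P[+ _] => H /H; rewrite graph_pointK// rV_headK rV_consK ltxx.
done.
Qed.

End local_graph_facts.

(** * Foot points in graph coordinates and the second derivative of the distance *)

Section foot_point.
Context {R : realType} (n : nat) (Omega : set 'rV[R]_n.+1).
Implicit Types (Q : 'M[R]_n.+1) (phi : 'rV[R]_n -> R).
Local Notation d := (dist_compl Omega).
Local Notation near_pt := (near_pt Omega).

(** Feet of points near [x] stay near [y] by [near_pt_stable], hence lie on the graph. As the graph
    near [y] is outside [Omega], each foot minimises the distance locally in the parameter and so
    solves the [critical] equation. *)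
Lemma foot_critical (oO : open Omega) (cO : ~` Omega !=set0) x y Q phi :
  Omega x -> near_pt x y -> (forall y', near_pt x y' -> y' = y) ->
  local_graph Omega y Q phi ->
  [/\ C2_at phi (rV_tail (y *m Q)), y = graph_point Q phi (rV_tail (y *m Q)) &
  forall e : R, 0 < e -> exists2 r : R, 0 < r & forall x' y', enorm (x' - x) < r ->
    near_pt x' y' -> [/\ Omega x', y' = graph_point Q phi (rV_tail (y' *m Q)),
      enorm (rV_tail (y' *m Q) - rV_tail (y *m Q)) < e &
      critical phi (rV_head (x' *m Q)) (rV_tail (y' *m Q)) = rV_tail (x' *m Q)]].
Proof.
move=> Ox xy yuniq lg; have By := near_pt_boundary oO cO Ox xy.
have [QQ _ [U [oU Uz CkU]] _] := lg.
have [r1 r10 r1P] := boundary_graph oO lg.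
have yE : y = graph_point Q phi (rV_tail (y *m Q)).
  by apply: r1P => //; rewrite subrr enorm0.
have [r2 r20 r2P] := graph_outside lg yE.
have [r3 r30 r3P] := C2_at_enorm oU Uz CkU.
split=> //; first by apply: r3P; rewrite subrr enorm0.
move=> e e0.
have rr : 0 < Num.min (Num.min e r1) (Num.min (r2 / 2) r3).
  by rewrite !lt_min e0 r10 r30 divr_gt0.
have [r4 r40 r4P] := near_pt_stable oO cO yuniq rr.
have /nbhs_enormP[r5 r50 r5P] : nbhs x Omega by exact: open_nbhs_nbhs.
exists (Num.min r4 r5); first by rewrite lt_min r40.
move=> x' y'; rewrite lt_min => /andP[/r4P xr4 /r5P Ox'] xy'.
have := xr4 y' xy'; rewrite !lt_min => /andP[/andP[y'e y'1] /andP[y'2 y'3]].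
have tl_le (u v : 'rV[R]_n.+1) : enorm (rV_tail (u *m Q) - rV_tail (v *m Q)) <= enorm (u - v).
  have -> : rV_tail (u *m Q) - rV_tail (v *m Q) = rV_tail ((u - v) *m Q).
    by rewrite mulmxBl -(scaleN1r (v *m Q)) rV_tailD rV_tailZ scaleN1r.
  by rewrite -(enorm_mulQ (u - v) QQ) enorm_tail.
have y'E := r1P y' (near_pt_boundary oO cO Ox' xy') y'1.
split => //; first exact: le_lt_trans (tl_le _ _) y'e.
have r22 : 0 < r2 / 2 by rewrite divr_gt0.
have C2' : C2_at phi (rV_tail (y' *m Q)).
  by apply: r3P; exact: le_lt_trans (tl_le _ _) y'3.
apply: (critical_point QQ C2' r22) => z zr.
rewrite -y'E xy'.2; apply: dist_le => //; apply: r2P.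
rewrite (le_lt_trans (enorm_triangle (rV_tail (y' *m Q)) _ _))//.
by have := tl_le y' y; lra.
Qed.

(** By [segment_growth], |xs - P z|^2 - (1 - k) |P z - y|^2, with [P = graph_point Q phi], has a
    local minimum at [z0]. Nonnegativity of its second variation bounds the quadratic form of [M]
    below by [(1 - k) |zeta|^2]. *)
Lemma critical_diff_unit (oO : open Omega) (cO : ~` Omega !=set0) x y Q phi (k : R) :
  Omega x -> near_pt x y -> 0 < k -> k < 1 -> local_graph Omega y Q phi ->
  critical_diff phi (rV_head ((y + k *: (x - y)) *m Q)) (rV_tail (y *m Q)) \in unitmx.
Proof.
move=> Ox xy k0 k1 lg; have By := near_pt_boundary oO cO Ox xy.
have [QQ _ [U [oU Uz CkU]] _] := lg.
have [r1 r10 r1P] := boundary_graph oO lg.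
have yE : y = graph_point Q phi (rV_tail (y *m Q)).
  by apply: r1P => //; rewrite subrr enorm0.
have [r2 r20 r2P] := graph_outside lg yE.
have [r3 r30 r3P] := C2_at_enorm oU Uz CkU.
set z0 := rV_tail (y *m Q) in yE r2P r3P *; set xs := y + k *: (x - y).
have C2 : C2_at phi z0 by apply: r3P; rewrite subrr enorm0.
set M := critical_diff _ _ _.
have pos (zeta : 'rV[R]_n) : (1 - k) * dot zeta zeta <= dot (zeta *m M) zeta.
  have [->|zeta0] := eqVneq zeta 0; first by rewrite mul0mx dot0r mulr0.
  have T1 := @dist2_taylor _ _ Q phi xs 0 z0 zeta QQ C2.
  have T2 := @dist2_taylor _ _ Q phi y 0 z0 zeta QQ C2.
  have := taylor2D T1 (taylor2Z (k := - (1 - k)) T2).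
  set F := fun h : R => _; set c0 := (X in taylor2 _ X); set c1 := (X in taylor2 _ _ X).
  set c2 := (X in taylor2 _ _ _ X) => T.
  have FE h : F h = dot (xs - graph_point Q phi (z0 + h *: zeta)) (xs - graph_point Q phi (z0 + h *: zeta))
      - (1 - k) * dot (graph_point Q phi (z0 + h *: zeta) - y) (graph_point Q phi (z0 + h *: zeta) - y).
    rewrite /F !scaler0 !addr0 mulNr; congr (_ - _ * _).
    by rewrite -!enorm_sqr enormBC.
  have F0 : F 0 = (k * d x) ^+ 2.
    rewrite FE scale0r addr0 -yE subrr dot0l mulr0 subr0 /xs addrAC subrr add0r.
    by rewrite dotZl dotZr -enorm_sqr xy.2; ring.
  have T0 : taylor2 F (F 0) c1 c2.
    apply: (taylor2_eq T) => //; rewrite F0 /c0.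
    have := FE 0; rewrite F0 scale0r addr0 -yE subrr dot0l mulr0 subr0 => ->.
    rewrite [in RHS]yE dist2_graph// -/z0.
    have -> : rV_head (y *m Q) - phi z0 = 0.
      by rewrite yE graph_pointK// rV_headK subrr.
    by rewrite -/z0 subrr dot0l expr0n /= addr0 mulr0 addr0.
  have zp : 0 < enorm zeta by rewrite enorm_gt0.
  have rz : 0 < r2 / enorm zeta by rewrite divr_gt0.
  have Fmin (h : R) : `|h| < r2 / enorm zeta -> F 0 <= F h.
    move=> hr; rewrite F0 FE lerBrDr; apply: segment_growth => //.
    by apply: r2P; rewrite addrAC subrr add0r enormZ -ltr_pdivlMr.
  have [_] := taylor2_min T0 rz Fmin.
  rewrite /c2 /M /critical_diff.
  have -> : rV_head ((0 : 'rV[R]_n.+1) *m Q) = 0 by rewrite mul0mx /rV_head mxE.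
  have -> : rV_tail ((0 : 'rV[R]_n.+1) *m Q) = 0.
    by rewrite mul0mx; apply/rowP => i; rewrite !mxE.
  have -> : rV_head (y *m Q) - phi z0 = 0.
    by rewrite {1}yE graph_pointK// rV_headK subrr.
  rewrite mul0r subr0 !sub0r sqrrN !dotNl !dotNr opprK mulmxDr mulmxDr mulmx1.
  rewrite -scalemxAr !dotDl dotZl mulmxA.
  have -> : dot (zeta *m (grad phi z0)^T *m grad phi z0) zeta = dot zeta (grad phi z0) ^+ 2.
    rewrite [zeta *m _]mx11_scalar -dotE mul_scalar_mx dotZl expr2.
    by rewrite (dotC (grad _ _)).
  have := sqr_ge0 (dot zeta (grad phi z0)).
  move: (dot zeta (grad phi z0) ^+ 2) => G G0.
  have := mulr_ge0 (_ : 0 <= 1 - k) G0; rewrite subr_ge0 (ltW k1) => /(_ isT); lra.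
rewrite -row_free_unit; apply: inj_row_free => v vM.
apply/eqP; rewrite -dot_eq0 eq_le dot_ge0 andbT.
have := pos v; rewrite vM dot0l pmulr_rle0// subr_gt0 //.
Qed.

Lemma sdiffv_affine m k (G : 'rV[R]_m -> 'rV[R]_k) (z0 : 'rV[R]_m) (B : 'M[R]_(m, k))
    (c : 'rV[R]_k) (t : R) : sdiffv G z0 B -> sdiffv (fun z => c + t *: G z) z0 (t *: B).
Proof.
move=> GB e e0; have t1 : 0 < `|t| + 1 by rewrite ltr_wpDl.
have et : 0 < e / (`|t| + 1) by rewrite divr_gt0.
have [r r0 rP] := GB _ et; exists r => // z z' zr z'r.
have -> : c + t *: G z' - (c + t *: G z) - (z' - z) *m (t *: B) =
    t *: (G z' - G z - (z' - z) *m B).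
  rewrite -scalemxAr; move: (_ *m B) => w; apply/rowP => i; rewrite !mxE; ring.
rewrite enormZ; apply: (@le_trans _ _ (`|t| * (e / (`|t| + 1) * enorm (z' - z)))).
  by rewrite ler_wpM2l// rP.
rewrite mulrA ler_wpM2r// mulrCA ger_pMr// ler_pdivrMr// mul1r lerDl //.
Qed.

(** Two feet of [x'] solve the critical equation at the height of [x']. Rewritten at the height of
    [x], the two values differ by [t] times the increment of [grad phi], the situation of
    [implicit_unique]. *)
Lemma dist_unique_near (oO : open Omega) (cO : ~` Omega !=set0) x y Q phi :
  Omega x -> near_pt x y -> (forall y', near_pt x y' -> y' = y) ->
  local_graph Omega y Q phi ->
  critical_diff phi (rV_head (x *m Q)) (rV_tail (y *m Q)) \in unitmx ->
  exists2 r : R, 0 < r & forall x', enorm (x' - x) < r ->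
    Omega x' /\ forall y' y'', near_pt x' y' -> near_pt x' y'' -> y'' = y'.
Proof.
move=> Ox xy yuniq lg Mu; have [QQ _ _ _] := lg.
have [C2 yE foot] := foot_critical oO cO Ox xy yuniq lg.
have [r1 r10 r1P] := implicit_unique Mu (sdiffv_critical (rV_head (x *m Q)) C2) (sdiffv_grad C2).
have [r2 r20 r2P] := foot _ r10.
exists (Num.min r1 r2); first by rewrite lt_min r10.
move=> x'; rewrite lt_min => /andP[x'1 x'2].
have [y0 xy0] := near_pt_ex oO cO x'.
split; first by have [] := r2P x' y0 x'2 xy0.
move=> y' y'' xy' xy''.
have [_ y'E y'1 cy'] := r2P x' y' x'2 xy'; have [_ y''E y''1 cy''] := r2P x' y'' x'2 xy''.
suff zz : rV_tail (y'' *m Q) = rV_tail (y' *m Q) by rewrite y'E y''E zz.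
pose t := rV_head (x' *m Q) - rV_head (x *m Q).
apply: (r1P _ _ t) => //.
  rewrite (le_lt_trans _ x'1)// -(enorm_mulQ _ QQ); apply: le_trans (enorm_head _).
  by rewrite mulmxBl -(scaleN1r (x *m Q)) rV_headD rV_headZ mulN1r.
have E z : critical phi (rV_head (x *m Q)) z = critical phi (rV_head (x' *m Q)) z + t *: grad phi z.
  rewrite /critical -addrA -scalerDl; congr (_ + _ *: _); rewrite /t; ring.
rewrite !E cy' cy'' scalerBr opprD addrACA subrr add0r //.
Qed.

Lemma is_derive_near (f g : R -> R) (l r : R) : 0 < r ->
  (forall h : R, `|h| < r -> f h = g h) -> is_derive (0 : R) 1 f l -> is_derive (0 : R) 1 g l.
Proof.
move=> r0 fg /is_deriveP H; apply/is_deriveP => e /H[r1 r10 r1P].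
exists (Num.min r r1); first by rewrite lt_min r0.
move=> h; rewrite lt_min => /andP[hr hr1].
have h0 : `|0 : R| < r by rewrite normr0.
have hE : 0 + h *: (1 : R) = h by rewrite add0r [_%:A]mulr1.
by have := r1P h hr1; rewrite hE !fg.
Qed.

(** Near [x], [D_v d] at [x + h v] is [<x + h v - foot, v> / d], and the foot, read in graph
    coordinates, is differentiable at [h = 0] by [implicit_derive]. *)
Lemma dist_second_derivative (oO : open Omega) (cO : ~` Omega !=set0) x y Q phi v :
  Omega x -> near_pt x y -> (forall y', near_pt x y' -> y' = y) ->
  local_graph Omega y Q phi ->
  critical_diff phi (rV_head (x *m Q)) (rV_tail (y *m Q)) \in unitmx ->
  exists l, is_derive x v (fun x' => 'D_v d x') l.
Proof.
move=> Ox xy yuniq lg Mu; have [QQ _ _ _] := lg.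
have [C2 yE foot] := foot_critical oO cO Ox xy yuniq lg.
have [r1 r10 r1P] := dist_unique_near oO cO Ox xy yuniq lg Mu.
set z0 := rV_tail (y *m Q) in Mu yE foot C2.
pose foot_of x' := sval (cid (near_pt_ex oO cO x')).
have footP x' : near_pt x' (foot_of x') by exact: svalP (cid (near_pt_ex oO cO x')).
pose zf (h : R) := rV_tail (foot_of (x + h *: v) *m Q).
have zf0 : zf 0 = z0.
  by rewrite /zf scale0r addr0; congr (rV_tail (_ *m Q)); apply: yuniq.
have small (r : R) : 0 < r -> exists2 s : R, 0 < s & forall h : R, `|h| < s ->
    enorm (x + h *: v - x) < r.
  move=> r0; exists (r / (enorm v + 1)); first by rewrite divr_gt0// ltr_wpDl.
  move=> h; rewrite ltr_pdivlMr ?ltr_wpDl// addrAC subrr add0r enormZ mulrDr mulr1.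
  by apply: le_lt_trans; rewrite lerDl.
(* A displacement [h v] shifts the target of the critical equation by [h] times the tail of [v] and
   its height parameter by [h] times the head; [u] collects both effects. *)
pose u (z : 'rV[R]_n) := rV_tail (v *m Q) + rV_head (v *m Q) *: grad phi z.
have uD : sdiffv u z0 (rV_head (v *m Q) *: hess phi z0).
  exact: sdiffv_affine (sdiffv_grad C2).
have zfc (e : R) : 0 < e -> exists2 r : R, 0 < r & forall h : R, `|h| < r ->
    enorm (zf h - z0) < e.
  move=> /foot[r2 r20 r2P]; have [s s0 sP] := small _ r20; exists s => // h hs.
  by have [] := r2P _ _ (sP h hs) (footP _).
have zfe : exists2 r : R, 0 < r & forall h : R, `|h| < r ->
    critical phi (rV_head (x *m Q)) (zf h) - critical phi (rV_head (x *m Q)) z0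
      = h *: u (zf h).
  have [r2 r20 r2P] := foot 1 ltr01; have [s s0 sP] := small _ r20; exists s => // h hs.
  have [_ _ _ ch] := r2P _ _ (sP h hs) (footP _).
  have x0 : enorm (x - x) < r2 by rewrite subrr enorm0.
  have [_ _ _ c0] := r2P x y x0 xy; rewrite -/z0 in c0.
  rewrite c0; have E : critical phi (rV_head (x *m Q)) (zf h) =
     critical phi (rV_head ((x + h *: v) *m Q)) (zf h) + (h * rV_head (v *m Q)) *: grad phi (zf h).
    rewrite /critical -addrA -scalerDl; congr (_ + _ *: _).
    by rewrite mulmxDl -scalemxAl rV_headD rV_headZ; ring.
  rewrite E ch mulmxDl -scalemxAl rV_tailD rV_tailZ /u scalerDr scalerA.
  by rewrite -[X in X - _]addrA addrAC subrr add0r.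
have zfd := implicit_derive Mu (sdiffv_critical _ C2) uD zf0 zfc zfe.
set zeta := u z0 *m invmx _ in zfd.
have Dzf : is_derive (0 : R) 1 zf zeta.
  apply: is_derive_row => i; apply/is_deriveP => e e0.
  have [r r0 rP] := zfd e e0; exists r => // h /rP; apply: le_trans.
  have -> : 0 + h *: (1 : R) = h by rewrite add0r [_%:A]mulr1.
  apply: le_trans (coord_le_enorm _ i).
  by rewrite zf0 !mxE.
have Dphi : is_derive (0 : R) 1 (fun h => phi (zf h)) (dot zeta (grad phi z0)).
  apply/is_deriveP => e e0.
  pose c := enorm zeta + 1; have c0 : 0 < c by rewrite ltr_wpDl.
  pose g := enorm (grad phi z0) + 1; have g0 : 0 < g by rewrite ltr_wpDl.
  have e1 : 0 < e / (2 * c) by rewrite divr_gt0// mulr_gt0.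
  have e2 : 0 < Num.min 1 (e / (2 * g)) by rewrite lt_min ltr01 divr_gt0// mulr_gt0.
  have [r2 r20 r2P] := strict_diff (nbhs_singleton C2.1) e1.
  have [r3 r30 r3P] := zfd _ e2; have [r4 r40 r4P] := zfc _ r20.
  exists (Num.min r3 r4); first by rewrite lt_min r30.
  move=> h; rewrite lt_min => /andP[/r3P H3 /r4P H4].
  have -> : 0 + h *: (1 : R) = h by rewrite add0r [_%:A]mulr1.
  rewrite zf0; have z00 : enorm (z0 - z0) < r2 by rewrite subrr enorm0.
  have H2 := r2P z0 (zf h) z00 H4.
  have H3a : enorm (zf h - z0 - h *: zeta) <= `|h|.
    by rewrite (le_trans H3)// ler_piMl// ge_min lexx.
  have H3b : enorm (zf h - z0 - h *: zeta) <= e / (2 * g) * `|h|.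
    by rewrite (le_trans H3)// ler_wpM2r// ge_min lexx orbT.
  have H5 : enorm (zf h - z0) <= c * `|h|.
    rewrite -(subrK (h *: zeta) (zf h - z0)) (le_trans (ler_enormD _ _))//.
    by rewrite /c mulrDl mul1r addrC lerD// enormZ mulrC.
  have -> : phi (zf h) - phi z0 - h * dot zeta (grad phi z0) =
    (phi (zf h) - phi z0 - dot (zf h - z0) (grad phi z0)) +
     dot (zf h - z0 - h *: zeta) (grad phi z0) by rewrite !dotBl dotZl; ring.
  rewrite (le_trans (ler_normD _ _))// (splitr e) mulrDl lerD//.
    rewrite (le_trans H2)//; have -> : e / 2 * `|h| = e / (2 * c) * (c * `|h|).
      by field; rewrite gt_eqF.
    by rewrite ler_wpM2l// ltW.
  rewrite (le_trans (dot_norm_le _ _))//.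
  have -> : e / 2 * `|h| = (e / (2 * g) * `|h|) * g by field; rewrite gt_eqF.
  by rewrite ler_pM// /g lerDl.
have Dgp := is_derive_mulmx Q^T (is_derive_rV_cons Dphi Dzf).
have Dline (w : 'rV[R]_n.+1) : is_derive (0 : R) 1 (fun h : R => x + h *: w) w.
  apply: is_derive_row => i; apply/is_deriveP => e e0; exists 1 => // h _.
  have -> : 0 + h *: (1 : R) = h by rewrite add0r [_%:A]mulr1.
  have -> : (x + h *: w) ord0 i - (x + 0 *: w) ord0 i - h * w ord0 i = 0.
    by rewrite !mxE; ring.
  by rewrite normr0 mulr_ge0// ltW.
have Ddiff : is_derive (0 : R) 1 (fun h => x + h *: v - graph_point Q phi (zf h))
    (v - rV_cons (dot zeta (grad phi z0)) zeta *m Q^T).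
  exact: is_deriveB (Dline v) Dgp.
have Dnum : is_derive (0 : R) 1 (fun h => dot (x + h *: v - graph_point Q phi (zf h)) v)
    (dot (v - rV_cons (dot zeta (grad phi z0)) zeta *m Q^T) v).
  apply: is_derive_sumr => i.
  have := is_deriveM (is_derive_coord i Ddiff) (is_derive_cst (v ord0 i) (0 : R) (1 : R)).
  by rewrite scaler0 add0r [_ *: _]mulrC.
have dx : 0 < d x := dist_gt0 oO cO Ox.
have Dd : is_derive (x + (0 : R) *: v) v d (dot (x - y) v / d x).
  by rewrite scale0r addr0; exact: dist_is_derive.
have Dd0 := (is_derive_line _ _ _ _ _).1 Dd.
have dne : (fun h : R => d (x + h *: v)) 0 != 0 by rewrite scale0r addr0 gt_eqF.
have Dinv := @is_deriveV R (fun h : R => d (x + h *: v)) 0 _ 1 dne Dd0.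
have Dquot := is_deriveM Dnum Dinv.
set l := (X in is_derive _ _ _ X) in Dquot; exists l.
have : is_derive (x + (0 : R) *: v) v (fun x' => 'D_v d x') l.
  apply: (is_derive_line _ _ _ _ _).2.
  have [r2 r20 r2P] := foot 1 ltr01.
  have rr : 0 < Num.min r1 r2 by rewrite lt_min r10.
  have [s s0 sP] := small _ rr.
  (* The formula for [D_v d] is available only where feet are unique, that is, for small [h]. *)
  apply: (is_derive_near s0 _ Dquot) => h /sP; rewrite lt_min => /andP[h1 h2].
  have [Oh uh] := r1P _ h1.
  have [_ fE _ _] := r2P _ _ h2 (footP _).
  have := dist_is_derive oO cO v Oh (footP _) (fun y' H => uh _ _ (footP _) H).
  move=> /(@derive_val _ _ _ _ _ _ _) ->.
  by rewrite {1}fE.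
by rewrite scale0r addr0.
Qed.

End foot_point.

(** * The good set *)

Section good_points.
Context {R : realType} (n : nat) (Omega : set 'rV[R]_n.+1).
Local Notation d := (dist_compl Omega).
Local Notation near_pt := (near_pt Omega).

Lemma open_enorm_ball m (x : 'rV[R]_m) (r : R) : open [set y | enorm (y - x) < r].
Proof.
rewrite openE => y /= yr; apply/nbhs_enormP; exists (r - enorm (y - x)).
  by rewrite subr_gt0.
move=> z zy /=; rewrite (le_lt_trans (enorm_triangle y _ _))//.
by rewrite -ltrBrDr.
Qed.

Lemma domain_complement : open Omega -> boundary Omega !=set0 -> ~` Omega !=set0.
Proof. by move=> oO [y By]; exists y; exact: boundaryN. Qed.

Definition inner_point x y := exists x' k, [/\ Omega x', near_pt x' y,
  0 < k < 1 & x = y + k *: (x' - y)].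

Lemma inner_point_regular (oO : open Omega) (cO : ~` Omega !=set0)
    (C2 : C2_boundary Omega) x y : inner_point x y ->
  [/\ Omega x, near_pt x y & exists2 r : R, 0 < r & forall w, enorm (w - x) < r ->
    Omega w /\ forall z z', near_pt w z -> near_pt w z' -> z' = z] /\
  forall v, exists l, is_derive x v (fun w => 'D_v d w) l.
Proof.
move=> [x' [k [Ox' xy' /andP[k0 k1] ->]]].
have xy := segment_near cO xy' k0 k1.
have dx' := dist_gt0 oO cO Ox'.
have Ox : Omega (y + k *: (x' - y)).
  apply: contrapT => /(dist_out cO); rewrite (segment_dist cO xy')// => /eqP.
  by rewrite mulf_eq0 !gt_eqF.
have By := near_pt_boundary oO cO Ox' xy'.
have [Q [phi lg]] := C2 y By.
have uniq := segment_uniq cO xy' k0 k1.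
have Mu := critical_diff_unit oO cO Ox' xy' k0 k1 lg.
split; first by split=> //; exact: (dist_unique_near oO cO Ox xy uniq lg Mu).
by move=> v; exact: (dist_second_derivative oO cO v Ox xy uniq lg Mu).
Qed.

Lemma inner_point_good (oO : open Omega) (cO : ~` Omega !=set0)
    (C2 : C2_boundary Omega) x y : inner_point x y -> good_set Omega x.
Proof.
move=> /(inner_point_regular oO cO C2)[[Ox _ [r r0 rP]] _].
exists [set w | enorm (w - x) < r]; last by rewrite /= subrr enorm0.
split; [exact: open_enorm_ball|by move=> w /rP[]|].
move=> w /rP[Ow uw]; have [z wz] := near_pt_ex oO cO w.
exists z; split; first exact/nearest_pointP.
by move=> z' /(nearest_pointP oO cO _ Ow) wz'; apply: uw.
Qed.

Lemma good_unique (oO : open Omega) (cO : ~` Omega !=set0) x : good_set Omega x ->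
  exists2 r : R, 0 < r & forall w, enorm (w - x) < r ->
    Omega w /\ forall z z', near_pt w z -> near_pt w z' -> z' = z.
Proof.
move=> [U [oU UO uU] Ux]; have /nbhs_enormP[r r0 rP] : nbhs x U by exact: open_nbhs_nbhs.
exists r => // w /rP Uw; have Ow := UO _ Uw; split=> // z z' wz wz'.
have [y [_ yu]] := uU w Uw.
by rewrite -(yu z ((nearest_pointP oO cO _ Ow).2 wz))
  -(yu z' ((nearest_pointP oO cO _ Ow).2 wz')).
Qed.

(* If d had slope < 1 away from x it could be increased along the gradient, so a
   maximiser of d - (1 - e)|. - x| on a ball lies on the sphere: d reaches the value
   d x + rho at distance rho from x, which forces a straight minimal segment. *)
Lemma good_inner_point (oO : open Omega) (cO : ~` Omega !=set0) x : good_set Omega x ->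
  exists y, inner_point x y.
Proof.
move=> /(good_unique oO cO)[r r0 rP].
have xr : enorm (x - x) < r by rewrite subrr enorm0.
have [Ox ux] := rP x xr; have [y xy] := near_pt_ex oO cO x.
have dx := dist_gt0 oO cO Ox.
pose tau := r / 2; have tau0 : 0 < tau by rewrite divr_gt0.
have taur : tau < r by rewrite /tau; lra.
pose B := [set: 'rV[R]_n.+1] `&` [set w | enorm (w - x) <= tau].
have cptB : compact B by apply: compact_enorm; exact: closedT.
have Bx : B x by split=> //=; rewrite subrr enorm0 ltW.
have B0 : B !=set0 by exists x.
have cd : {within B, continuous d}.
  by apply: continuous_subspaceT; exact: dist_continuous.
have [xp] := compact_EVT_max B0 cptB cd; rewrite inE => -[_ /= xpx] xpmax.
have xpd : d x + tau <= d xp.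
  apply/ler_addgt0Pr => e e0.
  pose e' := Num.min 1 (e / tau) / 2.
  have e'0 : 0 < e' by rewrite divr_gt0// lt_min ltr01 divr_gt0.
  have /andP[e'1 e'e] : (e' < 1) && (e' * tau < e).
    rewrite -(ltr_pdivlMr _ _ tau0); have : e' < Num.min 1 (e / tau).
      by move: e'0; rewrite /e'; lra.
    by rewrite lt_min.
  have cF : {within B, continuous (fun w => d w - (1 - e') * enorm (w - x))}.
    apply: continuous_subspaceT => w; apply: continuousB.
      exact: dist_continuous.
    apply: continuousM; first exact: cst_continuous.
    have -> : (fun w : 'rV[R]_n.+1 => enorm (w - x)) = (fun w => enorm (x - w)).
      by apply/funext => z; rewrite enormBC.
    exact: continuous_enormB.
  have [w] := compact_EVT_max B0 cptB cF; rewrite inE => -[_ /= wx] wmax.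
  have wE : enorm (w - x) = tau.
    apply/eqP; rewrite eq_le wx/= leNgt; apply/negP => wlt.
    have [Ow uw] := rP w (le_lt_trans wx taur).
    have [z wz] := near_pt_ex oO cO w.
    have dw := dist_gt0 oO cO Ow.
    (* The unit direction away from the foot, along which [d] has slope 1: a short step gains more
       in [d] than [1 - e'] times its length. *)
    pose v := (d w)^-1 *: (w - z).
    have v1 : enorm v = 1.
      by rewrite enormZ wz.2 gtr0_norm ?invr_gt0// mulVf// gt_eqF.
    have := dist_is_derive oO cO v Ow wz (fun z' H => uw _ _ wz H).
    have -> : dot (w - z) v / d w = 1.
      by rewrite dotZr -enorm_sqr wz.2; field; rewrite gt_eqF.
    move=> /is_deriveP /(_ (e' / 2)); rewrite divr_gt0// => /(_ isT)[s s0 sP].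
    pose h := Num.min s (tau - enorm (w - x)) / 2.
    have hp : 0 < Num.min s (tau - enorm (w - x)) by rewrite lt_min s0 subr_gt0.
    have h0 : 0 < h by rewrite divr_gt0.
    have : h < Num.min s (tau - enorm (w - x)) by move: hp; rewrite /h; lra.
    rewrite lt_min => /andP[hs htau].
    have hn : `|h| = h by rewrite gtr0_norm.
    have whx : enorm (w + h *: v - x) <= enorm (w - x) + h.
      rewrite [w + _ - x]addrAC (le_trans (ler_enormD _ _))//.
      by rewrite enormZ v1 hn mulr1.
    have Bwh : w + h *: v \in B by rewrite inE; split=> //=; lra.
    have := wmax _ Bwh; have := sP h; rewrite hn => /(_ hs); rewrite ler_norml mulr1.
    move=> /andP[H1 _] H2.
    have H3 : (1 - e') * enorm (w + h *: v - x) <= (1 - e') * (enorm (w - x) + h).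
      by rewrite ler_wpM2l// subr_ge0 ltW.
    have H4 : 0 < e' * h by rewrite mulr_gt0.
    by move: H1 H2 H3 H4; rewrite mulrDr; lra.
  have := wmax x; rewrite inE => /(_ Bx); rewrite subrr enorm0 mulr0 subr0 wE => H1.
  have : d w <= d xp by apply: xpmax; rewrite inE; split => //=; rewrite wE.
  by move: H1 e'e; rewrite mulrBl mul1r; lra.
have xpy : enorm (xp - y) = d x + tau /\ d xp = d x + tau /\ enorm (xp - x) = tau.
  have H1 := enorm_triangle x xp y; rewrite xy.2 in H1.
  by have H2 := dist_le xp xy.1; split; [|split]; lra.
have [xpy1 [xpd1 xpx1]] := xpy.
(* [y] is also a foot of [xp], and [x] divides the segment from [y] to [xp] in the ratio
   [d x : tau]. *)
exists y, xp, (d x / (d x + tau)); split.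
- by apply: contrapT => /(dist_out cO); rewrite xpd1; lra.
- by split; [exact: xy.1|rewrite xpy1].
- rewrite divr_gt0 ?addr_gt0//= ltr_pdivrMr ?addr_gt0// mul1r; lra.
have ab : xp - y = (xp - x) + (x - y) by rewrite addrA subrK.
(* Equality case of the triangle inequality through [x]: the squared lengths force the dot product
   of [xp - x] and [x - y] to be [tau * d x]. *)
have E : d x *: (xp - x) = tau *: (x - y).
  apply/eqP; rewrite -subr_eq0 -dot_eq0; apply/eqP.
  have : dot (xp - y) (xp - y) = (d x + tau) ^+ 2 by rewrite -enorm_sqr xpy1.
  have : dot (xp - x) (xp - x) = tau ^+ 2 by rewrite -enorm_sqr xpx1.
  have : dot (x - y) (x - y) = (d x) ^+ 2 by rewrite -enorm_sqr xy.2.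
  rewrite ab; move: (xp - x) (x - y) => a b bb aa ab2.
  rewrite dotDl !dotDr aa bb (dotC b a) in ab2.
  rewrite dotBl !dotBr !dotZl !dotZr aa bb (dotC b a).
  have -> : dot a b = d x * tau by move: ab2; rewrite sqrrD; lra.
  by ring.
rewrite ab [d x / _]mulrC -scalerA scalerDr E -scalerDl [tau + _]addrC scalerA.
by rewrite mulVf ?gt_eqF ?addr_gt0// scale1r addrC subrK.
Qed.

End good_points.

(** * Curvature comparison and the lower bound on the constant *)

Section mean_curvature_bound.
Context {R : realType} (n : nat) (Omega : set 'rV[R]_n.+1).
Local Notation d := (dist_compl Omega).
Local Notation near_pt := (near_pt Omega).

(** [xget] returns the default 0 when no vector qualifies; [shape_matrix_ex] excludes that case. *)
Lemma principal_curvaturesP (C2 : C2_boundary Omega) y : boundary Omega y ->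
  are_principal_curvatures Omega y (principal_curvatures Omega y).
Proof.
move=> By; have [Q [phi lg]] := C2 y By.
have [_ _ [U [oU Uz CkU]] _] := lg.
have [r r0 rP] := C2_at_enorm oU Uz CkU.
have C2z : C2_at phi (rV_tail (y *m Q)) by apply: rP; rewrite subrr enorm0.
have [W [k [SW kP]]] := shape_matrix_ex Q C2z.
rewrite /principal_curvatures; case: xgetP => [k' -> //|/(_ k)]; case.
by exists Q, phi, W.
Qed.

Lemma mean_curvature_trace (n0 : (0 < n)%N) (C2 : C2_boundary Omega) y : boundary Omega y ->
  exists Q phi W, [/\ local_graph Omega y Q phi,
    is_shape_matrix Q phi (rV_tail (y *m Q)) W & \tr W = mean_curvature Omega y].
Proof.
move=> By; have [Q [phi [W [lg SW kP]]]] := principal_curvaturesP C2 By.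
by exists Q, phi, W; split=> //; rewrite -(char_poly_tr n0 kP).
Qed.

(** [row i Q] is the axis [e_i] in rotated coordinates; the inequalities for the separate axes thus
    add up to traces. *)
Lemma sum_dot_rows m k l (Q : 'M[R]_(m, k)) (X Y : 'M[R]_(k, l)) : Q^T *m Q = 1%:M ->
  \sum_i dot (row i Q *m X) (row i Q *m Y) = \tr (X *m Y^T).
Proof.
move=> QQ; have -> : \tr (X *m Y^T) = \tr (Q *m X *m (Q *m Y)^T).
  by rewrite trmx_mul mulmxA [RHS]mxtrace_mulC !mulmxA QQ mul1mx.
rewrite /mxtrace; apply: eq_bigr => i _; rewrite -!row_mul [RHS]mxE.
by apply: eq_bigr => j _; rewrite ![row _ _ _ _]mxE [X in _ = _ * X]mxE.
Qed.

Lemma dist_taylor (oO : open Omega) (cO : ~` Omega !=set0) (C2 : C2_boundary Omega) x y v :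
  inner_point Omega x y ->
  taylor2 (fun h => d (x + h *: v)) (d x) ('D_v d x) ('D_v (fun w => 'D_v d w) x / 2).
Proof.
move=> /(inner_point_regular oO cO C2)[[Ox xy [r r0 rP]] /(_ v)[l D2]].
have v1 : 0 < enorm v + 1 by rewrite ltr_wpDl.
have rv : 0 < r / (enorm v + 1) by rewrite divr_gt0.
have := @taylor2_derive R (fun h => d (x + h *: v)) (fun h => 'D_v d (x + h *: v))
  (r / (enorm v + 1)) l rv.
rewrite scale0r addr0 (@derive_val _ _ _ _ _ _ _ D2); apply.
  move=> s sr; apply: (is_derive_line _ _ _ _ _).1; apply: derivableP.
  have : enorm (x + s *: v - x) < r.
    rewrite addrAC subrr add0r enormZ; move: sr; rewrite ltr_pdivlMr// mulrDr mulr1.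
    by apply: le_lt_trans; rewrite lerDl.
  move=> /rP[Ow uw]; have [z wz] := near_pt_ex oO cO (x + s *: v).
  by have [] := dist_is_derive oO cO v Ow wz (fun z' H => uw _ _ wz H).
have D20 : is_derive (x + (0 : R) *: v) v (fun w => 'D_v d w) l by rewrite scale0r addr0.
exact: (is_derive_line _ _ _ _ _).1 D20.
Qed.

(** Fixes the sign: [x - y] is [A] times the upward normal direction [(1, - grad phi)]. For negative
    [A] the segment from [y] to [x] would start below the graph, although it starts inside
    [Omega]. *)
Lemma foot_height_gt0 (oO : open Omega) (cO : ~` Omega !=set0) x y Q phi : Omega x ->
  near_pt x y -> (forall y', near_pt x y' -> y' = y) -> local_graph Omega y Q phi ->
  let z0 := rV_tail (y *m Q) in let A := rV_head (x *m Q) - phi z0 in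
  [/\ 0 < A, rV_tail (x *m Q) - z0 = - A *: grad phi z0 & A = d x * slope phi z0].
Proof.
move=> Ox xy yuniq lg z0 A.
have [QQ _ _ /nbhs_enormP[r1 r10 r1P]] := lg.
have [C2 yE foot] := foot_critical oO cO Ox xy yuniq lg.
rewrite -/z0 in C2 yE foot.
have betaE : rV_tail (x *m Q) - z0 = - A *: grad phi z0.
  have [r2 r20 r2P] := foot 1 ltr01.
  have xx : enorm (x - x) < r2 by rewrite subrr enorm0.
  have [_ _ _ <-] := r2P x y xx xy; rewrite -/z0 /critical addrAC subrr add0r /A.
  by rewrite opprB.
have dx := dist_gt0 oO cO Ox.
have d2 : d x ^+ 2 = A ^+ 2 * (1 + dot (grad phi z0) (grad phi z0)).
  rewrite -xy.2 enorm_sqr yE dist2_graph// betaE -/A dotZl dotZr; ring.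
have Ane : A != 0.
  by apply/eqP => A0; move/eqP: d2; rewrite A0 expr0n/= mul0r sqrf_eq0 gt_eqF.
have A0 : 0 <= A.
  set G := 1 + _ in d2; have G0 : 0 < G by rewrite ltr_wpDr// dot_ge0.
  rewrite leNgt; apply/negP => Alt.
  (* Along the segment, height minus [phi] changes at the rate [A (1 + |grad phi|^2) = A G]; half of
     it is allowed as linearisation error. *)
  have AG : 0 < - (A * G) / 2 by rewrite divr_gt0// oppr_gt0 nmulr_rlt0.
  have := C1_is_derive (rV_tail (x *m Q) - z0) (nbhs_singleton C2.1).
  move=> /is_deriveP /(_ _ AG)[r2 r20 r2P].
  pose h := Num.min (Num.min 1 r2) (r1 / d x) / 2.
  have hp : 0 < Num.min (Num.min 1 r2) (r1 / d x) by rewrite !lt_min ltr01 r20 divr_gt0.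
  have h0 : 0 < h by rewrite divr_gt0.
  have : h < Num.min (Num.min 1 r2) (r1 / d x) by move: hp; rewrite /h; lra.
  rewrite !lt_min ltr_pdivlMr// => /andP[/andP[h1 hr2] hr1].
  have hn : `|h| = h by rewrite gtr0_norm.
  have Oyh : Omega (y + h *: (x - y)).
    apply: (@lt_dist _ _ Omega x).
    have -> : x - (y + h *: (x - y)) = (1 - h) *: (x - y).
      by apply/rowP => i; rewrite !mxE; ring.
    by rewrite enormZ xy.2 ger0_norm ?subr_ge0 ?ltW// gtr_pMl// gtrBl.
  have /r1P[/(_ Oyh) + _] : enorm (y + h *: (x - y) - y) < r1.
    by rewrite addrAC subrr add0r enormZ hn xy.2.
  have yhQ : rV_tail ((y + h *: (x - y)) *m Q) = z0 + h *: (rV_tail (x *m Q) - z0).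
    by rewrite mulmxDl -scalemxAl mulmxBl -(scaleN1r (y *m Q)) !(rV_tailD, rV_tailZ) scaleN1r.
  have yhH : rV_head ((y + h *: (x - y)) *m Q) = phi z0 + h * A.
    rewrite mulmxDl -scalemxAl mulmxBl -(scaleN1r (y *m Q)) !(rV_headD, rV_headZ) mulN1r /A.
    by rewrite {1 2}yE graph_pointK// rV_headK.
  rewrite yhQ yhH; have := r2P h; rewrite hn => /(_ hr2).
  rewrite betaE dotZl => H1 H2; move: H1; rewrite ler_norml => /andP[H1 _].
  have : 0 < h * (- (A * G) / 2) by rewrite mulr_gt0.
  by move: H1 H2; rewrite /G; lra.
have Ap : 0 < A by rewrite lt_def Ane.
split => //; apply/eqP; rewrite -(@eqrXn2 _ 2) ?ltW ?mulr_gt0 ?slope_gt0//.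
rewrite exprMn d2 -mulrA [_ * slope _ _ ^+ 2]mulrC slope_sqr mulr1 //.
Qed.

(** The boundary point competing for [x + h e_i] has parameter [z0 + h zeta], where [zeta]
    represents [al] times the tangential projection of [e_i]. Second order terms of the squared
    distances are compared and summed over [i]: each of the [n] tangent directions gives
    [(1 - al)^2], and curvature enters through the trace of the shape matrix. *)
Lemma curvature_comparison (n0 : (0 < n)%N) (oO : open Omega) (cO : ~` Omega !=set0)
    (C2 : C2_boundary Omega) x y (al : R) : inner_point Omega x y ->
  d x * laplacian d x <= n%:R * (1 - al) ^+ 2 - al ^+ 2 * d x * mean_curvature Omega y.
Proof.
move=> ip; have [[Ox xy [r0 r00 r0P]] _] := inner_point_regular oO cO C2 ip.
have yuniq y' : near_pt x y' -> y' = y.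
  by have [] := r0P x; rewrite ?subrr ?enorm0// => _ H xy'; exact: H.
have By := near_pt_boundary oO cO Ox xy.
have [Q [phi [W [lg SW <-]]]] := mean_curvature_trace n0 C2 By.
have [QQ _ _ _] := lg.
have [C2z yE _] := foot_critical oO cO Ox xy yuniq lg.
have [A0 betaE AE] := foot_height_gt0 oO cO Ox xy yuniq lg.
have [r2 r20 r2P] := graph_outside lg yE.
set z0 := rV_tail (y *m Q) in C2z yE A0 betaE AE r2P *.
set A := rV_head (x *m Q) - phi z0 in A0 betaE AE.
pose g := grad phi z0; pose B := hess phi z0.
have WG := shape_matrix_form QQ C2z SW; rewrite -/z0 -/B in WG.
set G := first_form phi z0 in WG.
have dx := dist_gt0 oO cO Ox.
have GG := first_form_unit phi z0; rewrite -/G in GG.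
set Gi := (X in G *m X = _) in GG.
have GT : G^T = G.
  by rewrite /G /first_form linearD/= trmx1 trmx_mul trmxK.
have GiT : Gi^T *m G = 1%:M by rewrite -[X in _ *m X]GT -trmx_mul GG trmx1.
(* The rows of [J] are the tangent vectors in rotated coordinates, and [J^T *m Gi *m J] is the
   orthogonal projection onto the tangent space; [L] below sends a vector to the parameters of [al]
   times its projection. *)
pose J : 'M[R]_(n, n.+1) := row_mx g^T 1%:M.
have JJ : J *m J^T = G.
  transitivity ((row_mx g^T 1%:M : 'M[R]_(n, 1 + n)) *m (row_mx g^T 1%:M : 'M[R]_(n, 1 + n))^T).
    by [].
  by rewrite tr_row_mx mul_row_col trmxK trmx1 mulmx1 addrC.
pose L : 'M[R]_(n.+1, n) := al *: (J^T *m Gi).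
have zJ (zeta : 'rV[R]_n) : zeta *m J = rV_cons (dot zeta g) zeta.
  by rewrite /J (mul_mx_row zeta g^T) mulmx1 /rV_cons [zeta *m _]mx11_scalar -dotE.
have comp i : d x * partial i (partial i d) x + partial i d x ^+ 2 <=
    dot (row i Q *m (1%:M - L *m J)) (row i Q *m (1%:M - L *m J))
    - A * dot (row i Q *m (L *m B)) (row i Q *m L).
  pose zeta := row i Q *m L.
  have T1 := @dist2_taylor _ _ Q phi x (delta_mx ord0 i) z0 zeta QQ C2z.
  have Td := dist_taylor oO cO C2 (v := delta_mx ord0 i) ip.
  have T2 := taylor2M Td Td.
  pose f1 h := dot (x + h *: delta_mx ord0 i - graph_point Q phi (z0 + h *: zeta))
                   (x + h *: delta_mx ord0 i - graph_point Q phi (z0 + h *: zeta)).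
  have c0 : (rV_head (x *m Q) - phi z0) ^+ 2 + dot (rV_tail (x *m Q) - z0) (rV_tail (x *m Q) - z0)
     = d x * d x by rewrite -dist2_graph// -yE -enorm_sqr xy.2 expr2.
  have le21 : \forall h \near (0 : R), d (x + h *: delta_mx ord0 i) * d (x + h *: delta_mx ord0 i) <= f1 h.
    apply/nbhs_ballP; exists (r2 / (enorm zeta + 1)).
      by rewrite /= divr_gt0// ltr_wpDl.
    move=> h; rewrite /ball/= sub0r normrN ltr_pdivlMr ?ltr_wpDl// mulrDr mulr1 => hr.
    rewrite /f1 -enorm_sqr -expr2 ler_pXn2r ?nnegrE ?(dist_ge0 cO)//.
    apply: dist_le => //; apply: r2P; rewrite addrAC subrr add0r enormZ.
    by apply: le_lt_trans hr; rewrite lerDl.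
  have T1' := taylor2_eq T1 c0 erefl erefl.
  have := taylor2_le T2 T1' le21; rewrite -rowE -/z0 -/A -/g -/B.
  have -> : row i Q *m (1%:M - L *m J) =
      rV_cons (rV_head (row i Q) - dot zeta g) (rV_tail (row i Q) - zeta).
    rewrite mulmxBr mulmx1 mulmxA zJ -{1}(rV_eta (row i Q)) -scaleN1r rV_consZ rV_consD.
    by rewrite mulN1r scaleN1r.
  rewrite dot_rV_cons -expr2 mulmxA -/zeta /partial => H; apply: le_trans H.
  by rewrite le_eqVlt; apply/orP; left; apply/eqP; field.
(* The eikonal equation; it cancels the contribution 1 of the normal direction to the trace
   below. *)
have Hlap : \sum_i partial i d x ^+ 2 = 1.
  have E i : partial i d x = (x - y) ord0 i / d x.
    have D := dist_is_derive oO cO (delta_mx ord0 i) Ox xy yuniq.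
    by rewrite /partial (@derive_val _ _ _ _ _ _ _ D) dotC dot_delta.
  under eq_bigr do rewrite E expr_div_n.
  rewrite -mulr_suml; have -> : \sum_i (x - y) ord0 i ^+ 2 = d x ^+ 2.
    by rewrite -xy.2 enorm_sqr; apply: eq_bigr => i _; rewrite expr2.
  by rewrite divff// expf_neq0// gt_eqF.
have QtQ : Q^T *m Q = 1%:M by exact: mulmx1C.
have := @ler_sum R _ (index_enum 'I_n.+1) xpredT _ _ (fun i _ => comp i).
rewrite big_split/= -mulr_sumr Hlap sumrB -mulr_sumr !sum_dot_rows//.
have tJ : \tr (L *m J) = al * n%:R.
  rewrite /L -scalemxAl mxtraceZ; congr (_ * _).
  rewrite -mulmxA mxtrace_mulC -mulmxA JJ mxtrace_mulC GG mxtrace1 //.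
have -> : \tr ((1%:M - L *m J) *m (1%:M - L *m J)^T) = 1 + n%:R * (1 - al) ^+ 2.
  rewrite linearB/= trmx1 mulmxBl mul1mx mulmxBr mulmx1 !linearB/= mxtrace1 mxtrace_tr tJ.
  have -> : \tr (L *m J *m (L *m J)^T) = al ^+ 2 * n%:R.
    rewrite trmx_mul mulmxA -(mulmxA L) JJ /L linearZ/= -!scalemxAl -scalemxAr scalerA.
    rewrite mxtraceZ -expr2; congr (_ * _).
    rewrite trmx_mul trmxK -(mulmxA J^T) (mulmx1C GG) mulmx1 mxtrace_mulC -mulmxA JJ.
    by rewrite GiT mxtrace1.
  rewrite -natr1; ring.
(* The relation [W *m G = slope *: B] turns the Hessian into the shape matrix; the factor
   [1 / slope] cancels against [A = d x * slope]. *)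
have -> : \tr (L *m B *m L^T) = al ^+ 2 * (\tr W / slope phi z0).
  have BE : B = (slope phi z0)^-1 *: (W *m G).
    by rewrite WG scalerA mulVf ?scale1r// gt_eqF// slope_gt0.
  rewrite /L linearZ/= -!scalemxAl -scalemxAr scalerA mxtraceZ -expr2; congr (_ * _).
  rewrite trmx_mul trmxK mulmxA mxtrace_mulC !mulmxA JJ GG mul1mx BE.
  by rewrite -scalemxAl mxtraceZ -mulmxA (mulmx1C GiT) mulmx1 mulrC.
rewrite AE; have := slope_gt0 phi z0; move: (slope phi z0) => w w0.
have -> : d x * w * (al ^+ 2 * (\tr W / w)) = al ^+ 2 * d x * \tr W by field; rewrite gt_eqF.
rewrite /laplacian; lra.
Qed.

End mean_curvature_bound.

(** * From the curvature comparison to the lower bound on the constant *)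

Section lambda_bound.
Context {R : realType}.

(* Weighted arithmetic-geometric mean inequality, through 1 + y <= e^y. *)
Lemma powR_mul_onem_le (p s : R) : 1 < p -> 0 <= s -> s <= 1 ->
  s `^ (p - 1) * (p * (1 - s)) <= ((p - 1) / p) `^ (p - 1).
Proof.
move=> p1 s0 s1; have p0 : 0 < p by lra.
set c := (p - 1) / p; have c0 : 0 < c by rewrite divr_gt0 ?subr_gt0.
have -> : s = (s / c) * c by rewrite divfK// gt_eqF.
set u := s / c; have u0 : 0 <= u by rewrite divr_ge0// ltW.
rewrite powRM ?(ltW c0)// mulrAC ger_pMl ?powR_gt0//.
have H1 : u `^ (p - 1) <= expR ((u - 1) * (p - 1)).
  rewrite expRM ge0_ler_powR ?nnegrE ?expR_ge0 ?subr_ge0 ?(ltW p1)//.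
  by have := expR_ge1Dx (u - 1); rewrite addrC subrK.
have H2 : p * (1 - u * c) <= expR (p * (1 - u * c) - 1).
  by have := expR_ge1Dx (p * (1 - u * c) - 1); rewrite addrC subrK.
have uc : u * c = s by rewrite /u divfK// gt_eqF.
apply: (@le_trans _ _ (expR ((u - 1) * (p - 1)) * expR (p * (1 - u * c) - 1))).
  by rewrite ler_pM ?powR_ge0// mulr_ge0 ?(ltW p0)// uc subr_ge0.
rewrite -expRD uc; suff -> : (u - 1) * (p - 1) + (p * (1 - s) - 1) = 0 by rewrite expR0.
have : u * (p - 1) = p * s by rewrite -uc /c; field; rewrite gt_eqF.
lra.
Qed.

(** [s = t h / n] is the scale-free variable. The family of inequalities forces [s < 1] and
    [L >= h / (1 - s)]; eliminating the power of [t] through [h = n s / t] leaves a function of [s]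
    bounded by [powR_mul_onem_le]. *)
Lemma curvature_scalar (p t L h h0 : R) (n : nat) : (0 < n)%N -> 1 < p -> 0 < t ->
  0 <= h0 -> h0 <= h ->
  (forall al, - (t * L) <= n%:R * (1 - al) ^+ 2 - al ^+ 2 * t * h) ->
  p / n%:R `^ (p - 1) * h0 `^ p <= ((p - 1) / p) `^ (p - 1) * (L / t `^ (p - 1)).
Proof.
move=> n0 p1 t0 h00 hh0 H; have p0 : 0 < p by lra.
have nr0 : 0 < n%:R :> R by rewrite ltr0n.
have hge0 : 0 <= h by exact: le_trans hh0.
have [s sE] : exists s : R, s = t * h / n%:R by exists (t * h / n%:R).
have s0 : 0 <= s by rewrite sE divr_ge0 ?mulr_ge0 ?(ltW t0) ?(ltW nr0).
have hE : h = n%:R * s / t by rewrite sE; field; rewrite !gt_eqF.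
have s1 : s < 1.
  rewrite ltNge; apply/negP => s1.
  (* For [s >= 1] the right side is at most [n (1 - 2 al)]; this [al] makes the left side equal to
     [n (3 - 2 al)], which is larger. *)
  have := H ((t * L / n%:R + 1) / 2 + 1).
  set al := _ + 1.
  have E : t * L = n%:R * (2 * al - 3) by rewrite /al; field; rewrite gt_eqF.
  have E2 : al ^+ 2 * t * h = n%:R * (al ^+ 2 * s) by rewrite hE; field; rewrite gt_eqF.
  rewrite E E2 -mulrBr -mulrN ler_pM2l// => H1.
  have : al ^+ 2 <= al ^+ 2 * s by rewrite ler_peMr ?sqr_ge0.
  have sq : (1 - al) ^+ 2 = al ^+ 2 - 2 * al + 1 by ring.
  by move: H1; rewrite sq; lra.
have s1' : 0 < 1 - s by rewrite subr_gt0.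
have LE : h / (1 - s) <= L.
  (* The minimiser of [(1 - al)^2 - al^2 s], with minimum [- s / (1 - s)]. *)
  rewrite -(ler_pM2l t0) -lerN2; apply: le_trans (H (1 - s)^-1) _.
  rewrite le_eqVlt; apply/orP; left; apply/eqP; rewrite hE; field.
  by rewrite !gt_eqF.
have tp : 0 < t `^ (p - 1) by rewrite powR_gt0.
have np : 0 < n%:R `^ (p - 1) :> R by rewrite powR_gt0.
apply: (@le_trans _ _ (p / n%:R `^ (p - 1) * h `^ p)).
  rewrite ler_wpM2l ?divr_ge0 ?powR_ge0 ?(ltW p0)//.
  by rewrite ge0_ler_powR ?nnegrE ?(ltW p0).
have -> : h `^ p = h * (n%:R `^ (p - 1) * s `^ (p - 1) / t `^ (p - 1)).
  have -> : n%:R `^ (p - 1) * s `^ (p - 1) / t `^ (p - 1) = h `^ (p - 1).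
    rewrite hE -[(_ * s) / t]/(_ * t^-1) powRM ?mulr_ge0 ?invr_ge0 ?(ltW t0) ?(ltW nr0)//.
    rewrite powRM ?(ltW nr0)//; congr (_ * _).
    by rewrite -[in RHS](powR_inv1 (ltW t0)) -powRrM mulN1r powRN.
  have [->|hn0] := eqVneq h 0; first by rewrite powR0 ?gt_eqF// mul0r.
  rewrite -{2}(powRr1 hge0) -powRD; last by rewrite hn0 implybT.
  by rewrite addrC subrK.
have -> : p / n%:R `^ (p - 1) * (h * (n%:R `^ (p - 1) * s `^ (p - 1) / t `^ (p - 1))) =
   (s `^ (p - 1) * (p * (1 - s))) * (h / (1 - s) / t `^ (p - 1)).
  by field; rewrite !gt_eqF.
apply: (@le_trans _ _ (((p - 1) / p) `^ (p - 1) * (h / (1 - s) / t `^ (p - 1)))).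
  rewrite ler_wpM2r ?powR_mul_onem_le ?(ltW s1)//.
  by rewrite !divr_ge0 ?(ltW s1') ?(ltW tp).
by rewrite ler_wpM2l ?powR_ge0// ler_wpM2r ?invr_ge0 ?(ltW tp).
Qed.

Lemma inf_mean_curvature_fin n (Omega : set 'rV[R]_n.+1) : boundary Omega !=set0 ->
  weakly_mean_convex Omega -> exists2 h0 : R, inf_mean_curvature Omega = h0%:E &
    0 <= h0 /\ forall y, boundary Omega y -> h0 <= mean_curvature Omega y.
Proof.
move=> [y0 By0] mc.
have ge0 : (0 <= inf_mean_curvature Omega)%E.
  by apply: le_ereal_inf_tmp => _ [y By <-]; rewrite lee_fin mc.
have le y : boundary Omega y -> (inf_mean_curvature Omega <= (mean_curvature Omega y)%:E)%E.
  by move=> By; apply: ereal_inf_lbound; exists y.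
case E : (inf_mean_curvature Omega) ge0 le => [h0| |] // ge0 le.
  by exists h0 => //; split=> // y /le.
by have := le _ By0; rewrite leNgt ltry.
Qed.

Lemma good_setE m (Omega : set 'rV[R]_m) : good_set Omega = Omega `\` singular_set Omega.
Proof.
apply/seteqP; split=> [x Gx|x [Ox nS]]; last first.
  by apply: contrapT => nG; apply: nS.
by split; [case: Gx => U [_ UO _] Ux; exact: UO|case].
Qed.

Lemma lambda_lower_bound n (n0 : (0 < n)%N) (Omega : set 'rV[R]_n.+1) (p : R) :
  open Omega -> boundary Omega !=set0 -> C2_boundary Omega -> weakly_mean_convex Omega ->
  1 < p ->
  ((p / n%:R `^ (p - 1))%:E * inf_mean_curvature Omega `^ p <= hardy_lambda p Omega)%E.
Proof.
move=> oO B0 C2 mc p1; have p0 : 0 < p by lra.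
have [h0 -> [h00 h0le]] := inf_mean_curvature_fin B0 mc.
have cO := domain_complement oO B0.
set c := ((p - 1) / p) `^ (p - 1).
have c0 : 0 < c by rewrite powR_gt0// divr_gt0// subr_gt0.
rewrite poweR_EFin -EFinM /hardy_lambda -good_setE -/c.
have -> : p / n%:R `^ (p - 1) * h0 `^ p = c * (c^-1 * (p / n%:R `^ (p - 1) * h0 `^ p)).
  by rewrite mulrA mulfV ?mul1r// gt_eqF.
rewrite EFinM; apply: lee_wpmul2l; first by rewrite lee_fin ltW.
apply: le_ereal_inf_tmp => _ [x Gx <-]; rewrite lee_fin ler_pdivrMl//.
(* Every good point is inner, so the comparison covers all points of the infimum. *)
have [y ip] := good_inner_point oO cO Gx.
have [[Ox xy _] _] := inner_point_regular oO cO C2 ip.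
have By := near_pt_boundary oO cO Ox xy.
apply: (curvature_scalar n0 p1 (dist_gt0 oO cO Ox) h00 (h0le y By)) => al.
by rewrite mulrN opprK; exact: curvature_comparison.
Qed.

End lambda_bound.

(** * Lebesgue measure on row vectors *)

Section borel.
Context {R : realType}.

Definition box m (q : 'rV[R]_m) (e : R) : set 'rV[R]_m :=
  [set x | forall i, `|x ord0 i - q ord0 i| < e].

Lemma measurable_box m (q : 'rV[R]_m) (e : R) : measurable (box q e).
Proof.
have -> : box q e = \bigcap_(i in [set: 'I_m])
    ([set: 'rV[R]_m] `&` (fun v : 'rV[R]_m => v ord0 i) @^-1` `]q ord0 i - e, q ord0 i + e[%classic).
  apply/seteqP; split=> [x xq i _|x xq i].
    split=> //=; rewrite in_itv/=; have := xq i; rewrite ltr_norml => /andP[? ?].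
    by apply/andP; split; lra.
  have [_ /=] := xq i I; rewrite in_itv/= => /andP[? ?].
  by rewrite ltr_norml; apply/andP; split; lra.
apply: fin_bigcap_measurable => //= i _.
by apply: measurable_rV_coord => //; exact: measurable_itv.
Qed.

(** The sigma-algebra is generated by the coordinates; an open set is the union of the boxes with
    rational centre and radius [1 / (k + 1)] that it contains, a countable family. *)
Lemma measurable_open m (O : set 'rV[R]_m) : open O -> measurable O.
Proof.
move=> oO.
pose F (p : 'rV[rat]_m * nat) : set 'rV[R]_m :=
  [set x | box (map_mx ratr p.1) p.2.+1%:R^-1 x /\ box (map_mx ratr p.1) p.2.+1%:R^-1 `<=` O].
have -> : O = \bigcup_p F p.
  apply/seteqP; split=> [x Ox|x [p _ [px pO]]]; last exact: pO.
  have /nbhs_ballP[e /= e0 eP] : nbhs x O by exact: open_nbhs_nbhs.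
  have [k _ /(_ k (leqnn k)) ke0] := near_infty_natSinv_lt (PosNum (divr_gt0 e0 (ltr0Sn R 1))).
  have ke : k.+1%:R^-1 < e / 2 := ke0.
  have k0 : 0 < k.+1%:R^-1 :> R by rewrite invr_gt0.
  have qex i : exists q : rat, `|x ord0 i - ratr q| < k.+1%:R^-1.
    move: (k.+1%:R^-1) k0 => t t0.
    have : x ord0 i - t < x ord0 i + t by lra.
    move=> /rat_in_itvoo[q]; rewrite in_itv/= => /andP[? ?]; exists q.
    by rewrite ltr_norml; apply/andP; split; lra.
  pose q := \row_i sval (cid (qex i)).
  have qP i : `|x ord0 i - ratr (q ord0 i)| < k.+1%:R^-1.
    by rewrite mxE; exact: svalP (cid (qex i)).
  exists (q, k) => //; split=> /= [i|y yq]; first by rewrite mxE; exact: qP.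
  apply: eP; split => // i j; rewrite ord1 /ball/=.
  have := qP j; have := yq j; rewrite [map_mx _ _ _ _]mxE /=.
  move: (k.+1%:R^-1) ke => t te.
  rewrite !ltr_norml => /andP[? ?] /andP[? ?]; apply/andP; split; lra.
apply: countable_bigcupT_measurable; first exact: countableP.
move=> p; have [pO|npO] := pselect (box (map_mx ratr p.1 : 'rV[R]_m) p.2.+1%:R^-1 `<=` O).
  have -> : F p = box (map_mx ratr p.1) p.2.+1%:R^-1.
    by apply/seteqP; split=> [x []|x].
  exact: measurable_box.
have -> : F p = set0 by apply/seteqP; split=> [x []|x].
exact: measurable0.
Qed.

Lemma continuous_measurable_rV m (f : 'rV[R]_m -> R) : continuous f ->
  measurable_fun setT f.
Proof.
move=> /continuousP cf; apply: (measurability _ (RGenOpens.measurableE R)).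
move=> _ [_ [a [b ->] <-]]; rewrite setTI; apply: measurable_open; apply: cf.
exact: interval_open.
Qed.

Definition cube m (r : R) : set 'rV[R]_m := [set x | forall i, `|x ord0 i| <= r].

Lemma measurable_cube m r : measurable (@cube m r).
Proof.
have -> : cube r = \bigcap_(i in [set: 'I_m])
    ([set: 'rV[R]_m] `&` (fun v : 'rV[R]_m => v ord0 i) @^-1` `[- r, r]%classic).
  apply/seteqP; split=> [x xq i _|x xq i].
    by split=> //=; rewrite in_itv/=; have := xq i; rewrite ler_norml.
  by have [_ /=] := xq i I; rewrite in_itv/= ler_norml.
apply: fin_bigcap_measurable => //= i _.
by apply: measurable_rV_coord => //; exact: measurable_itv.
Qed.

Lemma lebesgue_rVS m : lebesgue_rV m.+1 = lebesgue_rV_step (lebesgue_rV m)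
  :> (set 'rV[R]_m.+1 -> \bar R).
Proof. by []. Qed.

Lemma lebesgue_cube_fin m (r : R) : (lebesgue_rV m (cube r) < +oo)%E.
Proof.
elim: m => [|m IH]; first by rewrite /= diracE; exact: ltry.
rewrite lebesgue_rVS /lebesgue_rV_step /pushforward.
have -> : @rV_consp R m @^-1` cube r = `[- r, r]%classic `*` cube r.
  apply/seteqP; split=> [[t z] /= H|[t z] /= [+ H] i].
    split=> /=.
      by rewrite in_itv/= -ler_norml; have := H ord0; rewrite /rV_consp rV_cons0.
    by move=> i; have := H (lift ord0 i); rewrite /rV_consp rV_consS.
  rewrite in_itv/= -ler_norml => tr; rewrite /rV_consp.
  by case: (unliftP ord0 i) => [j|] ->; rewrite ?rV_consS ?rV_cons0.
rewrite product_measure1E//; last exact: measurable_cube.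
apply: lte_mul_pinfty => //.
have F : lebesgue_measure (`[- r, r]%classic : set R) \is a fin_num.
  by rewrite lebesgue_measure_itv/=; case: ifP => _ //; rewrite -EFinB.
exact: F.
Qed.

Definition shiftR (c : R) (t : measurableTypeR R) : measurableTypeR R := t + c.

Lemma measurable_shiftR c : measurable_fun setT (shiftR c).
Proof.
have : measurable_fun setT (fun t : R => t + c).
  apply: continuous_measurable_fun => t.
  by apply: continuousD; [exact: cvg_id|exact: cst_continuous].
by [].
Qed.

HB.instance Definition _ c := isMeasurableFun.Build _ _ _ _ (shiftR c) (measurable_shiftR c).

Lemma lebesgue_measure_shift (c : R) (A : set (measurableTypeR R)) : measurable A ->
  lebesgue_measure (shiftR c @^-1` A) = lebesgue_measure A.
Proof.
move=> mA; have : lebesgue_measure A = pushforward (@lebesgue_measure R) (shiftR c) A.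
  apply: lebesgue_measure_unique => //= _ [[a b]] _ <-; rewrite /pushforward.
  have -> : shiftR c @^-1` `]a, b]%classic = `]a - c, b - c]%classic.
    by apply/seteqP; split=> t /=; rewrite /shiftR !in_itv/= ltrBlDr lerBrDr.
  have E (u v : R) : lebesgue_measure (`]u, v]%classic : set R) =
      (if (u < v)%R then (v%:E - u%:E)%E else 0%E).
    by rewrite lebesgue_measure_itv/= lte_fin.
  by rewrite !E ltrD2r -!EFinB opprB addrA subrK.
by [].
Qed.

Definition shift_rV m (c : 'rV[R]_m) (x : 'rV[R]_m) : 'rV[R]_m := x + c.

Lemma measurable_shift_rV m (c : 'rV[R]_m) : measurable_fun setT (shift_rV c).
Proof.
apply: measurable_fun_rV => i.
have -> : (fun x => shift_rV c x ord0 i) = shiftR (c ord0 i) \o (fun x : 'rV[R]_m => x ord0 i).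
  by apply/funext => x; rewrite /shift_rV mxE.
by apply: measurableT_comp; [exact: measurable_shiftR|exact: measurable_rV_coord].
Qed.

HB.instance Definition _ m (c : 'rV[R]_m) :=
  isMeasurableFun.Build _ _ _ _ (shift_rV c) (measurable_shift_rV c).

Lemma preimage_measurable d1 d2 (T1 : measurableType d1) (T2 : measurableType d2)
  (f : T1 -> T2) A : measurable_fun setT f -> measurable A -> measurable (f @^-1` A).
Proof. by move=> mf mA; rewrite -[X in measurable X]setTI; exact: mf. Qed.

(** Induction on the dimension: the translated product measure agrees with the product measure on
    rectangles, and these determine it. *)
Lemma lebesgue_rV_shift m (c : 'rV[R]_m) (A : set 'rV[R]_m) : measurable A ->
  lebesgue_rV m (shift_rV c @^-1` A) = lebesgue_rV m A.
Proof.
elim: m c A => [|m IH] c A mA.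
  congr (lebesgue_rV 0 _); apply/seteqP; split => x /=;
    by rewrite /shift_rV (_ : x + c = x)//; apply/rowP => -[].
rewrite lebesgue_rVS /lebesgue_rV_step /pushforward.
pose sh (p : measurableTypeR R * 'rV[R]_m) :=
  (shiftR (rV_head c) p.1, shift_rV (rV_tail c) p.2).
have msh : measurable_fun setT sh.
  have m1 : measurable_fun setT
      (shiftR (rV_head c) \o (@fst (measurableTypeR R) 'rV[R]_m)).
    exact: (measurableT_comp (measurable_shiftR _) measurable_fst).
  have m2 : measurable_fun setT
      (shift_rV (rV_tail c) \o (@snd (measurableTypeR R) 'rV[R]_m)).
    exact: (measurableT_comp (measurable_shift_rV _) measurable_snd).
  exact: (measurable_fun_pair m1 m2).
pose shm : {mfun (measurableTypeR R * 'rV[R]_m)%type >-> (measurableTypeR R * 'rV[R]_m)%type} :=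
  HB.pack sh (isMeasurableFun.Build _ _ _ _ sh msh).
have -> : @rV_consp R m @^-1` (shift_rV c @^-1` A) = sh @^-1` (@rV_consp R m @^-1` A).
  have E p : shift_rV c (rV_consp p) = rV_consp (sh p).
    by rewrite /shift_rV -{1}(rV_eta c) /rV_consp rV_consD.
  by apply/seteqP; split=> p /=; rewrite E.
have mA' : measurable (@rV_consp R m @^-1` A).
  by apply: preimage_measurable => //; exact: measurable_rV_consp.
apply/esym.
have := @product_measure_unique _ _ _ _ R (@lebesgue_measure R) (lebesgue_rV m)
  (pushforward (@lebesgue_measure R \x lebesgue_rV m)%E shm).
apply => // X Y mX mY; rewrite /pushforward.
have EQ : shm @^-1` (X `*` Y) =
    (shiftR (rV_head c) @^-1` X) `*` (shift_rV (rV_tail c) @^-1` Y).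
  by apply/seteqP; split.
transitivity ((@lebesgue_measure R \x lebesgue_rV m)%E
    ((shiftR (rV_head c) @^-1` X) `*` (shift_rV (rV_tail c) @^-1` Y))).
  exact: (congr1 (@lebesgue_measure R \x lebesgue_rV m)%E EQ).
rewrite product_measure1E.
- by congr (_ * _)%E; [exact: lebesgue_measure_shift|exact: IH].
- by apply: preimage_measurable => //; exact: measurable_shiftR.
- by apply: preimage_measurable => //; exact: measurable_shift_rV.
Qed.

Lemma lebesgue_rV_pushforward m (c : 'rV[R]_m) (A : set 'rV[R]_m) : measurable A -> A `<=` setT ->
  pushforward (lebesgue_rV m) (shift_rV c) A = lebesgue_rV m A.
Proof. by move=> mA _; exact: lebesgue_rV_shift. Qed.

Lemma integrable_shift m (c : 'rV[R]_m) (f : 'rV[R]_m -> \bar R) :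
  (lebesgue_rV m).-integrable setT f ->
  (lebesgue_rV m).-integrable setT (fun x => f (x + c)%R).
Proof.
move=> intf; have mf := measurable_int _ intf.
apply/integrableP; split; first exact: (measurableT_comp mf (measurable_shift_rV c)).
have /integrableP[_] := intf.
rewrite -(eq_measure_integral _ (@lebesgue_rV_pushforward _ c)).
rewrite (ge0_integral_pushforward (measurable_shift_rV c))//.
exact: measurableT_comp.
Qed.

Lemma integral_shift m (c : 'rV[R]_m) (f : 'rV[R]_m -> \bar R) :
  (lebesgue_rV m).-integrable setT f ->
  (\int[lebesgue_rV m]_x f (x + c)%R = \int[lebesgue_rV m]_x f x)%E.
Proof.
move=> intf; have mf := measurable_int _ intf.
rewrite -[RHS](eq_measure_integral _ (@lebesgue_rV_pushforward _ c)).
rewrite (integral_pushforward (measurable_shift_rV c))//.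
by rewrite preimage_setT; exact: integrable_shift.
Qed.

End borel.

(** * The Hardy defect *)

Section power_inequalities.
Context {R : realType}.

(** Young's inequality for [b] and [a^(p-1)] with exponents [p] and [p / (p - 1)]; rearranged, the
    graph of t^p lies above its tangent at [a]. *)
Lemma young_tangent (p a b : R) : 1 < p -> 0 <= a -> 0 <= b ->
  p * b * a `^ (p - 1) <= b `^ p + (p - 1) * a `^ p.
Proof.
move=> p1 a0 b0; have p0 : 0 < p by lra.
have q0 : 0 < p / (p - 1) by rewrite divr_gt0 ?subr_gt0.
have := @conjugate_powR R b (a `^ (p - 1)) p (p / (p - 1)) b0 (powR_ge0 _ _) p0 q0.
rewrite -powRrM mulrCA mulfV ?mulr1; last by rewrite subr_eq0 gt_eqF.
have -> : p^-1 + (p / (p - 1))^-1 = 1.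
  by field; rewrite subr_eq0 !gt_eqF.
move=> /(_ erefl); rewrite -(ler_pM2l p0) mulrA => /le_trans; apply.
rewrite le_eqVlt; apply/orP; left; apply/eqP; field.
by rewrite subr_eq0 !gt_eqF.
Qed.

Lemma powR_split (p a : R) : 0 <= a -> 1 < p -> a `^ p = a * a `^ (p - 1).
Proof.
move=> a0 p1; have [->|an0] := eqVneq a 0.
  by rewrite powR0 ?mul0r// gt_eqF// (lt_trans ltr01).
by rewrite -{2}(powRr1 a0) -powRD ?an0 ?implybT// addrC subrK.
Qed.

Lemma powR_lip (p M a b : R) : 1 < p -> 0 <= a -> 0 <= b -> a <= M -> b <= M ->
  `|a `^ p - b `^ p| <= p * M `^ (p - 1) * `|a - b|.
Proof.
move=> p1; have p0 : 0 < p by lra.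
have p10 : 0 <= p - 1 by rewrite subr_ge0 ltW.
have H (u v : R) : 0 <= v -> v <= u -> u <= M ->
    `|u `^ p - v `^ p| <= p * M `^ (p - 1) * `|u - v|.
  move=> v0 vu uM; have u0 := le_trans v0 vu.
  rewrite ger0_norm ?subr_ge0; last by rewrite ge0_ler_powR ?nnegrE ?(ltW p0).
  rewrite ger0_norm ?subr_ge0//.
  have Y := young_tangent p1 u0 v0; have S := powR_split u0 p1.
  apply: (@le_trans _ _ (p * u `^ (p - 1) * (u - v))).
    have -> : p * u `^ (p - 1) * (u - v) = p * (u * u `^ (p - 1)) - p * v * u `^ (p - 1) by ring.
    by rewrite -S; lra.
  rewrite ler_wpM2r ?subr_ge0// ler_wpM2l ?(ltW p0)//.
  by rewrite ge0_ler_powR ?nnegrE// (le_trans u0).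
move=> a0 b0 aM bM; have [ba|ab] := leP b a; first exact: H.
by rewrite distrC [`|a - b|]distrC; apply: H => //; exact: ltW.
Qed.

Lemma norm_is_derive (t : R) : t != 0 -> is_derive t 1 (@Num.norm R R) (Num.sg t).
Proof.
move=> t0; apply/is_deriveP => e e0; exists `|t|; first by rewrite normr_gt0.
move=> h ht; rewrite [_%:A]mulr1.
have -> : `|t + h| = Num.sg t * (t + h).
  rewrite normrEsg; congr (_ * _).
  have [tn|tp|tz] := ltgtP t 0; last by rewrite tz eqxx in t0.
    by move: ht; rewrite (ltr0_sg tn) (ltr0_norm tn) ltr_norml => /andP[? ?]; rewrite ltr0_sg//; lra.
  by move: ht; rewrite (gtr0_sg tp) (gtr0_norm tp) ltr_norml => /andP[? ?]; rewrite gtr0_sg//; lra.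
have -> : Num.sg t * (t + h) - `|t| - h * Num.sg t = 0 by rewrite normrEsg; ring.
by rewrite normr0 mulr_ge0// ltW.
Qed.

End power_inequalities.

Section pointwise.
Context {R : realType} (m : nat) (Omega : set 'rV[R]_m).
Local Notation d := (dist_compl Omega).
Local Notation near_pt := (near_pt Omega).

(** The foot [y] competes for [x + v], and the square root of d^2 + 2 <x - y, v> + |v|^2 is bounded
    by an affine plus a quadratic term: a semiconcavity estimate for [d]. *)
Lemma dist_upper (cO : ~` Omega !=set0) x y v : 0 < d x -> near_pt x y ->
  d (x + v) <= d x + dot (x - y) v / d x + dot v v / d x.
Proof.
move=> dx xy.
apply: le_trans (dist_le (x + v) xy.1) _.
have S : dot (x - y + v) (x - y + v) = d x ^+ 2 + 2 * dot (x - y) v + dot v v.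
  rewrite -xy.2 enorm_sqr; move: (x - y) => a.
  by rewrite dotDl !dotDr (dotC v a); ring.
have v2 := dot_ge0 v.
have Rp : 0 <= d x ^+ 2 + dot (x - y) v + dot v v.
  by have := dot_ge0 (x - y + v); rewrite S; have := sqr_ge0 (d x); lra.
have -> : d x + dot (x - y) v / d x + dot v v / d x =
    (d x ^+ 2 + dot (x - y) v + dot v v) / d x.
  by field; rewrite gt_eqF.
rewrite ler_pdivlMr// -(@ler_pXn2r _ 2) ?nnegrE ?mulr_ge0 ?(ltW dx)//.
rewrite exprMn enorm_sqr addrAC S -subr_ge0.
have -> : (d x ^+ 2 + dot (x - y) v + dot v v) ^+ 2 -
   (d x ^+ 2 + 2 * dot (x - y) v + dot v v) * d x ^+ 2 =
   (dot (x - y) v + dot v v) ^+ 2 + d x ^+ 2 * dot v v by ring.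
by rewrite addr_ge0 ?sqr_ge0// mulr_ge0 ?sqr_ge0.
Qed.

Lemma partial_outside_support (f : 'rV[R]_m -> R) x i :
  ~ closure [set y | f y != 0] x -> partial i f x = 0.
Proof.
set K := closure _ => nKx.
have fK y : f y != 0 -> K y by move=> fy; exact: subset_closure.
have : is_derive x (delta_mx ord0 i) f 0.
  have /nbhs_enormP[r r0 rP] : nbhs x (~` K).
    by apply: open_nbhs_nbhs; split => //; apply: closed_openC; exact: closed_closure.
  have f0 y : enorm (y - x) < r -> f y = 0.
    by move=> /rP nKy; apply/eqP/negPn/negP => /fK.
  apply/is_deriveP => e e0; exists r => // h hr.
  rewrite !f0 ?subrr ?enorm0// ?mulr0 ?subr0 ?normr0 ?mulr_ge0 ?(ltW e0)//.
  by rewrite addrAC subrr add0r enormZ enorm_delta mulr1.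
by move=> D; exact: derive_val.
Qed.

(** All constants come from compactness of the support. [M] serves twice, for [|f|] and for [d]
    where [f] is nonzero, so that one constant bounds [hardy_test]. *)
Lemma test_function_bounds (oO : open Omega) (cO : ~` Omega !=set0) f : test_function Omega f ->
  exists rho L M B : R, [/\ 0 < rho, 0 < L, 0 < M,
    (forall x, f x != 0 -> [/\ Omega x, rho <= d x, d x <= M & cube B x]) &
    (forall x, `|f x| <= M) /\
    (forall x i h, `|f (x + h *: delta_mx ord0 i) - f x| <= L * `|h|)].
Proof.
move=> [Cf cptK KO]; set K := closure _ in cptK KO.
have fK x : f x != 0 -> K x by move=> fx; exact: subset_closure.
have cf : continuous f by have [c _] := Cf 0%N => x; exact: c.
have C1f x : C1_at f x.
  have [_ df] := Cf 1%N; split; last by move=> i; have [_ [c _]] := df i; exact: c.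
  by apply: (@nearW _ (nbhs x)) => y i; have [dfi _] := df i; exact: dfi.
have bounded (u : 'rV[R]_m -> R) : continuous u -> exists2 C : R, 0 < C &
    forall x, K x -> `|u x| <= C.
  move=> cu; have [K0|K0] := pselect (K !=set0); last first.
    by exists 1 => // x Kx; exfalso; apply: K0; exists x.
  have cau : {within K, continuous (fun x => `|u x|)}.
    apply: continuous_subspaceT => x; apply: continuous_comp; first exact: cu.
    exact: norm_continuous.
  have [x0 _ x0max] := compact_EVT_max K0 cptK cau.
  exists (`|u x0| + 1); first by rewrite ltr_wpDl.
  by move=> x Kx; rewrite (@le_trans _ _ `|u x0|) ?lerDl// x0max// inE.
have [rho rho0 rhoP] : exists2 rho : R, 0 < rho & forall x, K x -> rho <= d x.
  have [K0|K0] := pselect (K !=set0); last first.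
    by exists 1 => // x Kx; exfalso; apply: K0; exists x.
  have cd : {within K, continuous d}.
    by apply: continuous_subspaceT; exact: dist_continuous.
  have [x0 Kx0 x0min] := compact_EVT_min K0 cptK cd.
  exists (d x0); first by apply: (dist_gt0 oO cO); apply: KO; move: Kx0; rewrite inE.
  by move=> x Kx; apply: x0min; rewrite inE.
have [Md Md0 MdP] := bounded d (dist_continuous cO).
have [Mf Mf0 MfP] := bounded f cf.
have partial0 x i : ~ K x -> partial i f x = 0 by exact: partial_outside_support.
have [L L0 LP] : exists2 L : R, 0 < L & forall x i, `|partial i f x| <= L.
  have [Li LiP] : exists Li : 'I_m -> R, forall i, 0 < Li i /\ forall x, `|partial i f x| <= Li i.
    have H i : exists C : R, 0 < C /\ forall x, `|partial i f x| <= C.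
      have cpi : continuous (partial i f) by move=> x; exact: (C1f x).2.
      have [C C0 CP] := bounded _ cpi; exists C; split => // x.
      have [Kx|nKx] := pselect (K x); first exact: CP.
      by rewrite partial0// normr0 ltW.
    by exists (fun i => sval (cid (H i))) => i; exact: svalP (cid (H i)).
  exists (1 + \sum_i Li i); first by rewrite ltr_wpDr// sumr_ge0// => i _; have [/ltW] := LiP i.
  move=> x i; have [_ H] := LiP i; rewrite (le_trans (H x))//.
  rewrite (bigD1 i)//= addrCA lerDl addr_ge0// sumr_ge0// => j _; have [/ltW //] := LiP j.
have [B BP] : exists B : R, forall x, K x -> cube B x.
  have cen : continuous (@enorm R m) by exact: enorm_continuous.
  have [B _ BP] := bounded _ cen; exists B => x Kx i.
  by rewrite (le_trans (coord_le_enorm x i))// (le_trans _ (BP x Kx))// ler_norm.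
exists rho, L, (Mf + Md), B; split => //; first by rewrite addr_gt0.
  move=> x /fK Kx; split; [exact: KO|exact: rhoP| |exact: BP].
  by rewrite (le_trans (ler_norm _))// (le_trans (MdP x Kx))// lerDr ltW.
split.
  move=> x; have [->|/fK Kx] := eqVneq (f x) 0.
    by rewrite normr0 addr_ge0// ltW.
  by rewrite (le_trans (MfP x Kx))// lerDl ltW.
move=> x i h.
have := @increment_bound R (fun t => f (x + t *: delta_mx ord0 i))
  (fun t => partial i f (x + t *: delta_mx ord0 i)) h 0 L.
rewrite scale0r addr0 mulr0 subr0; apply=> s _; last by rewrite subr0.
have D := C1_is_derive (delta_mx ord0 i) (C1f (x + s *: delta_mx ord0 i)).
rewrite dot_delta mxE in D.
exact: (is_derive_line _ _ _ _ _).1 D.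
Qed.

End pointwise.

(** * Uniform and pointwise bounds for the discrete defect *)

Section defect_bounds.
Context {R : realType}.

Lemma scaled_power_lip (p r D M s s' u u' : R) : 1 < p -> 0 < r -> 0 < M ->
  r <= s -> r <= s' -> s' <= D -> `|u| <= M -> `|u'| <= M ->
  `|s' * (`|u'| / s') `^ p - s * (`|u| / s) `^ p| <=
  (D * (p * (M / r) `^ (p - 1)) / r) * `|u' - u| +
  (D * (p * (M / r) `^ (p - 1)) * (M / r ^+ 2) + (M / r) `^ p) * `|s' - s|.
Proof.
move=> p1 r0 M0 rs rs' s'D uM u'M; have p0 : 0 < p by lra.
have s0 : 0 < s by exact: lt_le_trans rs.
have s'0 : 0 < s' by exact: lt_le_trans rs'.
have D0 : 0 < D by exact: lt_le_trans s'D.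
pose w := `|u| / s; pose w' := `|u'| / s'.
have w0 : 0 <= w by rewrite divr_ge0// ltW.
have w'0 : 0 <= w' by rewrite divr_ge0// ltW.
have wW : w <= M / r by rewrite ler_pM// ?invr_ge0 ?(ltW s0)// lef_pV2.
have w'W : w' <= M / r by rewrite ler_pM// ?invr_ge0 ?(ltW s'0)// lef_pV2.
have W0 : 0 <= p * (M / r) `^ (p - 1) by rewrite mulr_ge0 ?powR_ge0 ?ltW.
have ww : `|w' - w| <= `|u' - u| / r + M / r ^+ 2 * `|s' - s|.
  have -> : w' - w = (`|u'| - `|u|) / s' + `|u| * (s - s') / (s * s').
    by rewrite /w /w'; field; rewrite !gt_eqF.
  rewrite (le_trans (ler_normD _ _))// lerD//.
    rewrite normrM (gtr0_norm (_ : 0 < s'^-1)) ?invr_gt0//.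
    by rewrite ler_pM ?invr_ge0 ?(ltW s'0)// ?lef_pV2// ler_dist_dist.
  rewrite normrM (gtr0_norm (_ : 0 < (s * s')^-1)) ?invr_gt0 ?mulr_gt0//.
  rewrite normrM normr_id (distrC s) mulrAC.
  rewrite ler_wpM2r// ler_pM ?invr_ge0 ?mulr_ge0 ?(ltW s0) ?(ltW s'0)//.
  rewrite lef_pV2 ?posrE ?exprn_gt0 ?mulr_gt0// expr2 ler_pM ?(ltW r0)//.
have -> : s' * w' `^ p - s * w `^ p = s' * (w' `^ p - w `^ p) + (s' - s) * w `^ p by ring.
rewrite (le_trans (ler_normD _ _))//.
have H1 : `|s' * (w' `^ p - w `^ p)| <=
    D * (p * (M / r) `^ (p - 1)) * (`|u' - u| / r + M / r ^+ 2 * `|s' - s|).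
  rewrite normrM (gtr0_norm s'0) -mulrA ler_pM ?(ltW s'0)//.
  rewrite (le_trans (powR_lip p1 w'0 w0 w'W wW))// ler_wpM2l//.
have H2 : `|(s' - s) * w `^ p| <= (M / r) `^ p * `|s' - s|.
  rewrite normrM (ger0_norm (powR_ge0 _ _)) mulrC ler_wpM2r//.
  by rewrite ge0_ler_powR ?nnegrE ?(ltW p0)// divr_ge0 ?(ltW M0) ?(ltW r0).
apply: (le_trans (lerD H1 H2)).
rewrite le_eqVlt; apply/orP; left; apply/eqP; field.
by rewrite gt_eqF.
Qed.

Context (n : nat) (Omega : set 'rV[R]_n.+1).
Local Notation d := (dist_compl Omega).
Local Notation near_pt := (near_pt Omega).

(* d^(1-p) |f|^p, in a form that vanishes where d = 0. *)
Definition hardy_test (p : R) (f : 'rV[R]_n.+1 -> R) (x : 'rV[R]_n.+1) : R :=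
  d x * (`|f x| / d x) `^ p.

(* A discretisation of - D_i (hardy_test * D_i d). *)
Definition defect_term (p : R) f i (h : R) x : R :=
  (hardy_test p f x * (d x - d (x - h *: delta_mx ord0 i)) -
   hardy_test p f (x + h *: delta_mx ord0 i) * (d (x + h *: delta_mx ord0 i) - d x)) / h ^+ 2.

(** Discrete product rule: a weighted second difference of [d], whose sign is controlled from one
    side, minus a product of first differences. *)
Lemma defect_termE p f i h x : defect_term p f i h x =
  (hardy_test p f x *
    (2 * d x - d (x + h *: delta_mx ord0 i) - d (x - h *: delta_mx ord0 i)) -
  (hardy_test p f (x + h *: delta_mx ord0 i) - hardy_test p f x) *
    (d (x + h *: delta_mx ord0 i) - d x)) / h ^+ 2.
Proof.
rewrite /defect_term; congr (_ / _).
move: (hardy_test p f (x + _)) (hardy_test p f x) => a b.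
by move: (d (x + _)) (d (x - _)) (d x) => u v w; ring.
Qed.

Lemma hardy_test_ge0 (cO : ~` Omega !=set0) p f x : 0 <= hardy_test p f x.
Proof. by rewrite mulr_ge0 ?powR_ge0// dist_ge0. Qed.

Lemma hardy_test0 p f x : 1 < p -> f x = 0 -> hardy_test p f x = 0.
Proof.
move=> p1 fx; rewrite /hardy_test fx normr0 mul0r powR0 ?mulr0// gt_eqF//.
exact: lt_trans p1.
Qed.

Lemma dist_step (cO : ~` Omega !=set0) x i (h : R) :
  `|d (x + h *: delta_mx ord0 i) - d x| <= `|h|.
Proof.
rewrite (le_trans (dist_lip cO _ _))// addrAC subrr add0r enormZ enorm_delta mulr1 //.
Qed.

(** Each foot gives an upper bound for [d] on both sides of [x], with its own slope. Taking the
    better one on each side produces a kink of size the difference of the slopes; [y = y'] gives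
    plain semiconcavity. *)
Lemma second_difference_gap (cO : ~` Omega !=set0) x y y' i (h : R) :
  0 < d x -> near_pt x y -> near_pt x y' ->
  `|h| * `|(y' - y) ord0 i| / d x - 2 * h ^+ 2 / d x <=
  2 * d x - d (x + h *: delta_mx ord0 i) - d (x - h *: delta_mx ord0 i).
Proof.
move=> dx xy xy'.
have e2 : dot (h *: delta_mx ord0 i) (h *: (delta_mx ord0 i : 'rV[R]_n.+1)) = h ^+ 2.
  by rewrite dotZl dotZr -enorm_sqr enorm_delta expr1n mulr1 -expr2.
have U z : near_pt x z ->
    d (x + h *: delta_mx ord0 i) <= d x + h * (x - z) ord0 i / d x + h ^+ 2 / d x /\
    d (x - h *: delta_mx ord0 i) <= d x - h * (x - z) ord0 i / d x + h ^+ 2 / d x.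
  move=> xz; have := dist_upper cO (h *: delta_mx ord0 i) dx xz.
  have := dist_upper cO (- (h *: delta_mx ord0 i)) dx xz.
  by rewrite !dotNr dotNl opprK e2 dotZr (dotC (x - z)) dot_delta mulNr; split.
have [U1 U2] := U y xy; have [U1' U2'] := U y' xy'.
have -> : `|h| * `|(y' - y) ord0 i| / d x = `|h * (y' - y) ord0 i / d x|.
  by rewrite !normrM (gtr0_norm (_ : 0 < (d x)^-1)) ?invr_gt0.
have E : h * (y' - y) ord0 i / d x = h * (x - y) ord0 i / d x - h * (x - y') ord0 i / d x.
  by rewrite !mxE; ring.
rewrite E -(mulrA 2).
move: (h * (x - y) ord0 i / d x) (h * (x - y') ord0 i / d x) U1 U2 U1' U2' => a b.
move: (h ^+ 2 / d x) (d (x + _)) (d (x - _)) (d x) => q u v t H1 H2 H3 H4.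
by have [ab|ab] := leP b a; [rewrite ger0_norm ?subr_ge0|rewrite ltr0_norm ?subr_lt0]; lra.
Qed.

Lemma second_difference_ge (oO : open Omega) (cO : ~` Omega !=set0) x i (h : R) : 0 < d x ->
  - (2 * h ^+ 2 / d x) <=
  2 * d x - d (x + h *: delta_mx ord0 i) - d (x - h *: delta_mx ord0 i).
Proof.
move=> dx; have [y xy] := near_pt_ex oO cO x.
have := second_difference_gap cO i h dx xy xy.
by rewrite subrr mxE normr0 mulr0 mul0r sub0r.
Qed.

Section bounds.
Variables (p rho L M B : R) (f : 'rV[R]_n.+1 -> R).

Definition test_bounds : Prop := [/\ 0 < rho, 0 < L, 0 < M,
  (forall x, f x != 0 -> [/\ Omega x, rho <= d x, d x <= M & cube B x]) &
  (forall x, `|f x| <= M) /\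
  (forall x i h, `|f (x + h *: delta_mx ord0 i) - f x| <= L * `|h|)].

(** If [f] is nonzero at one of the two points, [d >= rho] there and so [d >= rho / 2] at both,
    where [scaled_power_lip] applies; otherwise both values vanish. *)
Lemma hardy_test_lip (cO : ~` Omega !=set0) : 1 < p -> test_bounds ->
  exists2 C : R, 0 <= C & forall x i h, `|h| <= rho / 2 ->
    `|hardy_test p f (x + h *: delta_mx ord0 i) - hardy_test p f x| <= C * `|h|.
Proof.
move=> p1 [rho0 L0 M0 fP [fM fL]].
set r := rho / 2; have r0 : 0 < r by rewrite divr_gt0.
pose A := (M + rho) * (p * (M / r) `^ (p - 1)).
have p0 : 0 < p by exact: lt_trans p1.
have A0 : 0 <= A by rewrite !mulr_ge0 ?powR_ge0 ?addr_ge0 ?(ltW M0) ?(ltW rho0) ?(ltW p0).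
pose C2 := A * (M / r ^+ 2) + (M / r) `^ p.
have C20 : 0 <= C2 by rewrite addr_ge0 ?powR_ge0// mulr_ge0// divr_ge0 ?(ltW M0)// exprn_ge0// ltW.
have C10 : 0 <= A / r by rewrite divr_ge0 ?(ltW r0).
exists (A / r * L + C2).
  by rewrite addr_ge0// mulr_ge0// ltW.
move=> x i h hr; set x' := x + _.
have dd : `|d x' - d x| <= `|h| by exact: dist_step.
have rE : rho = r + r by rewrite /r; lra.
have main : r <= d x -> r <= d x' -> d x' <= M + rho ->
    `|hardy_test p f x' - hardy_test p f x| <= (A / r * L + C2) * `|h|.
  move=> rd rd' d'D; rewrite /hardy_test.
  apply: (le_trans (scaled_power_lip p1 r0 M0 rd rd' d'D (fM x) (fM x'))).
  rewrite [leRHS]mulrDl; apply: lerD; last by rewrite ler_wpM2l.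
  by rewrite -[leRHS]mulrA ler_wpM2l// fL.
have [d1 d2] : d x' <= d x + `|h| /\ d x <= d x' + `|h|.
  by move: dd; rewrite ler_norml => /andP[]; lra.
have [fx|/fP[_ dl du _]] := eqVneq (f x) 0; last by apply: main; lra.
have [fx'|/fP[_ dl du _]] := eqVneq (f x') 0; last by apply: main; lra.
rewrite !hardy_test0// subrr normr0 mulr_ge0// addr_ge0// mulr_ge0// ltW //.
Qed.

Lemma hardy_test_le : 1 < p -> test_bounds -> exists2 C : R, 0 <= C &
  forall x, hardy_test p f x <= C.
Proof.
move=> p1 [rho0 L0 M0 fP [fM fL]]; have p0 : 0 < p by exact: lt_trans p1.
exists (M * (M / rho) `^ p); first by rewrite mulr_ge0 ?powR_ge0// ltW.
move=> x; have [fx|fx] := eqVneq (f x) 0.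
  by rewrite hardy_test0// mulr_ge0 ?powR_ge0// ltW.
have [_ d1 d2 _] := fP x fx; have dx : 0 < d x by exact: lt_le_trans d1.
rewrite /hardy_test ler_pM ?powR_ge0 ?(ltW dx)//.
rewrite ge0_ler_powR ?nnegrE ?(ltW p0) ?divr_ge0 ?(ltW dx) ?(ltW M0) ?(ltW rho0)//.
by rewrite ler_pM ?invr_ge0 ?(ltW dx)// lef_pV2.
Qed.

(** The bound, uniform in [x] and [h], that Fatou's lemma requires: semiconcavity with constant
    [2 / rho] where [hardy_test] is nonzero, and Lipschitz bounds for the product of first
    differences. *)
Lemma defect_term_ge (oO : open Omega) (cO : ~` Omega !=set0) : 1 < p -> test_bounds ->
  exists2 C : R, 0 <= C & forall x i h, `|h| <= rho / 2 -> h != 0 ->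
    - C <= defect_term p f i h x.
Proof.
move=> p1 tb; have [C1 C10 C1P] := hardy_test_lip cO p1 tb.
have [C2 C20 C2P] := hardy_test_le p1 tb.
have [rho0 L0 M0 fP [fM fL]] := tb.
exists (C2 * (2 / rho) + C1).
  by rewrite addr_ge0// mulr_ge0// divr_ge0// ltW.
move=> x i h hr h0; rewrite defect_termE.
have h2 : 0 < h ^+ 2 by rewrite exprn_even_gt0.
have hh : h ^+ 2 = `|h| * `|h| by rewrite -normrM -expr2 ger0_norm ?sqr_ge0.
rewrite ler_pdivlMr// mulNr mulrDl opprD lerB//; last first.
  rewrite (le_trans (ler_norm _))// normrM hh mulrA ler_pM ?C1P//.
  exact: dist_step.
have [fx|fx] := eqVneq (f x) 0.
  by rewrite hardy_test0// mul0r oppr_le0 mulr_ge0 ?sqr_ge0// mulr_ge0// divr_ge0// ltW.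
have [_ d1 d2 _] := fP x fx; have dx : 0 < d x by exact: lt_le_trans d1.
apply: (@le_trans _ _ (hardy_test p f x * - (2 * h ^+ 2 / d x))); last first.
  by rewrite ler_wpM2l ?hardy_test_ge0// second_difference_ge.
have -> : C2 * (2 / rho) * h ^+ 2 = C2 * (2 * h ^+ 2 / rho) by ring.
rewrite mulrN lerN2; apply: ler_pM; [exact: hardy_test_ge0| |exact: C2P|].
  by rewrite divr_ge0 ?(ltW dx)// mulr_ge0 ?(ltW h2).
apply: ler_wpM2l; first by rewrite mulr_ge0 ?(ltW h2).
by rewrite lef_pV2 ?posrE.
Qed.

Lemma defect_term_support : 1 < p -> test_bounds -> forall x i h, `|h| <= rho ->
  defect_term p f i h x != 0 -> cube (B + rho) x.
Proof.
move=> p1 [rho0 L0 M0 fP [fM fL]] x i h hr D0.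
have [fx|/fP[_ _ _ Bx]] := eqVneq (f x) 0; last first.
  by move=> j; rewrite (le_trans (Bx j))// lerDl ltW.
have [fx'|/fP[_ _ _ Bx]] := eqVneq (f (x + h *: delta_mx ord0 i)) 0.
  by move: D0; rewrite /defect_term !hardy_test0// !mul0r subrr mul0r eqxx.
move=> j; have := Bx j; rewrite !mxE eqxx /=.
have : `|h * (j == i)%:R| <= rho by case: (j == i); rewrite ?mulr1 ?mulr0 ?normr0 ?(ltW rho0).
move: (h * _) => t tr xt; have -> : x ord0 j = (x ord0 j + t) - t by ring.
by rewrite (le_trans (ler_normB _ _))// lerD.
Qed.

(** Only the value at [x + h e_i] survives. There [|f| <= L |h|], so [hardy_test] is of order
    [|h|^p], which is o(|h|) as [p > 1], and the increment of [d] is at most [|h|]. *)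
Lemma defect_term_zero (cO : ~` Omega !=set0) x i : 1 < p -> test_bounds -> f x = 0 ->
  forall e : R, 0 < e -> \forall h \near 0^', - e <= defect_term p f i h x.
Proof.
move=> p1 [rho0 L0 M0 fP [fM fL]] fx e e0; have p0 : 0 < p by exact: lt_trans p1.
have q0 : 0 < p - 1 by rewrite subr_gt0.
pose Lr := L / rho; have Lr0 : 0 < Lr by rewrite divr_gt0.
have eM : 0 < e / (M * Lr) by rewrite divr_gt0// mulr_gt0.
(* The threshold on [|f| / d] below which its power [p - 1] is at most [e / (M * Lr)]. *)
pose dl := (e / (M * Lr)) `^ (p - 1)^-1.
have dl0 : 0 < dl by rewrite powR_gt0.
have rr : 0 < dl / Lr by rewrite divr_gt0.
exists (dl / Lr) => //= h; rewrite /ball_/= sub0r normrN => hr h0.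
have h2 : 0 < h ^+ 2 by rewrite exprn_even_gt0.
have hh : h ^+ 2 = `|h| * `|h| by rewrite -normrM -expr2 ger0_norm ?sqr_ge0.
rewrite /defect_term hardy_test0// mul0r sub0r ler_pdivlMr// mulNr lerN2.
set x' := x + _.
have dd : `|d x' - d x| <= `|h| by exact: dist_step.
suff H : hardy_test p f x' <= e * `|h|.
  rewrite (le_trans (ler_norm _))// normrM hh mulrA ler_pM//.
  by rewrite ger0_norm ?hardy_test_ge0.
have [fx'|fx'] := eqVneq (f x') 0.
  by rewrite hardy_test0// mulr_ge0// ltW.
have [_ d1 d2 _] := fP x' fx'; have dx' : 0 < d x' by exact: lt_le_trans d1.
have fh : `|f x'| <= L * `|h| by have := fL x i h; rewrite fx subr0.
have w0 : 0 <= `|f x'| / d x' by rewrite divr_ge0// ltW.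
have wle : `|f x'| / d x' <= Lr * `|h|.
  rewrite ler_pdivrMr//; apply: (le_trans fh).
  have -> : L * `|h| = Lr * `|h| * rho by rewrite /Lr; field; rewrite gt_eqF.
  by rewrite ler_wpM2l// mulr_ge0// ltW.
have wdl : `|f x'| / d x' <= dl.
  by rewrite (le_trans wle)// mulrC -ler_pdivlMr// ltW.
have wp : (`|f x'| / d x') `^ (p - 1) <= e / (M * Lr).
  have -> : e / (M * Lr) = dl `^ (p - 1).
    by rewrite /dl -powRrM mulVf ?gt_eqF// powRr1// ltW.
  by rewrite ge0_ler_powR ?nnegrE ?(ltW q0) ?(ltW dl0).
rewrite /hardy_test (powR_split w0 p1).
apply: (@le_trans _ _ (M * ((Lr * `|h|) * (e / (M * Lr))))).
  apply: ler_pM; [exact: ltW|by rewrite mulr_ge0 ?powR_ge0|exact: d2|].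
  by apply: ler_pM; rewrite ?powR_ge0.
by rewrite le_eqVlt; apply/orP; left; apply/eqP; field; rewrite !gt_eqF.
Qed.

(* With two nearest points d has a concave edge: its second difference is of order - |h|,
   so the defect explodes like 1 / |h|. *)
Lemma defect_term_multiple (cO : ~` Omega !=set0) x y y' i (T : R) :
  1 < p -> test_bounds -> f x != 0 -> near_pt x y -> near_pt x y' ->
  y ord0 i != y' ord0 i -> \forall h \near 0^', T <= defect_term p f i h x.
Proof.
move=> p1 tb fx xy xy' yy'.
have [C1 C10 C1P] := hardy_test_lip cO p1 tb.
have [rho0 L0 M0 fP [fM fL]] := tb.
have [_ d1 d2 _] := fP x fx; have dx : 0 < d x by exact: lt_le_trans d1.
have ps0 : 0 < hardy_test p f x.
  by rewrite mulr_gt0// powR_gt0// divr_gt0// normr_gt0.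
pose g := `|(y' - y) ord0 i| / d x.
have g0 : 0 < g by rewrite divr_gt0// normr_gt0 !mxE subr_eq0 eq_sym.
pose K := `|T| + C1 + hardy_test p f x * (2 / d x) + 1.
have K0 : 0 < K by rewrite ltr_wpDl// !addr_ge0// mulr_ge0 ?(ltW ps0)// divr_ge0// ltW.
have rr : 0 < Num.min (rho / 2) (hardy_test p f x * g / K).
  by rewrite lt_min !divr_gt0// mulr_gt0.
exists (Num.min (rho / 2) (hardy_test p f x * g / K)) => //= h.
rewrite /ball_/= sub0r normrN lt_min => /andP[/ltW hr hK] h0.
have h2 : 0 < h ^+ 2 by rewrite exprn_even_gt0.
have hh : h ^+ 2 = `|h| * `|h| by rewrite -normrM -expr2 ger0_norm ?sqr_ge0.
have hp : 0 < `|h| by rewrite normr_gt0.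
rewrite defect_termE ler_pdivlMr//.
have S := second_difference_gap cO i h dx xy xy'.
have S2 := ler_wpM2l (ltW ps0) S.
have P1 : (hardy_test p f (x + h *: delta_mx ord0 i) - hardy_test p f x) *
    (d (x + h *: delta_mx ord0 i) - d x) <= C1 * h ^+ 2.
  rewrite (le_trans (ler_norm _))// normrM hh mulrA ler_pM ?C1P//.
  exact: dist_step.
have T1 : T * h ^+ 2 <= `|T| * h ^+ 2 by rewrite ler_wpM2r ?(ltW h2)// ler_norm.
have K1 : K * h ^+ 2 <= hardy_test p f x * g * `|h|.
  by rewrite hh mulrA ler_wpM2r// ltW// mulrC -ltr_pdivlMr.
have E : hardy_test p f x * (`|h| * `|(y' - y) ord0 i| / d x - 2 * h ^+ 2 / d x) =
   hardy_test p f x * g * `|h| - hardy_test p f x * (2 / d x) * h ^+ 2.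
  rewrite /g; move: (hardy_test p f x) `|(y' - y) ord0 i| `|h| => a b c.
  by field; rewrite gt_eqF.
rewrite E in S2; move: S2 P1 T1 K1; rewrite /K.
move: (hardy_test p f x * (2 / d x)) (hardy_test p f x * g * `|h|) => a b.
move: (hardy_test p f x * (_ - _ - _)) ((hardy_test p f (x + _) - _) * _) => u v.
rewrite !mulrDl mul1r; move: (T * h ^+ 2) (`|T| * h ^+ 2) (C1 * h ^+ 2) (a * h ^+ 2) => *; lra.
Qed.

End bounds.

End defect_bounds.

(** * Lower limit of the defect at a point *)

Section pointwise_liminf.
Context {R : realType} (n : nat) (Omega : set 'rV[R]_n.+1).
Local Notation d := (dist_compl Omega).
Local Notation near_pt := (near_pt Omega).
Local Notation e_ i := (delta_mx ord0 i : 'rV[R]_n.+1).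

Lemma difference_quotient (g : 'rV[R]_n.+1 -> R) x v (a : R) : is_derive x v g a ->
  (fun h : R => (g (x + h *: v) - g x) / h) @ 0^' --> a.
Proof.
move=> [Dg Dv]; have /cvg_ex[l cl] :
    cvg ((fun h : R => h^-1 *: ((g \o shift x) (h *: v) - g x)) @ 0^') := Dg.
have lE : l = a by rewrite -Dv /derive; apply/esym/cvg_lim.
rewrite -lE; apply: cvg_trans cl; apply: near_eq_cvg; near=> h.
by rewrite /= mulrC (addrC x).
Unshelve. all: by end_near. Qed.

(** [young_tangent] for c^(1/p) w and c^((1-p)/p) g, with c = (p - 1) / p. The weights cancel in the
    mixed product, and subtracting the [w] term from [(p - 1) w^p] leaves [c w^p], because
    [(p - 1) (1 - c) = c]. *)
Lemma hardy_young (p w g : R) : 1 < p -> 0 <= w -> 0 <= g ->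
  p * w `^ (p - 1) * g <=
  ((p - 1) / p) `^ (1 - p) * g `^ p + (p - 1) * ((p - 1) / p) * w `^ p.
Proof.
move=> p1 w0 g0; have p0 : 0 < p by lra.
have : 0 < (p - 1) / p by rewrite divr_gt0 ?subr_gt0.
move: ((p - 1) / p) => c c0.
have H := young_tangent p1 (mulr_ge0 (powR_ge0 c p^-1) w0) (mulr_ge0 (powR_ge0 c ((1 - p) / p)) g0).
move: H; rewrite !powRM ?powR_ge0// -!powRrM mulVf ?gt_eqF// powRr1 ?(ltW c0)//.
rewrite divfK ?gt_eqF// !mulrA.
have cc : c `^ ((1 - p) / p) * c `^ (p^-1 * (p - 1)) = 1.
  rewrite -powRD; last by rewrite (gt_eqF c0) implybT.
  by rewrite (_ : _ + _ = 0) ?powRr0//; field; rewrite gt_eqF.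
suff -> : p * w `^ (p - 1) * g =
    p * c `^ ((1 - p) / p) * g * c `^ (p^-1 * (p - 1)) * w `^ (p - 1) by [].
by rewrite -[LHS]mul1r -{1}cc; ring.
Qed.

Lemma powR_near1 (p e : R) : 1 < p -> 0 < e -> exists2 k : R, 0 < k < 1 & 1 - e <= k `^ (p - 1).
Proof.
move=> p1 e0; have q0 : 0 < p - 1 by lra.
pose b := Num.max (1 - e) (1 / 2).
have b0 : 0 < b by rewrite lt_max; apply/orP; right; lra.
have b1 : b < 1 by rewrite gt_max; apply/andP; split; lra.
exists (b `^ (p - 1)^-1).
  have p1E : (1 : R) `^ (p - 1)^-1 = 1 by rewrite powR1.
  by rewrite powR_gt0//= -[ltRHS]p1E gt0_ltr_powR ?invr_gt0 ?nnegrE ?(ltW b0).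
by rewrite -powRrM mulVf ?gt_eqF// powRr1 ?(ltW b0)// le_max lexx.
Qed.

Lemma hardy_test_derive (oO : open Omega) (cO : ~` Omega !=set0) (p : R)
    (f : 'rV[R]_n.+1 -> R) x y v (b : R) :
  1 < p -> Omega x -> f x != 0 -> near_pt x y -> (forall y', near_pt x y' -> y' = y) ->
  is_derive x v f b ->
  is_derive x v (hardy_test Omega p f)
    (p * (`|f x| / d x) `^ (p - 1) * (Num.sg (f x) * b) -
     (p - 1) * (`|f x| / d x) `^ p * (dot (x - y) v / d x)).
Proof.
move=> p1 Ox fx xy uniq Df; have dx := dist_gt0 oO cO Ox.
have Dd := dist_is_derive oO cO v Ox xy uniq.
have DN := is_derive_comp1 (norm_is_derive fx) Df.
have Di : is_derive x v (fun z => (d z)^-1) (- (d x) ^- 2 * (dot (x - y) v / d x)).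
  have D1 := @is_deriveV R id (d x) 1 1 (lt0r_neq0 dx) (is_derive_id _ _).
  rewrite [_ *: _]mulr1 in D1.
  exact: (@is_derive_comp1 _ _ (fun t => t^-1) d x v _ _ D1 Dd).
have Dw := @is_deriveM R _ (fun z => `|f z|) (fun z => (d z)^-1) x v _ _ DN Di.
have w0 : 0 < `|f x| / d x by rewrite divr_gt0// normr_gt0.
have Dp := @is_derive_comp1 _ _ (fun t => t `^ p) (fun z => `|f z| / d z) x v _ _
  (is_derive1_powR p w0) Dw.
have Dq := @is_deriveM R _ d (fun z => (`|f z| / d z) `^ p) x v _ _ Dd Dp.
move: Dq.
set A := (X in is_derive _ _ _ X -> _); set B := (X in _ -> is_derive _ _ _ X).
suff -> : A = B by [].
rewrite /A /B /GRing.scale/= (powR_split (ltW w0) p1).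
move: (_ `^ _) => q; move: (dot _ _) => t.
by field; rewrite gt_eqF.
Qed.

(** The terms [(1 - k) d x] of [segment_shift] are compensated in the second difference, [d] being
    [k d x] at the inner point. The product of first differences stays at [x], where [d] is once
    differentiable. *)
Lemma defect_term_inner (cO : ~` Omega !=set0) (p : R) f x y (k : R) i (h : R) :
  near_pt x y -> 0 < k -> k < 1 -> h != 0 ->
  hardy_test Omega p f x * - ((d (y + k *: (x - y) + h *: e_ i) +
     d (y + k *: (x - y) - h *: e_ i) - 2 * d (y + k *: (x - y))) / h ^+ 2) -
  ((hardy_test Omega p f (x + h *: e_ i) - hardy_test Omega p f x) / h) *
     ((d (x + h *: e_ i) - d x) / h) <= defect_term Omega p f i h x.
Proof.
move=> xy k0 k1 h0; have h2 : 0 < h ^+ 2 by rewrite exprn_even_gt0.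
rewrite defect_termE (segment_dist cO xy k0 k1).
move: (segment_shift cO xy k0 k1 (h *: e_ i)) (segment_shift cO xy k0 k1 (- (h *: e_ i))).
move: (hardy_test_ge0 cO p f x).
move: (hardy_test _ _ _ x) (hardy_test _ _ _ (x + _)) => a b.
move: (d (x + _)) (d (x - _)) (d (y + _ + _)) (d (y + _ - _)) (d x).
move=> u u' v v' t a0 S1 S2.
rewrite [leLHS](_ : _ = (a * - (v + v' - 2 * (k * t)) - (b - a) * (u - t)) / h ^+ 2); last by field.
rewrite ler_pM2r ?invr_gt0// lerB// ler_wpM2l//; lra.
Qed.

(* [segment_shift] bounds the second differences of d at x by those at an inner point, where d
   is twice differentiable; the inner point then tends to x. *)
Lemma defect_sum_unique (oO : open Omega) (cO : ~` Omega !=set0) (C2 : C2_boundary Omega)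
    (p l : R) (f : 'rV[R]_n.+1 -> R) x y : 1 < p -> 0 <= l ->
  (forall z z', inner_point Omega z z' -> l * d z `^ (p - 1) <= - laplacian d z) ->
  Omega x -> (forall i, is_derive x (e_ i) f (partial i f x)) -> f x != 0 ->
  near_pt x y -> (forall y', near_pt x y' -> y' = y) ->
  forall e : R, 0 < e -> \forall h \near 0^',
    l * `|f x| `^ p + (p - 1) / p * (`|f x| / d x) `^ p -
    ((p - 1) / p) `^ (1 - p) * enorm (grad f x) `^ p - e <=
    \sum_i defect_term Omega p f i h x.
Proof.
move=> p1 l0 lap Ox Df fx xy uniq e e0; have dx := dist_gt0 oO cO Ox.
(* Half of [e] pays for evaluating the Laplacian at the inner point, where [d] is [k d x] instead of
   [d x]. *)
have [k /andP[k0 k1] kp] : exists2 k : R, 0 < k < 1 &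
    l * `|f x| `^ p - e / 2 <= l * `|f x| `^ p * k `^ (p - 1).
  have q0 : 0 < l * `|f x| `^ p + 1 by rewrite ltr_wpDl// mulr_ge0 ?powR_ge0.
  have [k k01 kp] := powR_near1 p1 (divr_gt0 (divr_gt0 e0 (ltr0n _ 2)) q0).
  exists k => //; have := ler_wpM2l (_ : 0 <= l * `|f x| `^ p) kp.
  rewrite mulr_ge0 ?powR_ge0// => /(_ isT); apply: le_trans.
  move: (l * _) q0 => q q0; rewrite mulrBr mulr1 lerB// mulrA ler_pdivrMr//.
  by rewrite mulrC ler_wpM2l ?lerDl// divr_ge0// ltW.
pose w := `|f x| / d x; have w0 : 0 <= w by rewrite divr_ge0// ltW.
pose xs := y + k *: (x - y).
have ip : inner_point Omega xs y by exists x, k; rewrite k0 k1.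
(* [a] is the gradient of [d] at [x], and [Psi] that of [hardy_test]. *)
pose a i := (x - y) ord0 i / d x.
pose Psi i := p * w `^ (p - 1) * (Num.sg (f x) * partial i f x) - (p - 1) * w `^ p * a i.
pose F h i := hardy_test Omega p f x * -
  ((d (xs + h *: e_ i) + d (xs - h *: e_ i) - 2 * d xs) / h ^+ 2) -
  ((hardy_test Omega p f (x + h *: e_ i) - hardy_test Omega p f x) / h) *
     ((d (x + h *: e_ i) - d x) / h).
have Fcvg i : (fun h => F h i) @ 0^' -->
    hardy_test Omega p f x * - partial i (partial i d) xs - Psi i * a i.
  have T := taylor2_sym (dist_taylor oO cO C2 (v := e_ i) ip).
  have A := difference_quotient (hardy_test_derive oO cO p1 Ox fx xy uniq (Df i)).
  have B := difference_quotient (dist_is_derive oO cO (e_ i) Ox xy uniq).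
  rewrite (dotC (x - y)) dot_delta in A B.
  apply: cvgB; last by apply: cvgM.
  apply: cvgMr; apply: cvgN.
  have -> : partial i (partial i d) xs = 2 * ('D_(e_ i) (fun w => 'D_(e_ i) d w) xs / 2).
    by rewrite mulrC divfK.
  by under eq_fun do rewrite -scaleNr.
have Scvg : (fun h => \sum_i F h i) @ 0^' -->
    \sum_i (hardy_test Omega p f x * - partial i (partial i d) xs - Psi i * a i).
  apply: cvg_big => //; exact: add_continuous.
(* Strict, thanks to the other half of [e]: the Laplacian bound, Cauchy-Schwarz for the pairing of
   [grad f] with the unit vector [a], then [hardy_young]. *)
have lim : l * `|f x| `^ p + (p - 1) / p * w `^ p -
    ((p - 1) / p) `^ (1 - p) * enorm (grad f x) `^ p - e <
    \sum_i (hardy_test Omega p f x * - partial i (partial i d) xs - Psi i * a i).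
  have -> : \sum_i (hardy_test Omega p f x * - partial i (partial i d) xs - Psi i * a i) =
     hardy_test Omega p f x * - laplacian d xs -
     (p * w `^ (p - 1) * (Num.sg (f x) * (dot (grad f x) (x - y) / d x)) -
      (p - 1) * w `^ p * (dot (x - y) (x - y) / d x ^+ 2)).
    rewrite sumrB -mulr_sumr sumrN; congr (_ - _).
    rewrite /dot !mulr_suml !mulr_sumr -sumrB; apply: eq_bigr => i _.
    rewrite /Psi /a !mxE; move: (w `^ _) (w `^ _) => W V.
    by field; rewrite gt_eqF.
  have young := hardy_young p1 w0 (enorm_ge0 (grad f x)).
  have -> : dot (x - y) (x - y) / d x ^+ 2 = 1.
    by rewrite -enorm_sqr xy.2 divff// gt_eqF// exprn_gt0.
  have H1 : Num.sg (f x) * (dot (grad f x) (x - y) / d x) <= enorm (grad f x).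
    rewrite (le_trans (ler_norm _))// normrM normr_sg fx mul1r normrM.
    rewrite (gtr0_norm (_ : 0 < (d x)^-1)) ?invr_gt0// ler_pdivrMr// -xy.2.
    exact: dot_norm_le.
  have H2 : l * `|f x| `^ p * k `^ (p - 1) <= hardy_test Omega p f x * - laplacian d xs.
    have := ler_wpM2l (hardy_test_ge0 cO p f x) (lap _ _ ip); apply: le_trans.
    rewrite (segment_dist cO xy k0 k1) powRM ?(ltW k0) ?(ltW dx)// /hardy_test.
    have -> : `|f x| `^ p = d x `^ p * (`|f x| / d x) `^ p.
      by rewrite -powRM// ?(ltW dx)// mulrC divfK// gt_eqF.
    rewrite (powR_split (ltW dx) p1) le_eqVlt; apply/orP; left; apply/eqP; ring.
  have H3 := ler_wpM2l (_ : 0 <= p * w `^ (p - 1)) H1.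
  have {}H3 : p * w `^ (p - 1) * (Num.sg (f x) * (dot (grad f x) (x - y) / d x)) <=
     p * w `^ (p - 1) * enorm (grad f x).
    by apply: H3; rewrite mulr_ge0 ?powR_ge0//; lra.
  have c1 : (p - 1) / p * w `^ p + (p - 1) * ((p - 1) / p) * w `^ p = (p - 1) * w `^ p.
    by field; rewrite gt_eqF//; lra.
  move: young H2 H3 c1 kp; rewrite mulr1.
  move: (_ * - _) (p * _ * enorm _) (p * _ * (_ * _)) ((p - 1) / p * w `^ p) => A1 A2 A3 A4.
  move: (_ * enorm _ `^ p) (_ * w `^ p) ((p - 1) * w `^ p) (l * _) => A5 A6 A7 A8.
  move: (A8 * _) => A9 *; lra.
have H := cvgr_gt _ Scvg _ lim.
near=> h.
have h0 : h != 0 by near: h; exact: nbhs_dnbhs_neq.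
apply: (@le_trans _ _ (\sum_i F h i)); first by apply: ltW; near: h; exact: H.
by apply: ler_sum => i _; exact: defect_term_inner.
Unshelve. all: by end_near. Qed.

End pointwise_liminf.

Section pointwise_bound.
Context {R : realType} (n : nat) (Omega : set 'rV[R]_n.+1).
Local Notation d := (dist_compl Omega).
Local Notation near_pt := (near_pt Omega).
Local Notation e_ i := (delta_mx ord0 i : 'rV[R]_n.+1).

Definition hardy_gap (p l : R) (f : 'rV[R]_n.+1 -> R) x : R :=
  l * `|f x| `^ p + (p - 1) / p * (`|f x| / d x) `^ p -
  ((p - 1) / p) `^ (1 - p) * enorm (grad f x) `^ p.

Lemma defect_sum_near (oO : open Omega) (cO : ~` Omega !=set0) (C2 : C2_boundary Omega)
    (p l rho L M B : R) (f : 'rV[R]_n.+1 -> R) x : 1 < p -> 0 <= l ->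
  (forall z z', inner_point Omega z z' -> l * d z `^ (p - 1) <= - laplacian d z) ->
  test_bounds Omega rho L M B f -> (forall i, is_derive x (e_ i) f (partial i f x)) ->
  forall e : R, 0 < e -> \forall h \near 0^',
    hardy_gap p l f x - e <= \sum_i defect_term Omega p f i h x.
Proof.
move=> p1 l0 lap tb Df e e0; have p0 : 0 < p by lra.
have [fx|fx] := eqVneq (f x) 0.
  have en : 0 < e / n.+1%:R by rewrite divr_gt0.
  have H : \forall h \near 0^', forall i, - (e / n.+1%:R) <= defect_term Omega p f i h x.
    by apply: filter_forall => i; exact: (defect_term_zero cO i p1 tb fx en).
  near=> h; have H' : forall i, - (e / n.+1%:R) <= defect_term Omega p f i h x by near: h.
  apply: (@le_trans _ _ (\sum_(i < n.+1) (- (e / n.+1%:R)))); last exact: ler_sum.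
  rewrite sumr_const card_ord mulNrn -[_ / _ *+ _]mulr_natr divfK ?pnatr_eq0//.
  rewrite /hardy_gap fx normr0 mul0r powR0 ?gt_eqF// !mulr0 addr0 sub0r gerDr oppr_le0.
  by rewrite mulr_ge0 ?powR_ge0.
have [rho0 _ _ fP _] := tb; have [Ox _ _ _] := fP x fx.
have [y xy] := near_pt_ex oO cO x.
have [uniq|/existsNP[y' /not_implyP[xy' /eqP yy']]] := pselect (forall y', near_pt x y' -> y' = y).
  exact: (defect_sum_unique oO cO C2 p1 l0 lap Ox Df fx xy uniq).
have [i yi] : exists i, y ord0 i != y' ord0 i.
  apply: contrapT => H; move/eqP: yy'; apply; apply/rowP => i; apply: contrapT => /eqP ne.
  by apply: H; exists i; rewrite eq_sym.
have [C C0 CP] := defect_term_ge oO cO p1 tb.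
(* The threshold includes [C] for each of the other [n] directions, whose terms are bounded below by
   [- C]. *)
have Hi := @defect_term_multiple _ _ _ _ _ _ _ _ _ cO _ _ _ i
  (hardy_gap p l f x + C *+ n) p1 tb fx xy xy' yi.
near=> h.
have h0 : h != 0 by near: h; exact: nbhs_dnbhs_neq.
have hr : `|h| <= rho / 2.
  near: h; exists (rho / 2); first by rewrite /= divr_gt0.
  by move=> z /=; rewrite sub0r normrN => /ltW.
have Hh : hardy_gap p l f x + C *+ n <= defect_term Omega p f i h x by near: h.
rewrite (bigD1 i)//=.
have S : - (C *+ n) <= \sum_(j < n.+1 | j != i) defect_term Omega p f j h x.
  apply: (@le_trans _ _ (\sum_(j < n.+1 | j != i) - C)); last by apply: ler_sum => j _; exact: CP.
  by rewrite sumr_const cardC1 card_ord mulNrn.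
by move: S Hh; move: (C *+ n) => c; lra.
Unshelve. all: by end_near. Qed.

End pointwise_bound.

(** * Integration of the defect *)

Section fatou.
Context d (T : measurableType d) (R : realType) (mu : {measure set T -> \bar R}).
Local Open Scope ereal_scope.

Lemma limn_einf_ge (u : (\bar R)^nat) (a : \bar R) :
  (\forall k \near \oo, a <= u k) -> a <= limn_einf u.
Proof.
move=> [N _ H]; rewrite limn_einf_lim.
apply: (@le_trans _ _ (einfs u N)).
  by apply: le_ereal_inf_tmp => _ [k /= Nk <-]; exact: H.
rewrite (cvg_lim _ (@cvg_einfs_sup _ u))//.
by apply: ereal_sup_ubound; exists N.
Qed.

(** Fatou's lemma for the nonnegative functions [C + E k], all of integral [C * mu D]; finiteness of
    [mu D] allows the constant to be subtracted afterwards. *)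
Lemma integral_le0_of_lower_limit D (E : (T -> R)^nat) (g : T -> R) (C : R) :
  measurable D -> mu D < +oo ->
  (forall k x, D x -> (- C <= E k x)%R) -> (forall x, D x -> (- C <= g x)%R) ->
  (forall k, mu.-integrable D (EFin \o E k)) -> mu.-integrable D (EFin \o g) ->
  (forall k, \int[mu]_(x in D) (E k x)%:E = 0) ->
  (forall x, D x -> forall e : R, (0 < e)%R -> \forall k \near \oo, (g x - e <= E k x)%R) ->
  \int[mu]_(x in D) (g x)%:E <= 0.
Proof.
move=> mD fD EC gC iE ig E0 Eg.
have Dfin : mu D \is a fin_num by rewrite ge0_fin_numE.
have iC : mu.-integrable D (EFin \o (cst C)).
  apply: measurable_bounded_integrable => //.
  by exists `|C|%R; split; rewrite ?num_real// => x Cx y _ /=; exact: ltW.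
pose h k x := C%:E + (E k x)%:E.
have mh k : measurable_fun D (h k).
  by apply: emeasurable_funD; [exact: measurable_int iC|exact: measurable_int (iE k)].
have h0 k x : D x -> 0 <= h k x.
  by move=> Dx; rewrite /h -EFinD lee_fin; have := EC k x Dx; lra.
have inth k : \int[mu]_(x in D) h k x = C%:E * mu D.
  rewrite integralD//; last exact: iE.
  by rewrite E0 adde0 integral_cst.
have := fatou mu mD mh h0.
under [X in _ <= limn_einf X -> _]eq_fun do rewrite inth.
rewrite is_cvg_limn_einfE//; last exact: is_cvg_cst.
rewrite lim_cst// => F.
have : \int[mu]_(x in D) (C%:E + (g x)%:E) <= C%:E * mu D.
  apply: le_trans F; apply: ge0_le_integral => //.
  - by move=> x Dx; rewrite -EFinD lee_fin; have := gC x Dx; lra.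
  - by apply: emeasurable_funD; [exact: measurable_int iC|exact: measurable_int ig].
  - rewrite /limn_einf; apply: measurableT_comp => //; apply: measurable_fun_limn_esup => k.
    by apply: measurableT_comp.
  - move=> x Dx; apply/lee_addgt0Pr => e e0.
    rewrite -leeBlDr//; apply: limn_einf_ge.
    have := Eg x Dx e e0; apply: filterS => k Hk.
    by rewrite /h -!EFinD lee_fin; lra.
rewrite integralD//; rewrite (integral_cst mu mD C%:E).
by rewrite -leeBrDl ?subee// fin_numM.
Qed.

End fatou.

Section hardy_measurable.
Context {R : realType} (n : nat) (Omega : set 'rV[R]_n.+1).
Local Notation d := (dist_compl Omega).
Local Notation e_ i := (delta_mx ord0 i : 'rV[R]_n.+1).
Local Notation leb := (lebesgue_rV n.+1).
Implicit Types (f : 'rV[R]_n.+1 -> R).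

Lemma measurable_dist (cO : ~` Omega !=set0) : measurable_fun setT d.
Proof. by apply: continuous_measurable_rV; exact: dist_continuous. Qed.

Lemma measurable_hardy_ratio (cO : ~` Omega !=set0) (p : R) f : continuous f ->
  measurable_fun setT (fun x => (`|f x| / d x) `^ p).
Proof.
move=> cf; apply: (measurableT_comp (measurable_powR p)).
have -> : (fun x => `|f x| / d x) = (fun x => `|f x| * d x `^ (-1)).
  by apply/funext => x; rewrite powR_inv1// dist_ge0.
apply: measurable_funM; first by apply: measurableT_comp => //; exact: continuous_measurable_rV.
by apply: (measurableT_comp (measurable_powR (-1))); exact: measurable_dist.
Qed.

Lemma measurable_hardy_test (cO : ~` Omega !=set0) (p : R) f : continuous f ->
  measurable_fun setT (hardy_test Omega p f).
Proof.
by move=> cf; apply: measurable_funM; [exact: measurable_dist|exact: measurable_hardy_ratio].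
Qed.

(* Translation invariance of the measure makes the defect, a difference of translates of the
   flux, integrate to 0. *)
Definition hardy_flux (p : R) f i (h : R) x : R :=
  hardy_test Omega p f x * (d x - d (x - h *: e_ i)) / h ^+ 2.

Lemma defect_term_flux p f i h x : defect_term Omega p f i h x =
  hardy_flux p f i h x - hardy_flux p f i h (x + h *: e_ i).
Proof. by rewrite /defect_term /hardy_flux addrK mulrBl. Qed.

Lemma measurable_hardy_flux (cO : ~` Omega !=set0) p f i h : continuous f ->
  measurable_fun setT (hardy_flux p f i h).
Proof.
move=> cf; apply: measurable_funM => //; apply: measurable_funM.
  exact: measurable_hardy_test.
apply: measurable_funB; first exact: measurable_dist.
have := measurableT_comp (measurable_dist cO) (measurable_shift_rV (- (h *: e_ i))).
by [].
Qed.

Lemma integrable_hardy_flux (cO : ~` Omega !=set0) (p rho L M B : R) f i h : 1 < p ->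
  continuous f -> test_bounds Omega rho L M B f ->
  leb.-integrable setT (EFin \o hardy_flux p f i h).
Proof.
move=> p1 cf tb; have [C C0 CP] := hardy_test_le p1 tb.
have [_ _ _ fP _] := tb.
have -> : EFin \o hardy_flux p f i h = (EFin \o hardy_flux p f i h) \_ (cube B).
  apply/funext => x; rewrite /patch; case: ifPn => // /negP nB /=.
  have [fx|/fP[_ _ _ Bx]] := eqVneq (f x) 0; last by exfalso; apply: nB; rewrite inE.
  by rewrite /hardy_flux hardy_test0// !mul0r.
apply: (iffLR (@integrable_mkcond _ _ R leb _ (EFin \o hardy_flux p f i h) (measurable_cube B))).
apply: measurable_bounded_integrable; first exact: measurable_cube.
- exact: lebesgue_cube_fin.
- by apply: measurable_funTS; exact: measurable_hardy_flux.
exists (C * `|h| / h ^+ 2); split; rewrite ?num_real// => K CK x _ /=.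
rewrite (le_trans _ (ltW CK))// /hardy_flux normrM.
rewrite (ger0_norm (_ : 0 <= (h ^+ 2)^-1)) ?invr_ge0 ?sqr_ge0//.
rewrite ler_wpM2r ?invr_ge0 ?sqr_ge0// normrM (ger0_norm (hardy_test_ge0 cO _ _ _)).
apply: ler_pM; [exact: hardy_test_ge0|exact: normr_ge0|exact: CP|].
have := dist_step cO (x - h *: e_ i) i h.
by rewrite subrK.
Qed.

Lemma integral_defect_term (cO : ~` Omega !=set0) (p rho L M B : R) f i h : 1 < p ->
  continuous f -> test_bounds Omega rho L M B f ->
  leb.-integrable setT (EFin \o defect_term Omega p f i h) /\
  (\int[leb]_x (defect_term Omega p f i h x)%:E = 0)%E.
Proof.
move=> p1 cf tb; have iF := integrable_hardy_flux cO i h p1 cf tb.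
have iS : leb.-integrable setT (fun x => (hardy_flux p f i h (x + h *: e_ i))%:E).
  exact: (integrable_shift (h *: e_ i) iF).
have E : EFin \o defect_term Omega p f i h =
    (fun x => (hardy_flux p f i h x)%:E - (hardy_flux p f i h (x + h *: e_ i))%:E)%E.
  by apply/funext => x; rewrite /= defect_term_flux EFinB.
split; first by rewrite E; exact: integrableB.
rewrite -[X in (\int[_]_x X x)%E]/(EFin \o defect_term Omega p f i h) E integralB//.
have -> := integral_shift (h *: e_ i) iF.
by rewrite subee// integrable_fin_num.
Qed.

End hardy_measurable.

Section hardy_integral.
Context {R : realType} (n : nat) (Omega : set 'rV[R]_n.+1).
Local Notation d := (dist_compl Omega).
Local Notation e_ i := (delta_mx ord0 i : 'rV[R]_n.+1).
Local Notation leb := (lebesgue_rV n.+1).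
Implicit Types (f : 'rV[R]_n.+1 -> R).

Lemma integral_support (F : 'rV[R]_n.+1 -> \bar R) (A B : set 'rV[R]_n.+1) :
  (forall x, F x != 0%E -> A x /\ B x) ->
  (\int[leb]_(x in A) F x = \int[leb]_(x in B) F x)%E.
Proof.
move=> H; rewrite !(integral_mkcond _ F); congr integral.
apply/funext => x; rewrite /patch.
have [->|/H[Ax Bx]] := eqVneq (F x) 0%E; first by rewrite !if_same.
by rewrite !mem_set.
Qed.

(** For [|h| <= rho] the defect lives in a cube that does not depend on [h], which supplies the
    domain of finite measure for the limit. *)
Lemma integrable_defect_cube (cO : ~` Omega !=set0) (p rho L M B : R) f i h : 1 < p ->
  continuous f -> test_bounds Omega rho L M B f -> `|h| <= rho ->
  leb.-integrable (cube (B + rho)) (EFin \o defect_term Omega p f i h) /\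
  (\int[leb]_(x in cube (B + rho)) (defect_term Omega p f i h x)%:E = 0)%E.
Proof.
move=> p1 cf tb hr; have [iE E0] := integral_defect_term cO i h p1 cf tb.
split; first by apply: integrableS iE => //; exact: measurable_cube.
rewrite -[RHS]E0; apply: integral_support => x; rewrite eqe => H; split => //.
exact: defect_term_support tb _ _ _ hr H.
Qed.

Lemma derive_bound f x v (L b : R) : is_derive x v f b ->
  (forall h, `|f (x + h *: v) - f x| <= L * `|h|) -> `|b| <= L.
Proof.
move=> D fL; have C := difference_quotient D.
apply/ler_addgt0Pr => e e0.
have /cvgrPdist_le/(_ e e0) H := C.
near (0 : R)^' => h.
have h0 : h != 0 by near: h; exact: nbhs_dnbhs_neq.
have bh : `|b - (f (x + h *: v) - f x) / h| <= e by near: h.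
have qL : `|(f (x + h *: v) - f x) / h| <= L.
  by rewrite normrM normfV ler_pdivrMr ?normr_gt0.
rewrite -[b](subrK ((f (x + h *: v) - f x) / h)) (le_trans (ler_normD _ _))//.
by rewrite addrC lerD.
Unshelve. all: by end_near. Qed.

Lemma measurable_grad_norm (p : R) f : (forall i, continuous (partial i f)) ->
  measurable_fun setT (fun x => enorm (grad f x) `^ p).
Proof.
move=> cf; apply: (measurableT_comp (measurable_powR p)).
apply: (@measurableT_comp _ _ _ _ _ _ (@enorm R n.+1) _ (grad f)).
  by apply: continuous_measurable_rV; exact: enorm_continuous.
apply: measurable_fun_rV => i.
under eq_fun do rewrite mxE.
exact: continuous_measurable_rV.
Qed.

Lemma integrable_cube (B : R) (g : 'rV[R]_n.+1 -> R) (C : R) : measurable_fun setT g ->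
  (forall x, 0 <= g x <= C) -> leb.-integrable (cube B) (EFin \o g).
Proof.
move=> mg gC; apply: measurable_bounded_integrable; first exact: measurable_cube.
- exact: lebesgue_cube_fin.
- exact: measurable_funTS.
- exists C; split; rewrite ?num_real// => K CK x _ /=.
  by have /andP[g0 gc] := gC x; rewrite ger0_norm// (le_trans gc)// ltW.
Qed.

Lemma hardy_gap_integral (oO : open Omega) (cO : ~` Omega !=set0) (C2 : C2_boundary Omega)
    (p l rho L M B : R) f : 1 < p -> 0 <= l ->
  (forall z z', inner_point Omega z z' -> l * d z `^ (p - 1) <= - laplacian d z) ->
  test_bounds Omega rho L M B f -> continuous f -> (forall i, continuous (partial i f)) ->
  (forall x i, is_derive x (e_ i) f (partial i f x)) ->
  (l%:E * (\int[leb]_(x in cube (B + rho)) (`|f x| `^ p)%:E) +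
   ((p - 1) / p)%:E * (\int[leb]_(x in cube (B + rho)) ((`|f x| / d x) `^ p)%:E) <=
   (((p - 1) / p) `^ (1 - p))%:E *
     (\int[leb]_(x in cube (B + rho)) (enorm (grad f x) `^ p)%:E))%E.
Proof.
move=> p1 l0 lap tb cf cdf Df; have [rho0 L0 M0 fP [fM fL]] := tb.
have p0 : 0 < p by exact: lt_trans p1.
have c0 : 0 < (p - 1) / p by rewrite divr_gt0 ?subr_gt0.
have mD := @measurable_cube R n.+1 (B + rho).
have fD := @lebesgue_cube_fin R n.+1 (B + rho).
pose F1 x := `|f x| `^ p; pose F2 x := (`|f x| / d x) `^ p.
pose F3 x := enorm (grad f x) `^ p.
have b1 x : 0 <= F1 x <= M `^ p.
  by rewrite powR_ge0 ge0_ler_powR ?nnegrE ?(ltW p0) ?(ltW M0).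
have b2 x : 0 <= F2 x <= (M / rho) `^ p.
  rewrite powR_ge0 ge0_ler_powR ?nnegrE ?(ltW p0) ?divr_ge0 ?(ltW M0) ?(ltW rho0) ?dist_ge0//=.
  have [->|fx] := eqVneq (f x) 0; first by rewrite normr0 mul0r divr_ge0// ltW.
  have [_ d1 _ _] := fP x fx; have dx : 0 < d x by exact: lt_le_trans d1.
  by rewrite ler_pM ?invr_ge0 ?(ltW dx)// lef_pV2.
have b3 x : 0 <= F3 x <= (Num.sqrt (n.+1%:R * L ^+ 2)) `^ p.
  rewrite powR_ge0 ge0_ler_powR ?nnegrE ?(ltW p0) ?sqrtr_ge0//=.
  have L1 := ltW L0; rewrite /enorm ler_sqrt ?mulr_ge0//.
  rewrite -[n.+1 in leRHS]card_ord mulr_natl -sumr_const ler_sum// => i _.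
  rewrite mxE -real_normK ?num_real// ler_pXn2r ?nnegrE//.
  by apply: (derive_bound (Df x i)) => h; exact: fL.
have i1 : leb.-integrable (cube (B + rho)) (EFin \o F1).
  apply: integrable_cube b1; apply: (measurableT_comp (measurable_powR p)).
  by apply: measurableT_comp => //; exact: continuous_measurable_rV.
have i2 : leb.-integrable (cube (B + rho)) (EFin \o F2).
  by apply: integrable_cube b2; exact: measurable_hardy_ratio.
have i3 : leb.-integrable (cube (B + rho)) (EFin \o F3).
  by apply: integrable_cube b3; exact: measurable_grad_norm.
have j1 := integrableZl mD l i1.
have j2 := integrableZl mD ((p - 1) / p) i2.
have j3 := integrableZl mD (((p - 1) / p) `^ (1 - p)) i3.
have j12 := integrableD mD j1 j2.
have gapE x : (hardy_gap Omega p l f x)%:E =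
  (l%:E * (F1 x)%:E + ((p - 1) / p)%:E * (F2 x)%:E - (((p - 1) / p) `^ (1 - p))%:E * (F3 x)%:E)%E.
  by rewrite /hardy_gap EFinB EFinD !EFinM.
have ig : leb.-integrable (cube (B + rho)) (EFin \o hardy_gap Omega p l f).
  have -> : EFin \o hardy_gap Omega p l f = (fun x => (l%:E * (F1 x)%:E +
      ((p - 1) / p)%:E * (F2 x)%:E - (((p - 1) / p) `^ (1 - p))%:E * (F3 x)%:E)%E).
    by apply/funext => x; exact: gapE.
  exact: integrableB.
suff : (\int[leb]_(x in cube (B + rho)) (hardy_gap Omega p l f x)%:E <= 0)%E.
  under eq_integral do rewrite gapE.
  rewrite integralB// integralD// !integralZl//.
  by rewrite sube_le0.
have [C C0 CP] := defect_term_ge oO cO p1 tb.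
(* Nonzero steps tending to 0, all within the range [rho / 2] of the uniform lower bound. *)
pose h k : R := rho / 2 / k.+1%:R.
have hk k : 0 < h k <= rho / 2.
  rewrite /h !divr_gt0//= ler_pdivrMr// ler_peMr ?divr_ge0 ?(ltW rho0)//.
  by rewrite ler1n.
have hB k : `|h k| <= rho.
  have /andP[h0 hr] := hk k; rewrite gtr0_norm// (le_trans hr)// ler_pdivrMr//.
  by rewrite ler_peMr ?(ltW rho0)// ler1n.
have h_near : h @ \oo --> 0^'.
  move=> A [r /= r0 rA].
  have H : h @ \oo --> 0.
    rewrite -(mulr0 (rho / 2)); apply: cvgMr; exact: cvg_harmonic.
  have /cvgrPdist_lt/(_ r r0) := H; apply: filterS => k Hk; apply: rA => //.
  by have /andP[h0 _] := hk k; rewrite gt_eqF.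
have iE k i := integrable_defect_cube cO i p1 cf tb (hB k).
(* The negative part of [hardy_gap] is at most [K3], since each partial derivative is bounded by
   [L]. *)
pose K3 := ((p - 1) / p) `^ (1 - p) * (Num.sqrt (n.+1%:R * L ^+ 2)) `^ p.
have K30 : 0 <= K3 by rewrite mulr_ge0 ?powR_ge0.
apply: (@integral_le0_of_lower_limit _ _ R leb _
  (fun k x => \sum_i defect_term Omega p f i (h k) x) _ (C *+ n.+1 + K3)) => //.
- move=> k x _; have /andP[h0 hr] := hk k.
  apply: (@le_trans _ _ (\sum_(i < n.+1) - C)).
    by rewrite sumr_const card_ord mulNrn lerN2 lerDl.
  by apply: ler_sum => i _; apply: CP; rewrite ?gtr0_norm ?gt_eqF.
- move=> x _; have /andP[a1 _] := b1 x; have /andP[a2 _] := b2 x; have /andP[_ a3] := b3 x.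
  have Cn : 0 <= C *+ n.+1 by rewrite mulrn_wge0.
  have := ler_wpM2l (powR_ge0 ((p - 1) / p) (1 - p)) a3.
  have := mulr_ge0 l0 a1; have := mulr_ge0 (ltW c0) a2.
  rewrite /hardy_gap -/(F1 x) -/(F2 x) -/(F3 x) -/K3.
  move: (l * _) (_ * F2 x) (_ * F3 x) Cn => A1 A2 A3; move: (C *+ _) => A4 *; lra.
- move=> k; have -> : EFin \o (fun x => \sum_i defect_term Omega p f i (h k) x) =
      (fun x => (\sum_i (EFin \o defect_term Omega p f i (h k)) x)%E).
    by apply/funext => x; rewrite /= sumEFin.
  by apply: integrable_sum => // i _; have [] := iE k i.
- move=> k; under eq_integral do rewrite -sumEFin.
  rewrite integral_sum//=; last by move=> i; have [] := iE k i.
  by rewrite big1// => i _; have [] := iE k i.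
move=> x _ e e0; have := defect_sum_near oO cO C2 p1 l0 lap tb (Df x) e0.
exact: h_near.
Qed.

End hardy_integral.

(** * Finiteness of the constant and the integral inequality *)

Section conclusion.
Context {R : realType} (n : nat) (Omega : set 'rV[R]_n.+1).
Local Notation d := (dist_compl Omega).
Local Notation e_ i := (delta_mx ord0 i : 'rV[R]_n.+1).
Local Notation leb := (lebesgue_rV n.+1).

(** The infimum is nonnegative by [lambda_lower_bound], and below infinity because the midpoint of
    any minimal segment is a good point. *)
Lemma hardy_lambda_fin (n0 : (0 < n)%N) (p : R) : open Omega -> boundary Omega !=set0 ->
  C2_boundary Omega -> weakly_mean_convex Omega -> 1 < p ->
  exists2 l : R, hardy_lambda p Omega = (((p - 1) / p) `^ (p - 1) * l)%:E & 0 <= l /\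
    forall x y, inner_point Omega x y -> l * d x `^ (p - 1) <= - laplacian d x.
Proof.
move=> oO B0 C2 mc p1; have cO := domain_complement oO B0.
have p0 : 0 < p by exact: lt_trans p1.
have c0 : 0 < ((p - 1) / p) `^ (p - 1) by rewrite powR_gt0// divr_gt0 ?subr_gt0.
have := lambda_lower_bound n0 oO B0 C2 mc p1.
rewrite /hardy_lambda; set S := [set _ | _ in _].
have S_inner x y : inner_point Omega x y -> S (- laplacian d x / d x `^ (p - 1))%:E.
  by move=> /(inner_point_good oO cO C2); rewrite good_setE => Gx; exists x.
have [x [y xy]] : exists x y, inner_point Omega x y.
  have [b [/(_ setT filterT)[x [Ox _]] _]] := B0.
  have [y xy] := near_pt_ex oO cO x.
  exists (y + 2^-1 *: (x - y)), y, x, 2^-1; split => //.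
  by rewrite invr_gt0 ltr0n /= invf_lt1 ?ltr1n.
move=> lb; have S0 : (0 <= ereal_inf S)%E.
  rewrite -(pmule_rge0 _ (_ : 0 < (((p - 1) / p) `^ (p - 1))%:E)%E) ?lte_fin//.
  apply: le_trans lb; rewrite mule_ge0 ?poweR_ge0// lee_fin.
  by rewrite divr_ge0 ?powR_ge0// ltW.
have Sfin : ereal_inf S \is a fin_num.
  rewrite ge0_fin_numE//; apply: (@le_lt_trans _ _ (- laplacian d x / d x `^ (p - 1))%:E).
    by apply: ereal_inf_lbound; exact: S_inner xy.
  exact: ltry.
exists (fine (ereal_inf S)); first by rewrite EFinM fineK.
split; first exact: fine_ge0.
move=> z z' zz'; have [[Oz _ _] _] := inner_point_regular oO cO C2 zz'.
rewrite -ler_pdivlMr ?powR_gt0 ?(dist_gt0 oO cO)//.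
by rewrite -lee_fin fineK//; apply: ereal_inf_lbound; exact: S_inner zz'.
Qed.

Lemma grad_support (f : 'rV[R]_n.+1 -> R) x : ~ closure [set y | f y != 0] x -> grad f x = 0.
Proof. by move=> H; apply/rowP => i; rewrite !mxE partial_outside_support. Qed.

Lemma closure_cube (A : set 'rV[R]_n.+1) (B e : R) x : 0 < e -> A `<=` cube B ->
  closure A x -> cube (B + e) x.
Proof.
move=> e0 AB /(_ [set y | enorm (y - x) < e]) [].
  by apply/nbhs_enormP; exists e.
move=> y [/AB By /= ye] i; rewrite -[x](subrK y) addrC mxE.
rewrite (le_trans (ler_normD _ _))// lerD//.
by rewrite (le_trans (coord_le_enorm _ _))// -enormN opprB ltW.
Qed.

Lemma hardy_inequality (p l : R) (f : 'rV[R]_n.+1 -> R) (oO : open Omega)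
    (cO : ~` Omega !=set0) (C2 : C2_boundary Omega) : 1 < p -> 0 <= l ->
  (forall x y, inner_point Omega x y -> l * d x `^ (p - 1) <= - laplacian d x) ->
  test_function Omega f ->
  ((((p - 1) / p) `^ p)%:E * (\int[leb]_(x in Omega) (`|f x| `^ p / d x `^ p)%:E) +
   (((p - 1) / p) `^ (p - 1) * l)%:E * (\int[leb]_(x in Omega) (`|f x| `^ p)%:E) <=
   \int[leb]_(x in Omega) (enorm (grad f x) `^ p)%:E)%E.
Proof.
move=> p1 l0 lap tf; have p0 : 0 < p by exact: lt_trans p1.
have c0 : 0 < (p - 1) / p by rewrite divr_gt0 ?subr_gt0.
have [rho [L [M [B [rho0 L0 M0 fP fML]]]]] := test_function_bounds oO cO tf.
have tb : test_bounds Omega rho L M B f by split.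
have [Cf _ fO] := tf.
have [cf] := Cf 1%N; rewrite -/Ck => Dcf.
have cf' : continuous f by move=> x; exact: cf.
have cdf i : continuous (partial i f) by move=> x; have [_ [c _]] := Dcf i; exact: c.
have Df x i : is_derive x (e_ i) f (partial i f x).
  by have [D _] := Dcf i; apply: DeriveDef => //; exact: D.
have := hardy_gap_integral oO cO C2 p1 l0 lap tb cf' cdf Df.
have supp (F : 'rV[R]_n.+1 -> R) : (forall x, F x != 0 -> closure [set y | f y != 0] x) ->
    (\int[leb]_(x in cube (B + rho)) (F x)%:E = \int[leb]_(x in Omega) (F x)%:E)%E.
  move=> HF; apply: integral_support => x; rewrite eqe => /HF Fx; split; last exact: fO.
  by apply: closure_cube Fx => // y /= /fP[].
have f0 x : ~ closure [set y | f y != 0] x -> f x = 0.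
  by move=> H; apply/eqP/negPn/negP => fx; apply: H; exact: subset_closure.
rewrite !supp; first last.
- by move=> x; apply: contraPP => /f0 ->; rewrite normr0 powR0 ?eqxx// gt_eqF.
- by move=> x; apply: contraPP => /f0 ->; rewrite normr0 mul0r powR0 ?eqxx// gt_eqF.
- move=> x; apply: contraPP => /grad_support ->.
  by rewrite enorm0 powR0 ?eqxx// gt_eqF.
have -> : (\int[leb]_(x in Omega) (`|f x| `^ p / d x `^ p)%:E =
    \int[leb]_(x in Omega) ((`|f x| / d x) `^ p)%:E)%E.
  apply: eq_integral => x; rewrite inE => Ox; have dx := dist_gt0 oO cO Ox.
  congr (_%:E); rewrite powRM ?invr_ge0 ?(ltW dx)//; congr (_ * _).
  by rewrite -(powR_inv1 (ltW dx)) -powRrM mulN1r powRN.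
have I1 : (0 <= \int[leb]_(x in Omega) (`|f x| `^ p)%:E)%E.
  by apply: integral_ge0 => x _; rewrite lee_fin powR_ge0.
have I2 : (0 <= \int[leb]_(x in Omega) ((`|f x| / d x) `^ p)%:E)%E.
  by apply: integral_ge0 => x _; rewrite lee_fin powR_ge0.
move: I2 I1 ((p - 1) / p) c0.
move: (\int[leb]_(x in Omega) (`|f x| `^ p)%:E)%E.
move: (\int[leb]_(x in Omega) ((`|f x| / d x) `^ p)%:E)%E.
move: (\int[leb]_(x in Omega) (enorm (grad f x) `^ p)%:E)%E => I3 I2 I1 I20 I10 c c0 H.
have cp : 0 < c `^ (p - 1) by rewrite powR_gt0.
(* This factor turns the coefficients [l], [c], [c^(1-p)] into [c^(p-1) l], [c^p] and 1. *)
have := lee_wpmul2l (_ : 0 <= (c `^ (p - 1))%:E)%E H; rewrite lee_fin => /(_ (ltW cp)).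
rewrite muleA -EFinM -powRD ?(gt_eqF c0) ?implybT// (_ : p - 1 + (1 - p) = 0); last by ring.
rewrite powRr0 mul1e; apply: le_trans.
rewrite ge0_muleDr ?mule_ge0 ?lee_fin ?(ltW c0)// addeC !muleA -!EFinM.
by rewrite (powR_split (ltW c0) p1) (mulrC c).
Qed.

End conclusion.

Local Open Scope ereal_scope.

Theorem theorem4p3 (R : realType) (n : nat) (hn : (1 <= n)%N)
    (Omega : set 'rV[R]_n.+1)
    (domain_Omega : is_domain Omega)
    (boundary_neq0 : boundary Omega !=set0)
    (C2_Omega : C2_boundary Omega)
    (mean_convex_Omega : weakly_mean_convex Omega)
    (p : R) (hp : (1 < p)%R) :
  (p / n%:R `^ (p - 1))%:E * inf_mean_curvature Omega `^ p
    <= hardy_lambda p Omega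
  /\
  forall f : 'rV[R]_n.+1 -> R, test_function Omega f ->
    (((p - 1) / p) `^ p)%:E *
      (\int[lebesgue_rV n.+1]_(x in Omega)
         (`|f x| `^ p / dist_compl Omega x `^ p)%:E)
    + hardy_lambda p Omega *
      (\int[lebesgue_rV n.+1]_(x in Omega) (`|f x| `^ p)%:E)
    <= \int[lebesgue_rV n.+1]_(x in Omega) (enorm (grad f x) `^ p)%:E.
Proof.
have [oO _] := domain_Omega; have cO := domain_complement oO boundary_neq0.
split; first exact: lambda_lower_bound.
move=> f tf.
have [l -> [l0 lap]] := hardy_lambda_fin hn oO boundary_neq0 C2_Omega mean_convex_Omega hp.
exact: hardy_inequality.
Qed.
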